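(* Let $TV/(R)=A(\mathsf{w})$ be a $3$-Calabi-Yau algebra, where $\mathsf{w}\in V^{\otimes(m+1)}$ is a superpotential, let $x_1,\ldots,x_n$ be a basis of $V$, and fix an index $1\le k\le n$. Then $TV$ modulo the relations $$\partial_i\mathsf{w}=0,\qquad [x_i,\partial_k\mathsf{w}]=0\qquad (i=1,\ldots,n,\ i\ne k)$$ is a $4$-Calabi-Yau algebra and is a central extension of $A(\mathsf{w})$ by the image of $\partial_k\mathsf{w}$; that is, the image $\Omega$ of $\partial_k\mathsf{w}$ is a central regular element and the quotient by $(\Omega)$ is $A(\mathsf{w})$.
   Context: Fix a field $\Bbbk$; $V$ is an $n$-dimensional vector space, $TV$ its tensor algebra with $V$ in degree $1$, $m\ge 2$. Graded algebras are $\mathbb{N}$-graded, connected, finitely presented and generated in degree one. An element $\mathsf{w}\in V^{\otimes\ell}$ is a superpotential if it is invariant under $v_1\otimes\cdots\otimes v_\ell\mapsto v_\ell\otimes v_1\otimes\cdots\otimes v_{\ell-1}$. The partial derivative $\partial_i\colon TV\to TV$ (with respect to the basis) is the linear map with $\partial_i(x_i\mathsf{v})=\mathsf{v}$ and $\partial_i(\mathsf{u})=0$ for words $\mathsf{u}$ not beginning with $x_i$. $A(\mathsf{w}):=TV/(\partial_1\mathsf{w},\ldots,\partial_n\mathsf{w})$. Also $[x,y]=xy-yx$. For a graded algebra $A$ let $A^e=A\otimes A^{\circ}$; bimodules are left $A^e$-modules via $(a\otimes b)\cdot x=axb$. For a graded automorphism $\nu$, ${}_\nu A_1$ is $A$ with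 bimodule action $a\cdot c\cdot b=\nu(a)cb$. $A$ is twisted Calabi-Yau of dimension $d$ if, as a left $A^e$-module, $A$ has a finite-length resolution by finitely generated projectives and $\mathrm{Ext}^i_{A^e}(A,A^e)$ is $0$ for $i\ne d$ and isomorphic to ${}_\nu A_1(\ell)$ for $i=d$ (as graded right $A^e$-modules, i.e. bimodules), for some $\ell\in\mathbb{Z}$ and some graded algebra automorphism $\nu$ (the Nakayama automorphism). It is $d$-Calabi-Yau if moreover $\nu=\mathrm{id}_A$. (When $A(\mathsf w)$ is $3$-Calabi-Yau the defining twisted superpotential is a superpotential.) *)

(* Defs.v *)
From HB Require Import structures.
From mathcomp Require Import all_boot all_order all_algebra.
From mathcomp Require Import finmap.
From mathcomp.multinomials Require Import monalg.
From mathcomp.classical Require Import boolp.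

Set Implicit Arguments.
Unset Strict Implicit.
Unset Printing Implicit Defensive.

Import GRing.Theory.
Local Open Scope ring_scope.
Local Open Scope quotient_scope.

(* Associative unital algebras over a field, given by a central ring morphism
   from K.  They may be zero: algType requires 1 != 0, which fails for a
   quotient by the unit ideal. *)
HB.mixin Record isKAlg (K : fieldType) A of GRing.PzRing A := {
  kscal : K -> A;
  kscal_is_zmod_morphism : zmod_morphism kscal;
  kscal_is_monoid_morphism : monoid_morphism kscal;
  kscalC : forall c x, kscal c * x = x * kscal c
}.

#[short(type="kalgType")]
HB.structure Definition KAlg (K : fieldType) :=
  {A of GRing.PzRing A & isKAlg K A}.

HB.instance Definition _ (K : fieldType) (A : kalgType K) :=
  GRing.isZmodMorphism.Build K A (@kscal K A) (@kscal_is_zmod_morphism K A).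
HB.instance Definition _ (K : fieldType) (A : kalgType K) :=
  GRing.isMonoidMorphism.Build K A (@kscal K A)
    (@kscal_is_monoid_morphism K A).

(* Monoid algebra K[M].  The ring structure of monalg.v is not available in
   general, because its monoids have no nontrivial invertible elements; only
   its additive structure is reused. *)
Definition monoid_alg (K : fieldType) (M : monoidType) : Type := {malg K[M]}.

Section MonoidAlgebra.
Context {K : fieldType} {M : monoidType}.
Local Notation KM := (monoid_alg K M).

HB.instance Definition _ := GRing.Lmodule.on KM.

Definition monom (u : M) : KM := << u >>.

Definition linext (V : lmodType K) (f : M -> V) (p : KM) : V :=
  \sum_(u <- msupp p) p@_u *: f u.

Lemma linextEw (V : lmodType K) (f : M -> V) (p : KM) (d : {fset M}) :
  (msupp p `<=` d)%fset -> linext f p = \sum_(u <- d) p@_u *: f u.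
Proof.
move=> le; rewrite /linext (big_fset_incl _ le) //= => u _.
by move/mcoeff_outdom=> ->; rewrite scale0r.
Qed.

Lemma linext_is_linear (V : lmodType K) (f : M -> V) : linear (linext f).
Proof.
move=> c p q.
have le1 : (msupp p `<=` msupp p `|` msupp q)%fset by exact: fsubsetUl.
have le2 : (msupp q `<=` msupp p `|` msupp q)%fset by exact: fsubsetUr.
have le3 : (msupp (c *: p + q) `<=` msupp p `|` msupp q)%fset.
  apply: fsubset_trans (msuppD_le _ _) _; apply: fsetSU; exact: msuppZ_le.
rewrite (linextEw f le1) (linextEw f le2) (linextEw f le3).
rewrite scaler_sumr -big_split /=; apply: eq_bigr => u _.
by rewrite mcoeffD mcoeffZ scalerDl scalerA.
Qed.

HB.instance Definition _ (V : lmodType K) (f : M -> V) :=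
  GRing.isLinear.Build K KM V *:%R (linext f) (linext_is_linear f).

Lemma linext_monom (V : lmodType K) (f : M -> V) u : linext f (monom u) = f u.
Proof.
rewrite (linextEw f (d := [fset u]%fset)); last exact: msuppU_le.
by rewrite big_seq_fset1 mcoeffUU scale1r.
Qed.

Lemma monom_expand (p : KM) : p = linext monom p.
Proof.
rewrite {1}[p]monalgE /linext; apply: eq_bigr => u _.
apply/malgP => v; rewrite mcoeffZ !mcoeffU.
by rewrite mulr_natr.
Qed.

Lemma eq_linext (V : lmodType K) (f g : {linear KM -> V}) :
  (forall u, f (monom u) = g (monom u)) -> f =1 g.
Proof.
move=> fg p; rewrite [p]monom_expand /linext !linear_sum.
by apply: eq_bigr => u _; rewrite !linearZ /= fg.
Qed.

Definition mamul (p q : KM) : KM :=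
  linext (fun u => linext (fun v => monom (u * v)%g) q) p.

Definition mamulr q p := mamul p q.

Lemma mamul_linearl q : linear (mamulr q).
Proof. by move=> c p p'; rewrite /mamulr /mamul linearP. Qed.

Lemma mamul_linearr p : linear (mamul p).
Proof.
move=> c q q'; rewrite /mamul /linext scaler_sumr -big_split /=.
apply: eq_bigr => u _; rewrite -!/(linext _ _) linearP.
by rewrite scalerDr !scalerA mulrC.
Qed.

HB.instance Definition _ q :=
  GRing.isLinear.Build K KM KM *:%R (mamulr q) (mamul_linearl q).
HB.instance Definition _ p :=
  GRing.isLinear.Build K KM KM *:%R (mamul p) (mamul_linearr p).

Lemma mamulUU u v : mamul (monom u) (monom v) = monom (u * v)%g.
Proof. by rewrite /mamul !linext_monom. Qed.

Lemma mamulA : associative mamul.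
Proof.
move=> p q r.
pose f1 : {linear KM -> KM} := mamulr (mamul q r).
pose f2 : {linear KM -> KM} := mamulr r \o mamulr q.
apply: (eq_linext (f := f1) (g := f2)) => u; rewrite /f1 /f2 /= /mamulr.
pose g1 : {linear KM -> KM} := mamul (monom u) \o mamulr r.
pose g2 : {linear KM -> KM} := mamulr r \o mamul (monom u).
apply: (eq_linext (f := g1) (g := g2)) => v; rewrite /g1 /g2 /= /mamulr.
pose h1 : {linear KM -> KM} := mamul (monom u) \o mamul (monom v).
pose h2 : {linear KM -> KM} := mamul (mamul (monom u) (monom v)).
apply: (eq_linext (f := h1) (g := h2)) => t; rewrite /h1 /h2 /= /mamulr.
by rewrite !mamulUU mulgA.
Qed.

Lemma mamul1 : left_id (monom 1%g) mamul.
Proof.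
move=> p; pose f : {linear KM -> KM} := mamul (monom 1%g).
apply: (eq_linext (f := f) (g := idfun)) => u; rewrite /f /= /mamulr.
by rewrite mamulUU mul1g.
Qed.

Lemma mamulr1 : right_id (monom 1%g) mamul.
Proof.
move=> p; pose f : {linear KM -> KM} := mamulr (monom 1%g).
apply: (eq_linext (f := f) (g := idfun)) => u; rewrite /f /= /mamulr.
by rewrite mamulUU mulg1.
Qed.

Lemma mamulDl : left_distributive mamul +%R.
Proof. by move=> p q r; rewrite [LHS](linearD (mamulr r)). Qed.

Lemma mamulDr : right_distributive mamul +%R.
Proof. by move=> p q r; rewrite [LHS](linearD (mamul p)). Qed.

HB.instance Definition _ := GRing.Zmodule_isPzRing.Build KM
  mamulA mamul1 mamulr1 mamulDl mamulDr.

Lemma mascaleAl (c : K) (p q : KM) : c *: (p * q) = (c *: p) * q.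
Proof. exact: (esym (linearZ_LR (mamulr q) c p)). Qed.

Lemma mascaleAr (c : K) (p q : KM) : c *: (p * q) = p * (c *: q).
Proof. exact: (esym (linearZ_LR (mamul p) c q)). Qed.

Definition ma_scal (c : K) : KM := c *: monom 1%g.

Lemma ma_scal_is_zmod_morphism : zmod_morphism ma_scal.
Proof. by move=> c d; rewrite /ma_scal scalerBl. Qed.

Lemma ma_scal_is_monoid_morphism : monoid_morphism ma_scal.
Proof.
split=> [|c d]; rewrite /ma_scal ?scale1r //.
by rewrite -mascaleAl [monom 1%g * _]mamul1 scalerA.
Qed.

Lemma ma_scalC c (p : KM) : ma_scal c * p = p * ma_scal c.
Proof. by rewrite /ma_scal -mascaleAl -mascaleAr [_ * p]mamul1 [p * _]mamulr1. Qed.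

HB.instance Definition _ := isKAlg.Build K KM
  ma_scal_is_zmod_morphism ma_scal_is_monoid_morphism ma_scalC.

End MonoidAlgebra.

Section QuotientAlgebra.
Context {K : fieldType} {A : kalgType K}.
Implicit Types (S I : A -> Prop).

Record two_sided_ideal I : Prop := TwoSidedIdeal {
  ideal0 : I 0;
  idealB : forall x y, I x -> I y -> I (x - y);
  idealM : forall a x b, I x -> I (a * x * b)
}.

Definition ideal_gen S (x : A) : Prop :=
  forall I, two_sided_ideal I -> (forall s, S s -> I s) -> I x.

Lemma ideal_genP S : two_sided_ideal (ideal_gen S).
Proof.
split=> [|x y Sx Sy|a x b Sx] I II SI; first exact: ideal0.
  by apply: idealB => //; [apply: Sx | apply: Sy].
by apply: idealM => //; apply: Sx.
Qed.

Lemma ideal_gen_sub S s : S s -> ideal_gen S s.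
Proof. by move=> Ss I _; apply. Qed.

Variable S : A -> Prop.

Definition ideal_pred : {pred A} := fun x => `[< ideal_gen S x >].

Lemma ideal_predP x : reflect (ideal_gen S x) (x \in ideal_pred).
Proof. exact: asboolP. Qed.

Lemma ideal_pred_zmod_closed : zmod_closed ideal_pred.
Proof.
split; first by apply/ideal_predP; exact: (ideal0 (ideal_genP S)).
move=> x y /ideal_predP Sx /ideal_predP Sy.
by apply/ideal_predP; exact: (idealB (ideal_genP S) Sx Sy).
Qed.

HB.instance Definition _ :=
  GRing.isZmodClosed.Build A ideal_pred ideal_pred_zmod_closed.

Definition quot_alg : Type := Quotient.quot ideal_pred.

HB.instance Definition _ := GRing.Zmodule.on quot_alg.

Definition quot_pi (x : A) : quot_alg := \pi_(Quotient.quot ideal_pred) x.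
Definition quot_repr (x : quot_alg) : A := repr (x : Quotient.quot ideal_pred).

Lemma quot_reprK : cancel quot_repr quot_pi.
Proof. by move=> x; rewrite /quot_pi /quot_repr reprK. Qed.

Lemma quot_eqP x y : quot_pi x = quot_pi y <-> ideal_gen S (x - y).
Proof.
rewrite /quot_pi; split=> [/eqP|h].
  by rewrite -Quotient.idealrBE => /ideal_predP.
by apply/eqP; rewrite -Quotient.idealrBE; apply/ideal_predP.
Qed.

Lemma quot_piD : {morph quot_pi : x y / x + y}.
Proof. by move=> x y; rewrite /quot_pi Quotient.pi_add. Qed.

Lemma quot_pi_is_zmod_morphism : zmod_morphism quot_pi.
Proof. by move=> x y; rewrite quot_piD /quot_pi Quotient.pi_opp. Qed.

HB.instance Definition _ :=
  GRing.isZmodMorphism.Build A quot_alg quot_pi quot_pi_is_zmod_morphism.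

Definition quot_mul (x y : quot_alg) := quot_pi (quot_repr x * quot_repr y).

Lemma quot_piM x y : quot_pi (x * y) = quot_mul (quot_pi x) (quot_pi y).
Proof.
apply/quot_eqP; set x' := quot_repr _; set y' := quot_repr _.
have /quot_eqP hx : quot_pi x = quot_pi x' by rewrite quot_reprK.
have /quot_eqP hy : quot_pi y = quot_pi y' by rewrite quot_reprK.
have -> : x * y - x' * y' = 1 * (x - x') * y - (- x') * (y - y') * 1.
  by rewrite mul1r mulr1 mulNr opprK mulrBl mulrBr addrA subrK.
have J := ideal_genP S.
by apply: (idealB J); apply: (idealM J).
Qed.

Lemma quot_mulA : associative quot_mul.
Proof.
move=> x y z; rewrite -[x]quot_reprK -[y]quot_reprK -[z]quot_reprK.
by rewrite -!quot_piM mulrA.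
Qed.

Lemma quot_mul1 : left_id (quot_pi 1) quot_mul.
Proof. by move=> x; rewrite -[x]quot_reprK -quot_piM mul1r. Qed.

Lemma quot_mulr1 : right_id (quot_pi 1) quot_mul.
Proof. by move=> x; rewrite -[x]quot_reprK -quot_piM mulr1. Qed.

Lemma quot_mulDl : left_distributive quot_mul +%R.
Proof.
move=> x y z; rewrite -[x]quot_reprK -[y]quot_reprK -[z]quot_reprK.
by rewrite -quot_piD -!quot_piM -quot_piD mulrDl.
Qed.

Lemma quot_mulDr : right_distributive quot_mul +%R.
Proof.
move=> x y z; rewrite -[x]quot_reprK -[y]quot_reprK -[z]quot_reprK.
by rewrite -quot_piD -!quot_piM -quot_piD mulrDr.
Qed.

HB.instance Definition _ := GRing.Zmodule_isPzRing.Build quot_alg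
  quot_mulA quot_mul1 quot_mulr1 quot_mulDl quot_mulDr.

Lemma quot_pi_is_monoid_morphism : monoid_morphism quot_pi.
Proof. by split=> // x y; rewrite quot_piM. Qed.

HB.instance Definition _ :=
  GRing.isMonoidMorphism.Build A quot_alg quot_pi quot_pi_is_monoid_morphism.

Definition quot_scal (c : K) : quot_alg := quot_pi (kscal c).

Lemma quot_scal_is_zmod_morphism : zmod_morphism quot_scal.
Proof. by move=> c d; rewrite /quot_scal !rmorphB. Qed.

Lemma quot_scal_is_monoid_morphism : monoid_morphism quot_scal.
Proof. by split=> [|c d]; rewrite /quot_scal ?rmorphM ?rmorph1. Qed.

Lemma quot_scalC c (x : quot_alg) : quot_scal c * x = x * quot_scal c.
Proof. by rewrite -[x]quot_reprK /quot_scal -!rmorphM kscalC. Qed.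

HB.instance Definition _ := isKAlg.Build K quot_alg
  quot_scal_is_zmod_morphism quot_scal_is_monoid_morphism quot_scalC.

End QuotientAlgebra.

(* The tensor algebra of the vector space with basis x_0, ..., x_(n-1), with
   the words in the x_i as K-basis; wordX u is the word u, tX i the letter x_i. *)
Definition word (n : nat) : Type := seq 'I_n.

HB.instance Definition _ n := Choice.on (word n).
HB.instance Definition _ n := isMonoid.Build (word n)
  (@catA 'I_n) (@cat0s 'I_n) (@cats0 'I_n).

Definition tensor_alg (K : fieldType) (n : nat) := monoid_alg K (word n).

Section TensorAlgebra.
Context {K : fieldType} {n : nat}.
Local Notation TV := (tensor_alg K n).

Definition wordX (u : word n) : TV := monom u.

Definition tX (i : 'I_n) : TV := wordX [:: i].

(* V^{\otimes d} as a subset of TV *)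
Definition tens_deg (d : nat) (p : TV) : Prop :=
  forall u : word n, p@_u != 0 -> size u = d.

Definition rotation : TV -> TV := linext (fun u : word n => wordX (rotr 1 u)).

Definition superpotential (l : nat) (w : TV) : Prop :=
  tens_deg l w /\ rotation w = w.

Definition pderiv (i : 'I_n) : TV -> TV :=
  linext (fun u : word n =>
    if u is j :: v then (if j == i then wordX v else 0) else 0).

Definition commutator (p q : TV) : TV := p * q - q * p.

Definition jacobian_rel (w : TV) (r : TV) : Prop := exists i, r = pderiv i w.

Definition jacobian_alg (w : TV) := quot_alg (jacobian_rel w).

Definition extension_rel (w : TV) (k : 'I_n) (r : TV) : Prop :=
  exists2 i : 'I_n, i != k &
    r = pderiv i w \/ r = commutator (tX i) (pderiv k w).

Definition extension_alg (w : TV) (k : 'I_n) := quot_alg (extension_rel w k).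

Definition quot_deg (R : TV -> Prop) (d : nat) (a : quot_alg R) : Prop :=
  exists2 p : TV, tens_deg d p & a = quot_pi R p.

End TensorAlgebra.

Arguments quot_deg {K n} R d a.

Section EnvelopingAlgebra.
Context {K : fieldType}.

Definition env_pair (A : kalgType K) : Type := (A * A)%type.
HB.instance Definition _ A := Choice.on (env_pair A).

Definition env_mul (A : kalgType K) (s t : env_pair A) : env_pair A :=
  (s.1 * t.1, t.2 * s.2).

Lemma env_mulA A : associative (@env_mul A).
Proof. by move=> s t u; rewrite /env_mul /= !mulrA. Qed.
Lemma env_mul1 A : left_id ((1, 1) : env_pair A) (@env_mul A).
Proof. by case=> a b; rewrite /env_mul /= mul1r mulr1. Qed.
Lemma env_mulr1 A : right_id ((1, 1) : env_pair A) (@env_mul A).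
Proof. by case=> a b; rewrite /env_mul /= mul1r mulr1. Qed.

HB.instance Definition _ A :=
  isMonoid.Build (env_pair A) (@env_mulA A) (@env_mul1 A) (@env_mulr1 A).

Variable A : kalgType K.

Let sym (a b : A) : monoid_alg K (env_pair A) := monom ((a, b) : env_pair A).

Inductive bilinear_rel : monoid_alg K (env_pair A) -> Prop :=
| BilinDl a a' b : bilinear_rel (sym (a + a') b - sym a b - sym a' b)
| BilinDr a b b' : bilinear_rel (sym a (b + b') - sym a b - sym a b')
| BilinZl c a b : bilinear_rel (sym (kscal c * a) b - kscal c * sym a b)
| BilinZr c a b : bilinear_rel (sym a (kscal c * b) - kscal c * sym a b).

(* A^e = A \otimes_K A^op, presented as the monoid algebra of (A, .) x (A, .)^op
   modulo bilinearity of the symbols. *)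
Definition env_alg := quot_alg bilinear_rel.

Definition tens (a b : A) : env_alg := quot_pi bilinear_rel (sym a b).

End EnvelopingAlgebra.

Record is_grading (I : eqType) (V : zmodType) (gr : I -> V -> Prop) : Prop := {
  gr_0 : forall i, gr i 0;
  gr_B : forall i x y, gr i x -> gr i y -> gr i (x - y);
  gr_span : forall x, exists (s : seq I) (c : I -> V),
    (forall i, gr i (c i)) /\ x = \sum_(i <- s) c i;
  gr_indep : forall (s : seq I) (c : I -> V), uniq s ->
    (forall i, gr i (c i)) -> \sum_(i <- s) c i = 0 ->
    forall i, i \in s -> c i = 0
}.

(* N-graded, connected, finitely presented and generated in degree one *)
Record graded_algebra (K : fieldType) (A : kalgType K) (gr : nat -> A -> Prop)
    : Prop := {
  ga_grading : is_grading gr;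
  ga_1 : gr 0%N 1;
  ga_M : forall i j a b, gr i a -> gr j b -> gr (i + j)%N (a * b);
  ga_nz : (1 : A) != 0;
  ga_connected : forall a, gr 0%N a -> exists c : K, a = kscal c;
  ga_presented : exists (n : nat) (f : {rmorphism tensor_alg K n -> A})
      (rs : seq (tensor_alg K n)),
    [/\ forall c, f (kscal c) = kscal c, forall a, exists p, f p = a,
        forall i : 'I_n, gr 1%N (f (tX i))
      & forall p, f p = 0 <-> ideal_gen (fun r => r \in rs) p]
}.

Definition finitely_generated (R : pzRingType) (P : lmodType R) : Prop :=
  exists (r : nat) (e : 'I_r -> P),
    forall p, exists c : 'I_r -> R, p = \sum_i c i *: e i.

Definition projective (R : pzRingType) (P : lmodType R) : Prop :=
  forall (M N : lmodType R) (g : {linear M -> N}) (f : {linear P -> N}),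
    (forall y, exists x, g x = y) ->
    exists h : {linear P -> M}, forall p, g (h p) = f p.

Section CalabiYau.
Context {K : fieldType} {A : kalgType K} (gr : nat -> A -> Prop).
Local Notation E := (env_alg A).

Definition grZ (d : int) (a : A) : Prop :=
  match d with Posz n => gr n a | Negz _ => a = 0 end.

Definition env_deg (d : int) (u : E) : Prop :=
  exists (r : nat) (i j : 'I_r -> nat) (a b : 'I_r -> A),
    (forall t, [/\ gr (i t) (a t), gr (j t) (b t) & (i t + j t)%N%:Z = d])
    /\ u = \sum_t tens (a t) (b t).

(* Resolution of A, with (a \otimes b) x = a x b, by finitely generated graded
   projective left A^e-modules, with maps homogeneous of degree 0. *)
Record fg_proj_resolution : Type := {
  res_P : nat -> lmodType E;
  res_deg : forall i, int -> res_P i -> Prop;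
  res_d : forall i, {linear res_P i.+1 -> res_P i};
  res_eps : {additive res_P 0%N -> A};
  res_grading : forall i, is_grading (@res_deg i);
  res_graded : forall i j l u p,
    env_deg j u -> res_deg l p -> res_deg (j + l) (u *: p : res_P i);
  res_fg : forall i, finitely_generated (res_P i);
  res_proj : forall i, projective (res_P i);
  res_finite : exists N : nat, forall i, (N < i)%N -> forall p : res_P i, p = 0;
  res_d_deg : forall i l p, res_deg l p -> res_deg l (res_d i p);
  res_eps_deg : forall l p, res_deg l p -> grZ l (res_eps p);
  res_eps_lin : forall a b p, res_eps (tens a b *: p) = a * res_eps p * b;
  res_eps_surj : forall a, exists p, res_eps p = a;
  res_exact0 : forall p, res_eps p = 0 <-> exists q, p = res_d 0%N q;
  res_exact : forall i p, res_d i p = 0 <-> exists q, p = res_d i.+1 q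
}.

Variable P : fg_proj_resolution.

(* Cocycles and coboundaries of the complex Hom_{A^e}(P_i, A^e), whose
   cohomology is Ext^i_{A^e}(A, A^e). *)
Definition cocycle (i : nat) (f : res_P P i -> E) : Prop :=
  linear_for *%R f /\ forall q, f (res_d P i q) = 0.

Definition coboundary (i : nat) : (res_P P i -> E) -> Prop :=
  match i with
  | 0 => fun f => forall p, f p = 0
  | j.+1 => fun f => exists2 g : res_P P j -> E,
      linear_for *%R g & forall p, f p = g (res_d P j p)
  end.

Definition hom_deg (i : nat) (l : int) (f : res_P P i -> E) : Prop :=
  forall j p, res_deg j p -> env_deg (l + j) (f p).

(* Ext^i is the graded bimodule _nu A_1 (l): phi is the composite of the
   projection from cocycles to cohomology with an isomorphism.  The right
   A^e-action is (f u)(p) = f(p) u, and the right action of a \otimes b on a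
   bimodule is c |-> b . c . a; also A(l)_j = A_(l + j). *)
Definition ext_is_twisted (i : nat) (nu : A -> A) (l : int) : Prop :=
  exists phi : (res_P P i -> E) -> A,
    [/\ forall f g, cocycle f -> cocycle g -> phi (f \+ g) = phi f + phi g,
        forall f, cocycle f -> (phi f = 0 <-> coboundary f),
        forall c, exists2 f, cocycle f & phi f = c,
        forall f a b, cocycle f ->
          phi (fun p => f p * tens a b) = nu b * phi f * a
      & forall j f, cocycle f -> hom_deg j f -> grZ (l + j) (phi f)].

Definition ext_vanishes (i : nat) : Prop :=
  forall f : res_P P i -> E, cocycle f -> coboundary f.

End CalabiYau.

Section CalabiYauAlgebra.
Context {K : fieldType} {A : kalgType K} (gr : nat -> A -> Prop).

Definition graded_automorphism (nu : A -> A) : Prop :=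
  [/\ zmod_morphism nu, monoid_morphism nu,
      forall c, nu (kscal c) = kscal c, bijective nu
    & forall i a, gr i a -> gr i (nu a)].

Definition twisted_calabi_yau (d : nat) (nu : A -> A) : Prop :=
  [/\ graded_algebra gr, graded_automorphism nu
    & exists (P : fg_proj_resolution gr) (l : int),
        (forall i, i != d -> ext_vanishes P i) /\ ext_is_twisted P d nu l].

Definition calabi_yau (d : nat) : Prop := twisted_calabi_yau d idfun.

End CalabiYauAlgebra.

Definition central_regular (R : pzRingType) (z : R) : Prop :=
  [/\ forall y, z * y = y * z, GRing.lreg z & GRing.rreg z].

(* Main.v *)
(* Write [A] for the 3-Calabi-Yau algebra, [B] for the extension, [f_i] for the
   partial derivatives of [w], [Omega] for the image of [f_k] in [B], and
   [Hess] for the matrix over the enveloping algebra whose entries are the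
   components of the universal derivation of the [f_i].  Since [w] is a
   superpotential, [Hess] is invariant under transposition combined with the
   swap [a (x) b |-> b (x) a].  Hence the complex
     [A^e -> (A^e)^n -> (A^e)^n -> A^e]
   given by [X^T], [Hess] and [X = (x_i (x) 1 - 1 (x) x_i)_i] is self-dual, and
   as a presentation of [A] it is exact at its last two places.  Comparing it
   with a given resolution, [Ext^0 = 0] and [Ext^1 = 0] for [A] say that [X^T]
   is injective and that the complex is exact at the first [(A^e)^n].

   Regularity of [Omega] is a statement about syzygies [sum t_i f_i = 0] over
   the free algebra: the class of [t_k] vanishes in [B].  By exactness at the
   Hessian, [t] is a multiple of [sum x_i f_i = sum f_i x_i] modulo entries
   that die in [A^e]; removing the first letter of those lowers the degree.

   Over [B] the composites of consecutive maps of the complex are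
   [zeta = Omega (x) 1 - 1 (x) Omega] times a matrix unit.  These matrix units
   deform the cone of [zeta] into a complex of length 4.  It is exact because
   [B^e] modulo the regular elements [Omega (x) 1] and [1 (x) Omega] is [A^e],
   and it inherits self-duality, which computes [Ext(B, B^e)] with trivial
   Nakayama automorphism. *)

Require Import Defs.
From HB Require Import structures.
From mathcomp Require Import all_boot all_order all_algebra.
From mathcomp Require Import finmap.
From mathcomp.multinomials Require Import monalg.
From mathcomp.classical Require Import boolp classical_sets.

Set Implicit Arguments.
Unset Strict Implicit.
Unset Printing Implicit Defensive.

Import GRing.Theory Num.Theory Order.TTheory.
Local Open Scope ring_scope.

(** The matrix units come from the identity [sum_j D_j(a) (x_j (x) 1 - 1 (x) x_j) = a (x) 1 - 1 (x)
    a] of the universal derivation [D]. Applied to [f_i], its right side becomes 0 in [B^e] unless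
    [i = k], when it is [zeta]; this gives [Hess X]. The swap changes the sign of both [X] and
    [zeta], so it gives [X^T Hess] with the same sign.

    The resolution of [A] provided by the hypothesis is arbitrary: its ranks are unknown and it need
    not be minimal. It is therefore compared with the Hessian complex on single cochains, through a
    lift of the augmentation to [A^e].

    No Hilbert series enters. Regularity of [Omega] and exactness of the deformed cone are both
    descents on the degree, which is why the maps are kept homogeneous. In the cone, a cycle is,
    modulo boundaries, [1 (x) Omega] times a cycle of smaller degree. This uses that [1 (x) Omega],
    [Omega (x) 1] is a regular sequence, so regularity of [Omega] has to come first. *)

Section LinearSection.
Context {K : fieldType}.

(** A Zorn-maximal subspace [U] meeting [W] only in 0 is a complement of [W]: a vector outside
    [W + U] could be adjoined to [U]. The [W]-component is then unique, hence linear. *)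
Lemma linear_projection (V : lmodType K) (W : V -> Prop) :
    W 0 -> (forall c x y, W x -> W y -> W (c *: x + y)) ->
  exists p : {linear V -> V}, (forall x, W (p x)) /\ (forall x, W x -> p x = x).
Proof.
move=> W0 WP.
have WD x y : W x -> W y -> W (x + y).
  by move=> Wx Wy; rewrite -[x]scale1r; apply: WP.
have WZ c x : W x -> W (c *: x).
  by move=> Wx; rewrite -[_ *: _]addr0; apply: WP.
pose P (U : set V) := (forall c x y, U x -> U y -> U (c *: x + y)) /\
                      (forall x, U x -> W x -> x = 0).
have chainP F : (F `<=` P)%classic -> total_on F subset ->
    P (\bigcup_(X in F) X)%classic.
  move=> FP Ftot; split=> [c x y [X FX Xx] [Y FY Yy]|x [X FX Xx]]; last first.
    by case: (FP X FX) => _; apply.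
  have [XY|YX] := Ftot X Y FX FY.
    by exists Y => //; apply: (proj1 (FP Y FY)) => //; apply: XY.
  by exists X => //; apply: (proj1 (FP X FX)) => //; apply: YX.
have [U [[UP UW] Umax]] := Zorn_bigcup chainP.
(* The union of the empty chain must satisfy [P], so [P] does not ask for 0 in [U]; [U0] adds it. *)
pose U0 x := U x \/ x = 0.
have U0P c x y : U0 x -> U0 y -> U0 (c *: x + y).
  move=> [Ux|->] [Uy|->]; rewrite ?scaler0 ?add0r /U0; auto.
  left; have -> : c *: x + 0 = (c - 1) *: x + x by rewrite addr0 scalerBl scale1r subrK.
  exact: UP.
have U0D x y : U0 x -> U0 y -> U0 (x + y).
  by move=> Ux Uy; rewrite -[x]scale1r; apply: U0P.
have U0Z c x : U0 x -> U0 (c *: x).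
  by move=> Ux; rewrite -[_ *: _]addr0; apply: U0P => //; right.
have U0W x : U0 x -> W x -> x = 0 by move=> [Ux|//]; apply: UW.
have dec x : exists y, W y /\ U0 (x - y).
  apply: contrapT => nx.
  pose B z := exists c u, U0 u /\ z = c *: x + u.
  apply: (Umax B); last first.
    split=> [c z z' [d [u [Uu ->]]] [d' [u' [Uu' ->]]]|z [c [u [Uu ->]]] Wz].
      exists (c * d + d'), (c *: u + u'); split; first exact: U0P.
      by rewrite scalerDr scalerDl scalerA !addrA; congr (_ + _); rewrite addrAC.
    have [c0|nc] := eqVneq c 0.
      by move: Wz; rewrite c0 scale0r add0r; apply: U0W.
    case: nx; exists (c^-1 *: (c *: x + u)); split; first exact: WZ.
    rewrite scalerDr scalerA mulVf // scale1r opprD addrA subrr add0r.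
    by rewrite -scaleNr; apply: U0Z.
  split=> [z Uz|UB]; first by exists 0, z; rewrite scale0r add0r; split=> //; left.
  have /UB Ux : B x by exists 1, 0; rewrite scale1r addr0; split=> //; right.
  by case: nx; exists 0; rewrite subr0; split=> //; left.
have [p pP] := choice dec.
have uniqp x y : W y -> U0 (x - y) -> p x = y.
  move=> Wy Uy; have [Wp Up] := pP x; apply/eqP; rewrite -subr_eq0; apply/eqP.
  apply: U0W; last by rewrite -scaleN1r addrC; apply: WP.
  have -> : p x - y = (-1) *: (x - p x) + (x - y).
    by rewrite scaleN1r opprB addrA subrK.
  exact: U0P.
have plin : linear p.
  move=> c x y; have [Wx Ux] := pP x; have [Wy Uy] := pP y.
  apply: uniqp; first exact: WP.
  have -> : c *: x + y - (c *: p x + p y) = c *: (x - p x) + (y - p y).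
    by rewrite scalerBr opprD addrACA.
  exact: U0P.
pose pL : {linear V -> V} := HB.pack p (GRing.isLinear.Build K V V *:%R p plin).
exists pL; split=> x; first by case: (pP x).
by move=> Wx; apply: uniqp => //; rewrite subrr; right.
Qed.

(** Any choice of preimages becomes linear after subtracting components in the kernel of [f], since
    the result no longer depends on the choice. *)
Lemma linear_section (V W : lmodType K) (f : {linear V -> W}) :
  (forall y, exists x, f x = y) ->
  exists s : {linear W -> V}, forall y, f (s y) = y.
Proof.
move=> fsurj.
have [] := @linear_projection V (fun x => f x = 0) (linear0 f).
  by move=> c x y fx fy; rewrite linearP fx fy scaler0 add0r.
move=> p [p0 pid]; have [g gP] := choice fsurj.
have spec x y : f x = y -> x - p x = g y - p (g y).
  move=> fx; have : p (x - g y) = x - g y.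
    by apply: pid; rewrite linearB /= fx gP subrr.
  rewrite linearB /= => e; have {1}-> : x = p x - p (g y) + g y by rewrite e subrK.
  by rewrite addrC -[_ + _ + g y]addrA addKr addrC.
pose s y := g y - p (g y).
have slin : linear s.
  move=> c x y; rewrite /s -(spec (c *: g x + g y) (c *: x + y)).
    by rewrite linearP scalerBr opprD addrACA.
  by rewrite linearP /= !gP.
pose sL : {linear W -> V} := HB.pack s (GRing.isLinear.Build K W V *:%R s slin).
by exists sL => y /=; rewrite /s linearB /= gP p0 subr0.
Qed.

Lemma linear_retraction (V W : lmodType K) (f : {linear V -> W}) :
  injective f -> exists r : {linear W -> V}, forall x, r (f x) = x.
Proof.
move=> finj.
have [] := @linear_projection W (fun y => exists x, f x = y).
- by exists 0; rewrite linear0.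
- by move=> c _ _ [x <-] [y <-]; exists (c *: x + y); rewrite linearP.
move=> p [pim pid]; have [g gP] := choice pim.
have glin : linear g.
  by move=> c x y; apply: finj; rewrite gP linearP /= !linearP /= !gP.
pose gL : {linear W -> V} := HB.pack g (GRing.isLinear.Build K W V *:%R g glin).
by exists gL => x /=; apply: finj; rewrite gP pid //; exists x.
Qed.

End LinearSection.

(* [kalgType] comes without a scaling operation; this alias carries one. *)
Definition kmod (K : fieldType) (A : kalgType K) : Type := A.

Section Kmod.
Context {K : fieldType} (A : kalgType K).
HB.instance Definition _ := GRing.PzRing.on (kmod A).

Definition kmod_scale (c : K) (x : kmod A) : kmod A := kscal c * (x : A).

Fact kmod_scaleA a b v : kmod_scale a (kmod_scale b v) = kmod_scale (a * b) v.
Proof. by rewrite /kmod_scale rmorphM mulrA. Qed.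
Fact kmod_scale1 : left_id 1 kmod_scale.
Proof. by move=> x; rewrite /kmod_scale rmorph1 mul1r. Qed.
Fact kmod_scaleDr : right_distributive kmod_scale +%R.
Proof. by move=> c x y; rewrite /kmod_scale mulrDr. Qed.
Fact kmod_scaleDl v : {morph kmod_scale^~ v : a b / a + b}.
Proof. by move=> a b; rewrite /kmod_scale rmorphD mulrDl. Qed.

HB.instance Definition _ := GRing.Zmodule_isLmodule.Build K (kmod A)
  kmod_scaleA kmod_scale1 kmod_scaleDr kmod_scaleDl.

Lemma kmodZE c (x : kmod A) : c *: x = (kscal c * (x : A) : A).
Proof. by []. Qed.

End Kmod.

Section MonoidAlgebraFacts.
Context {K : fieldType} {M : monoidType}.
Local Notation KM := (monoid_alg K M).

Lemma monomM (u v : M) : (monom u : KM) * monom v = monom (u * v)%g.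
Proof. exact: mamulUU. Qed.

Lemma monom_algE c (p : KM) : kscal c * p = c *: p.
Proof. by rewrite /kscal /= /ma_scal -mascaleAl [monom 1%g * p]mul1r. Qed.

Lemma monom_sum (p : KM) : p = \sum_(u <- msupp p) kscal p@_u * monom u.
Proof.
rewrite {1}[p]monom_expand /linext.
by apply: eq_bigr => u _; rewrite monom_algE.
Qed.

Lemma monom_ind (P : KM -> Prop) :
  P 0 -> (forall c p q, P p -> P q -> P (kscal c * p + q)) ->
  (forall u, P (monom u)) -> forall p, P p.
Proof.
move=> P0 PP Pm p; rewrite [p]monom_sum.
apply: (big_ind P) => // [x y Px Py|u _].
  by rewrite -[x]scale1r -monom_algE; apply: PP.
by rewrite -[_ * _]addr0; apply: PP.
Qed.

Lemma linext_zmod (V : lmodType K) (f : M -> V) : zmod_morphism (linext f : KM -> V).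
Proof. exact: linearB. Qed.

Lemma linext_algZ (V : lmodType K) (f : M -> V) c (p : KM) :
  linext f (kscal c * p) = c *: linext f p.
Proof. by rewrite monom_algE; exact: linearZ. Qed.

End MonoidAlgebraFacts.

(** * Additive maps that vanish on a generated ideal *)

Section Ideals.
Context {K : fieldType} {B : kalgType K}.

(** The elements [q] with [f (s * q * t) = 0] for all [s] and [t] form an ideal, whereas the kernel
    of a merely additive [f] need not. *)
Lemma ideal_gen_ker (V : zmodType) (f : B -> V) (S : B -> Prop) :
  zmod_morphism f -> (forall s r t, S r -> f (s * r * t) = 0) ->
  forall p, ideal_gen S p -> f p = 0.
Proof.
move=> fB fS p /(_ (fun q => forall s t, f (s * q * t) = 0)) Jp.
rewrite -[p]mul1r -[1 * p]mulr1; apply: Jp => [|r Sr s t]; last exact: fS.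
split=> [s t|x y Jx Jy s t|a x b Jx s t].
- by rewrite mulr0 mul0r -[0]subr0 fB subrr.
- by rewrite mulrBr mulrBl fB /= Jx Jy subrr.
- by rewrite [s * _]mulrA -mulrA mulrA -[_ * b * t]mulrA [s * (a * x)]mulrA Jx.
Qed.

End Ideals.

Section Bilinear.
Context {K : fieldType} {A : kalgType K} {V : lmodType K}.

Record bilin (f : A -> A -> V) : Prop := Bilin {
  bilinDl : forall a a' b, f (a + a') b = f a b + f a' b;
  bilinDr : forall a b b', f a (b + b') = f a b + f a b';
  bilinZl : forall c a b, f (kscal c * a) b = c *: f a b;
  bilinZr : forall c a b, f a (kscal c * b) = c *: f a b
}.

(* [B] stands for the free algebra on the symbols [sym a b], and [F] for the
   linear extension of [f] to it. *)
Lemma bilinear_rel_ker (B : kalgType K) (sym : A -> A -> B) (S : B -> Prop)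
    (f : A -> A -> V) (F : B -> V) :
    bilin f ->
    (forall a b a' b', sym a b * sym a' b' = sym (a * a') (b' * b)) ->
    (forall P : B -> Prop, P 0 ->
       (forall c p q, P p -> P q -> P (kscal c * p + q)) ->
       (forall a b, P (sym a b)) -> forall p, P p) ->
    zmod_morphism F -> (forall c p, F (kscal c * p) = c *: F p) ->
    (forall a b, F (sym a b) = f a b) ->
    (forall r, S r ->
      [\/ exists a a' b, r = sym (a + a') b - sym a b - sym a' b,
          exists a b b', r = sym a (b + b') - sym a b - sym a b',
          exists c a b, r = sym (kscal c * a) b - kscal c * sym a b
        | exists c a b, r = sym a (kscal c * b) - kscal c * sym a b]) ->
  forall p, ideal_gen S p -> F p = 0.
Proof.
move=> fb symM symI FB FZ Fsym relS; apply: ideal_gen_ker => // s r t rR.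
have F0 : F 0 = 0 by rewrite -[0]subr0 FB subrr.
have FD x y : F (x + y) = F x + F y.
  by rewrite -[y in LHS]opprK FB -[- y]sub0r FB F0 sub0r opprK.
elim/symI: s => [|c s s' Js Js'|a1 b1]; first by rewrite !mul0r.
  by rewrite !mulrDl -!mulrA FD FZ !mulrA Js Js' scaler0 addr0.
elim/symI: t => [|c t t' Jt Jt'|a2 b2]; first by rewrite !mulr0.
  by rewrite mulrDr FD mulrA -kscalC -[kscal _ * _ * _]mulrA FZ Jt Jt' scaler0 addr0.
case: (relS r rR).
- move=> [a [a' [b ->]]]; rewrite !mulrBr !mulrBl !symM !FB !Fsym.
  by rewrite mulrDr mulrDl (bilinDl fb) -addrA -opprD subrr.
- move=> [a [b [b' ->]]]; rewrite !mulrBr !mulrBl !symM !FB !Fsym.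
  by rewrite mulrDl mulrDr (bilinDr fb) -addrA -opprD subrr.
- move=> [c [a [b ->]]]; rewrite mulrBr mulrBl [sym a1 b1 * (kscal _ * _)]mulrA.
  rewrite -kscalC -!mulrA FB FZ !mulrA !symM !Fsym.
  by rewrite [a1 * (_ * _)]mulrA -kscalC -!mulrA (bilinZl fb) subrr.
- move=> [c [a [b ->]]]; rewrite mulrBr mulrBl [sym a1 b1 * (kscal _ * _)]mulrA.
  rewrite -kscalC -!mulrA FB FZ !mulrA !symM !Fsym.
  by rewrite [b2 * (_ * _)]mulrA [b2 * _]mulrA -kscalC -!mulrA (bilinZr fb) subrr.
Qed.

End Bilinear.

Record khom (K : fieldType) (A B : kalgType K) := KHom {
  khom_fun :> {rmorphism A -> B};
  khomZ : forall c, khom_fun (kscal c) = kscal c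
}.

Definition khom_lin (K : fieldType) (A B : kalgType K) (f : khom A B) :
  kmod A -> kmod B := f.

Section KhomLin.
Context {K : fieldType} {A B : kalgType K} (f : khom A B).
Fact khom_lin_linear : linear (khom_lin f).
Proof.
by move=> c x y; rewrite /khom_lin !kmodZE rmorphD rmorphM khomZ.
Qed.
HB.instance Definition _ :=
  GRing.isLinear.Build K (kmod A) (kmod B) *:%R (khom_lin f) khom_lin_linear.
End KhomLin.

Section KlinFacts.
Context {K : fieldType} {A B : kalgType K} (f : {linear kmod A -> kmod B}).
Lemma klinD (x y : A) : f (x + y) = f x + f y :> B.
Proof. exact: linearD. Qed.
Lemma klinB (x y : A) : f (x - y) = f x - f y :> B.
Proof. exact: linearB. Qed.
Lemma klinZ c (x : A) : f (kscal c * x) = kscal c * f x :> B.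
Proof. exact: (linearZ_LR f c x). Qed.
Lemma klin0 : f 0 = 0 :> B.
Proof. exact: linear0. Qed.
Lemma klin_sum I r (P : pred I) (F : I -> A) :
  f (\sum_(i <- r | P i) F i) = \sum_(i <- r | P i) f (F i) :> B.
Proof. exact: (linear_sum f). Qed.
End KlinFacts.

(** * Models of the enveloping algebra *)

(* The algebra A (x) A^op characterised by its universal property; working
   with an arbitrary model keeps unification away from the concrete quotient
   [env_alg A]. *)
Structure envModel (K : fieldType) (A : kalgType K) := EnvModel {
  env_sort :> kalgType K;
  et : A -> A -> env_sort;
  elift : forall V : lmodType K, (A -> A -> V) -> env_sort -> V;
  etDl : forall a a' b, et (a + a') b = et a b + et a' b;
  etDr : forall a b b', et a (b + b') = et a b + et a b';
  etZl : forall c a b, et (kscal c * a) b = kscal c * et a b;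
  etZr : forall c a b, et a (kscal c * b) = kscal c * et a b;
  etM : forall a b a' b', et a b * et a' b' = et (a * a') (b' * b);
  et11 : et 1 1 = 1;
  et_ind : forall P : env_sort -> Prop, P 0 ->
    (forall u v, P u -> P v -> P (u + v)) -> (forall a b, P (et a b)) ->
    forall u, P u;
  elift_zmod : forall (V : lmodType K) (f : A -> A -> V), bilin f -> zmod_morphism (elift f);
  eliftZ : forall (V : lmodType K) (f : A -> A -> V), bilin f ->
    forall c u, elift f (kscal c * u) = c *: elift f u;
  eliftE : forall (V : lmodType K) (f : A -> A -> V), bilin f ->
    forall a b, elift f (et a b) = f a b
}.

Section EnvAlgModel.
Context {K : fieldType} (A : kalgType K).
Local Notation E := (env_alg A).
Local Notation KM := (monoid_alg K (env_pair A)).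
Local Notation rel := (@bilinear_rel K A).
Let sym (a b : A) : KM := monom ((a, b) : env_pair A).

Lemma tensDl (a a' b : A) : tens (a + a') b = tens a b + tens a' b.
Proof.
rewrite -[RHS]raddfD; apply/quot_eqP.
by rewrite opprD addrA; apply: ideal_gen_sub; apply: BilinDl.
Qed.

Lemma tensDr (a b b' : A) : tens a (b + b') = tens a b + tens a b'.
Proof.
rewrite -[RHS]raddfD; apply/quot_eqP.
by rewrite opprD addrA; apply: ideal_gen_sub; apply: BilinDr.
Qed.

Lemma tensZl c (a b : A) : tens (kscal c * a) b = kscal c * tens a b.
Proof.
have -> : kscal c * tens a b = quot_pi rel (kscal c * sym a b) by rewrite rmorphM.
by apply/quot_eqP; apply: ideal_gen_sub; apply: BilinZl.
Qed.

Lemma tensZr c (a b : A) : tens a (kscal c * b) = kscal c * tens a b.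
Proof.
have -> : kscal c * tens a b = quot_pi rel (kscal c * sym a b) by rewrite rmorphM.
by apply/quot_eqP; apply: ideal_gen_sub; apply: BilinZr.
Qed.

Lemma tensM (a b a' b' : A) : tens a b * tens a' b' = tens (a * a') (b' * b).
Proof. by rewrite -rmorphM monomM. Qed.

Lemma tens11 : tens 1 1 = 1 :> E.
Proof. by []. Qed.

Lemma env_ind (P : E -> Prop) :
  P 0 -> (forall u v, P u -> P v -> P (u + v)) ->
  (forall a b, P (tens a b)) -> forall u, P u.
Proof.
move=> P0 PD Pt u; rewrite -[u]quot_reprK [quot_repr u]monom_sum.
have e c (a b : A) : quot_pi rel (kscal c * monom ((a, b) : env_pair A))
    = tens (kscal c * a) b by rewrite tensZl rmorphM.
rewrite raddf_sum; apply: big_ind => // -[a b] _ /=.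
rewrite [quot_pi _ _]e; exact: Pt.
Qed.

Section Lift.
Variables (V : lmodType K) (f : A -> A -> V).

Definition env_lift (u : E) : V :=
  linext (fun s : env_pair A => f s.1 s.2) (quot_repr u).

Hypothesis fb : bilin f.
Local Notation F := (linext (fun s : env_pair A => f s.1 s.2)).

Lemma env_lift_pi p : env_lift (quot_pi rel p) = F p.
Proof.
apply/eqP; rewrite -subr_eq0 -[_ - _]linext_zmod; apply/eqP.
apply: (@bilinear_rel_ker K A V KM sym rel f F fb) => [a b a' b'|P P0 PP Pm| |||r|].
- exact: monomM.
- by apply: (monom_ind P0 PP) => -[a b]; apply: Pm.
- exact: linext_zmod.
- exact: linext_algZ.
- by move=> a b; apply: linext_monom.
- case=> [a a' b|a b b'|c a b|c a b].
  + by apply: Or41; exists a, a', b.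
  + by apply: Or42; exists a, b, b'.
  + by apply: Or43; exists c, a, b.
  + by apply: Or44; exists c, a, b.
by apply/quot_eqP; rewrite quot_reprK.
Qed.

Lemma env_lift_tens a b : env_lift (tens a b) = f a b.
Proof. by rewrite env_lift_pi linext_monom. Qed.

Lemma env_lift_zmod : zmod_morphism env_lift.
Proof.
move=> u v; rewrite -[u]quot_reprK -[v]quot_reprK.
by rewrite -[_ - _]quot_pi_is_zmod_morphism !env_lift_pi; apply: linext_zmod.
Qed.

Lemma env_liftZ c u : env_lift (kscal c * u) = c *: env_lift u.
Proof.
rewrite -[u]quot_reprK -[kscal c]/(quot_pi _ (kscal c)) -rmorphM !env_lift_pi.
exact: linext_algZ.
Qed.

End Lift.

Definition env_model : envModel A :=
  EnvModel tensDl tensDr tensZl tensZr tensM tens11 env_ind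
    env_lift_zmod env_liftZ env_lift_tens.

End EnvAlgModel.

(** * Calculus in the enveloping algebra *)

Section EnvBasics.
Context {K : fieldType} {A : kalgType K} (E : envModel A).
Local Notation et := (@et K A E).

Lemma etBr a b b' : et a (b - b') = et a b - et a b'.
Proof. by apply/eqP; rewrite eq_sym subr_eq -etDr subrK. Qed.
Lemma etBl a a' b : et (a - a') b = et a b - et a' b.
Proof. by apply/eqP; rewrite eq_sym subr_eq -etDl subrK. Qed.

Definition etl b a : E := et a b.
HB.instance Definition _ a := GRing.isZmodMorphism.Build A E (et a) (etBr a).
HB.instance Definition _ b :=
  GRing.isZmodMorphism.Build A E (etl b) (fun a a' => etBl a a' b).

Lemma et0r a : et a 0 = 0. Proof. exact: raddf0. Qed.
Lemma et0l b : et 0 b = 0. Proof. exact: (raddf0 (etl b)). Qed.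
Lemma et_sumr I r (P : pred I) a (F : I -> A) :
  et a (\sum_(i <- r | P i) F i) = \sum_(i <- r | P i) et a (F i).
Proof. exact: raddf_sum. Qed.
Lemma et_suml I r (P : pred I) b (F : I -> A) :
  et (\sum_(i <- r | P i) F i) b = \sum_(i <- r | P i) et (F i) b.
Proof. exact: (raddf_sum (etl b)). Qed.

Lemma et_kscal c : et (kscal c) 1 = kscal c.
Proof. by rewrite -[kscal c]mulr1 etZl et11 mulr1. Qed.

Lemma et_eq (V : zmodType) (f g : E -> V) :
  zmod_morphism f -> zmod_morphism g ->
  (forall a b, f (et a b) = g (et a b)) -> f =1 g.
Proof.
move=> fB gB fg; apply: et_ind => [|u v fu fv|//].
  by rewrite -[0]subr0 fB gB !subrr.
have D h : zmod_morphism h -> h (u + v) = h u + h v :> V.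
  by move=> hB; apply/eqP; rewrite -subr_eq -hB addrK.
by rewrite !D // fu fv.
Qed.

Definition eact_fun (x : A) (u : E) : A :=
  elift (V := kmod A) (fun a b : A => a * x * b : A) u.

Fact eact_bilin x : bilin (V := kmod A) (fun a b : A => a * x * b : A).
Proof.
split=> [a a' b|a b b'|c a b|c a b] /=.
- by rewrite mulrDl mulrDl.
- by rewrite mulrDr.
- by rewrite kmodZE !mulrA.
- by rewrite kmodZE mulrA -kscalC !mulrA.
Qed.

Fact eact_zmod x : zmod_morphism (eact_fun x).
Proof. exact: (@elift_zmod _ _ E (kmod A) _ (eact_bilin x)). Qed.
HB.instance Definition _ x :=
  GRing.isZmodMorphism.Build E A (eact_fun x) (eact_zmod x).

Definition eact (u : E) (x : A) : A := eact_fun x u.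

Lemma eactE a b x : eact (et a b) x = a * x * b.
Proof. exact: (eliftE _ (eact_bilin x)). Qed.
Lemma eactBl u v x : eact (u - v) x = eact u x - eact v x.
Proof. exact: (raddfB (eact_fun x)). Qed.
Lemma eactDl u v x : eact (u + v) x = eact u x + eact v x.
Proof. exact: (raddfD (eact_fun x)). Qed.
Lemma eact0l x : eact 0 x = 0.
Proof. exact: (raddf0 (eact_fun x)). Qed.
Lemma eact_suml I r (P : pred I) (F : I -> E) x :
  eact (\sum_(i <- r | P i) F i) x = \sum_(i <- r | P i) eact (F i) x.
Proof. exact: (raddf_sum (eact_fun x)). Qed.

Lemma eactDr u x y : eact u (x + y) = eact u x + eact u y.
Proof.
elim/et_ind: u => [|u v hu hv|a b]; first by rewrite !eact0l addr0.
  by rewrite !eactDl hu hv addrACA.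
by rewrite !eactE mulrDr mulrDl.
Qed.
Fact eact_is_zmod u : zmod_morphism (eact u).
Proof. by move=> x y; apply/eqP; rewrite eq_sym subr_eq -eactDr subrK. Qed.
HB.instance Definition _ u := GRing.isZmodMorphism.Build A A (eact u) (eact_is_zmod u).

Lemma eactM u v x : eact (u * v) x = eact u (eact v x).
Proof.
elim/et_ind: u => [|u u' hu hu'|a b]; first by rewrite mul0r !eact0l.
  by rewrite mulrDl !eactDl hu hu'.
elim/et_ind: v => [|v v' hv hv'|a' b'].
- by rewrite mulr0 !eact0l raddf0.
- by rewrite mulrDr !eactDl hv hv' raddfD.
- by rewrite etM !eactE !mulrA.
Qed.

Lemma eact1 x : eact 1 x = x.
Proof. by rewrite -et11 eactE mul1r mulr1. Qed.

Fact eswap_bilin : bilin (V := kmod E) (fun a b => et b a).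
Proof.
split=> [a a' b|a b b'|c a b|c a b] /=.
- exact: etDr.
- exact: etDl.
- exact: etZr.
- exact: etZl.
Qed.

(** The swap reverses products ([eswapM]), so it identifies [E] with its opposite ring; the duality
    of the complexes rests on it. *)
Definition eswap (u : E) : E := elift (V := kmod E) (fun a b => et b a) u.
HB.instance Definition _ :=
  GRing.isZmodMorphism.Build E E eswap (@elift_zmod _ _ E (kmod E) _ eswap_bilin).

Lemma eswapE a b : eswap (et a b) = et b a.
Proof. exact: (eliftE _ eswap_bilin). Qed.

Lemma eswapK : involutive eswap.
Proof.
elim/et_ind => [|u v hu hv|a b]; first by rewrite !raddf0.
  by rewrite !raddfD /= hu hv.
by rewrite !eswapE.
Qed.

Lemma eswapM u v : eswap (u * v) = eswap v * eswap u.
Proof.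
elim/et_ind: u => [|u u' hu hu'|a b]; first by rewrite mul0r raddf0 mulr0.
  by rewrite mulrDl !raddfD /= mulrDr hu hu'.
elim/et_ind: v => [|v v' hv hv'|a' b'].
- by rewrite mulr0 raddf0 mul0r.
- by rewrite mulrDr !raddfD /= mulrDl hv hv'.
- by rewrite etM !eswapE etM.
Qed.

Lemma eswap1 : eswap 1 = 1.
Proof. by rewrite -et11 eswapE. Qed.

Definition ediff (a : A) : E := et a 1 - et 1 a.

Lemma eact_diff a x : eact (ediff a) x = a * x - x * a.
Proof. by rewrite eactBl !eactE mulr1 mul1r. Qed.

Lemma eswap_diff a : eswap (ediff a) = - ediff a.
Proof. by rewrite raddfB /= !eswapE opprB. Qed.

(** The Leibniz rule. Left multiplication by [et 1 b] multiplies the second tensor factor by [b] on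
    the right. *)
Lemma ediffM a b : ediff (a * b) = et a 1 * ediff b + et 1 b * ediff a.
Proof. by rewrite /ediff !mulrBr !etM !mulr1 !mul1r addrA subrK. Qed.

Lemma ediffD a b : ediff (a + b) = ediff a + ediff b.
Proof. by rewrite /ediff etDl etDr opprD addrACA. Qed.

Lemma ediff_kscal c : ediff (kscal c) = 0.
Proof. by rewrite /ediff -[kscal c]mulr1 etZl etZr subrr. Qed.

Lemma et1_central z : (forall y, z * y = y * z) -> forall u, et z 1 * u = u * et z 1.
Proof.
move=> zc; elim/et_ind => [|u v hu hv|a b]; first by rewrite mulr0 mul0r.
  by rewrite mulrDr mulrDl hu hv.
by rewrite !etM zc mulr1 mul1r.
Qed.

Lemma et1r_central z : (forall y, z * y = y * z) -> forall u, et 1 z * u = u * et 1 z.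
Proof.
move=> zc; elim/et_ind => [|u v hu hv|a b]; first by rewrite mulr0 mul0r.
  by rewrite mulrDr mulrDl hu hv.
by rewrite !etM zc mulr1 mul1r.
Qed.

Lemma ediff_central z : (forall y, z * y = y * z) -> forall u, ediff z * u = u * ediff z.
Proof.
by move=> zc u; rewrite mulrBl mulrBr et1_central // et1r_central.
Qed.

(** Generation in the form of an induction on words that grow at their left end. *)
Definition generates (n : nat) (x : 'I_n -> A) := forall P : A -> Prop,
  (forall c, P (kscal c)) -> (forall i p, P p -> P (x i * p)) ->
  (forall p q, P p -> P q -> P (p + q)) -> forall p, P p.

Definition diff_col n (x : 'I_n -> A) : 'cV[E]_n := \col_i ediff (x i).

(** Modulo the left ideal generated by the [ediff (x i)], every [a (x) b] equals [ab (x) 1], because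
    the Leibniz rule puts each [ediff b] into that ideal. *)
Lemma eact1_ker n (x : 'I_n -> A) : generates x ->
  forall u, eact u 1 = 0 <-> exists v : 'rV_n, u%:M = v *m diff_col x.
Proof.
move=> xgen u; have entry (v : 'rV_n) :
    (v *m diff_col x) 0 0 = \sum_i v 0 i * ediff (x i).
  by rewrite mxE; apply: eq_bigr => i _; rewrite mxE.
split=> [u0|[v /matrixP/(_ 0 0)]]; last first.
  rewrite entry mxE mulr1n => ->; rewrite eact_suml big1 // => i _.
  by rewrite eactM eact_diff mulr1 mul1r subrr raddf0.
pose J u := exists v : 'rV_n, u%:M = v *m diff_col x.
have J0 : J 0 by exists 0; rewrite mul0mx raddf0.
have JD a b : J a -> J b -> J (a + b).
  by move=> [v ev] [v' ev']; exists (v + v'); rewrite mulmxDl raddfD /= ev ev'.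
have JM a b : J b -> J (a * b).
  move=> [v ev]; exists (a *: v); rewrite -scalemxAl -ev.
  by apply/matrixP=> i j; rewrite !mxE mulrnAr.
have Jx i : J (ediff (x i)).
  exists (delta_mx 0 i); apply/matrixP=> s t; rewrite !ord1 entry mxE.
  rewrite (bigD1 i) //= big1 => [|j ji]; rewrite mxE eqxx /= ?eqxx ?mul1r ?addr0 //.
  by rewrite (negPf ji) mul0r.
have Jd a : J (ediff a).
  elim/xgen: a => [c|i p Jp|p q Jp Jq].
  - by rewrite ediff_kscal.
  - by rewrite ediffM; apply: JD; apply: JM.
  - by rewrite ediffD; apply: JD.
have Ju v : J (v - et (eact v 1) 1).
  elim/et_ind: v => [|v v' hv hv'|a b].
  - by rewrite eact0l et0l subrr.
  - by rewrite eactDl etDl opprD addrACA; apply: JD.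
  - have -> : et a b - et (eact (et a b) 1) 1 = - et a 1 * ediff b.
      by rewrite mulNr mulrBr !etM !eactE !mulr1 opprB.
    exact: JM.
by rewrite -[u]subr0 -(et0l 1) -u0; apply: Ju.
Qed.

End EnvBasics.

Arguments etl {K A} E b a.
Arguments eswap {K A E} u.
Arguments ediff {K A} E a.
Arguments diff_col {K A} E {n} x.

Section EnvMap.
Context {K : fieldType} {A B : kalgType K} (E : envModel A) (F : envModel B).

Section Linear.
Variables f g : {linear kmod A -> kmod B}.

Fact emap_bilin : bilin (V := kmod F) (fun a b : A => et F (f a) (g b)).
Proof.
split=> [a a' b|a b b'|c a b|c a b] /=.
- by rewrite klinD etDl.
- by rewrite klinD etDr.
- by rewrite klinZ etZl.
- by rewrite klinZ etZr.
Qed.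

Definition emap (u : E) : F :=
  elift (V := kmod F) (fun a b : A => et F (f a) (g b)) u.
HB.instance Definition _ :=
  GRing.isZmodMorphism.Build E F emap (@elift_zmod _ _ E (kmod F) _ emap_bilin).

Lemma emapE a b : emap (et E a b) = et F (f a) (g b).
Proof. exact: (eliftE _ emap_bilin). Qed.
End Linear.

Variable h : khom A B.

Definition ehom (u : E) : F := emap (khom_lin h) (khom_lin h) u.
HB.instance Definition _ := GRing.isZmodMorphism.Build E F ehom
  (raddfB (emap (khom_lin h) (khom_lin h))).

Lemma ehomE a b : ehom (et E a b) = et F (h a) (h b).
Proof. exact: emapE. Qed.

Fact ehom_monoid : monoid_morphism ehom.
Proof.
split; first by rewrite -et11 ehomE rmorph1 et11.
elim/et_ind => [|u u' hu hu'|a b] v; first by rewrite mul0r !raddf0 mul0r.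
  by rewrite mulrDl !raddfD /= mulrDl hu hu'.
elim/et_ind: v => [|v v' hv hv'|a' b'].
- by rewrite mulr0 raddf0 mulr0.
- by rewrite mulrDr !raddfD /= mulrDr hv hv'.
- by rewrite etM !ehomE etM !rmorphM.
Qed.
HB.instance Definition _ := GRing.isMonoidMorphism.Build E F ehom ehom_monoid.

Lemma ehom_diff a : ehom (ediff E a) = ediff F (h a).
Proof. by rewrite raddfB /= !ehomE rmorph1. Qed.

Lemma ehom_diff_col n (x : 'I_n -> A) :
  map_mx ehom (diff_col E x) = diff_col F (h \o x).
Proof. by apply/matrixP=> i j; rewrite !mxE ehom_diff. Qed.

Lemma ehom_swap u : ehom (eswap u) = eswap (ehom u).
Proof.
elim/et_ind: u => [|u v hu hv|a b]; first by rewrite !raddf0.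
  by rewrite !raddfD /= hu hv.
by rewrite ehomE !eswapE ehomE.
Qed.

End EnvMap.

Arguments emap {K A B} E F f g.
Arguments ehom {K A B} E F h.

(** * Gradings as families of projections *)

Record gproj (K : fieldType) (A : kalgType K)
    (p : nat -> {linear kmod A -> kmod A}) : Prop := GProj {
  gproj_proj : forall i j (a : A), p i (p j a) = (if i == j then p j a else 0) :> A;
  gproj_fin : forall a : A, exists N, a = \sum_(i < N) (p i a : A);
  gproj_1 : p 0%N 1 = 1 :> A;
  gproj_M : forall i j (a b : A), p i a = a :> A -> p j b = b :> A ->
    p (i + j)%N (a * b) = a * b :> A
}.

Section Graded.
Context {K : fieldType} {A : kalgType K} (E : envModel A).
Variable p : nat -> {linear kmod A -> kmod A}.
Hypothesis pP : gproj p.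
Local Notation et := (et E).

Lemma gprojE i j (a : A) (pa : p j a = a :> A) : p i a = (if i == j then a else 0) :> A.
Proof. by have := gproj_proj pP i j a; rewrite pa. Qed.

Lemma gproj_idem i (a : A) : p i (p i a) = p i a :> A.
Proof. by rewrite (gproj_proj pP) eqxx. Qed.

Lemma et_hind (P : E -> Prop) : P 0 -> (forall u v, P u -> P v -> P (u + v)) ->
  (forall i j (a b : A), p i a = a :> A -> p j b = b :> A -> P (et a b)) ->
  forall u, P u.
Proof.
move=> P0 PD Ph; apply: et_ind => // a b.
have [N ->] := gproj_fin pP a; have [N' ->] := gproj_fin pP b.
rewrite et_suml; apply: big_ind => // i _.
rewrite et_sumr; apply: big_ind => // j _.
by apply: (Ph i j); apply: gproj_idem.
Qed.

Definition ecomp_nat (d : nat) (u : E) : E :=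
  \sum_(i < d.+1) emap E E (p i) (p (d - i)%N) u.

(** Degrees are integers because subtracting a shift can make them negative; components of negative
    degree are 0. *)
Definition ecomp (z : int) (u : E) : E :=
  if z is Posz d then ecomp_nat d u else 0.
Arguments ecomp : simpl never.

Fact ecomp_zmod z : zmod_morphism (ecomp z).
Proof.
move=> u v; case: z => [d|d]; rewrite /ecomp; last by rewrite subrr.
rewrite /ecomp_nat -sumrB; apply: eq_bigr => i _; exact: raddfB.
Qed.
HB.instance Definition _ z := GRing.isZmodMorphism.Build E E (ecomp z) (ecomp_zmod z).

Lemma ecompE z i j (a b : A) : p i a = a :> A -> p j b = b :> A ->
  ecomp z (et a b) = if z == (i + j)%N%:Z then et a b else 0.
Proof.
move=> pa pb; case: z => [d|d]; rewrite /ecomp //.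
have term (s : nat) : emap E E (p s) (p (d - s)%N) (et a b)
    = if (s == i) && ((d - s)%N == j) then et a b else 0.
  rewrite emapE (gprojE s pa) (gprojE _ pb).
  by case: eqP => _ /=; rewrite ?et0l //; case: eqP => _; rewrite ?et0r.
rewrite /ecomp_nat (eq_bigr _ (fun (s : 'I_d.+1) _ => term s)) eqz_nat.
have [dij|ndij] := eqVneq d (i + j)%N; last first.
  rewrite big1 // => s _; case: ifP => // /andP[/eqP si /eqP sj].
  by case/negP: ndij; rewrite -si -sj subnKC // -ltnS.
have id1 : (i < d.+1)%N by rewrite dij ltnS leq_addr.
have dji : (d - i)%N = j by rewrite dij addKn.
rewrite (bigD1 (Ordinal id1)) //= eqxx dji eqxx big1 ?addr0 // => s.
by rewrite -val_eqE /= => /negPf ->.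
Qed.

Lemma ecomp_neg z u : z < 0 -> ecomp z u = 0.
Proof. by case: z. Qed.

Lemma ecomp_comp z z' u : ecomp z (ecomp z' u) = if z == z' then ecomp z u else 0.
Proof.
elim/et_hind: u => [|u v hu hv|i j a b pa pb]; first by rewrite !raddf0 if_same.
  by rewrite !raddfD /= hu hv; case: ifP; rewrite ?addr0.
rewrite (ecompE z' pa pb) (fun_if (ecomp z)) raddf0 (ecompE z pa pb).
case: (z' =P (i + j)%N) => [->|/eqP n]; first by case: ifP.
by case: (z =P z') => [->|//]; rewrite (negPf n).
Qed.

Lemma ecomp_idem z u : ecomp z (ecomp z u) = ecomp z u.
Proof. by rewrite ecomp_comp eqxx. Qed.

(** The decomposition holds over every duplicate-free list containing [s], so that several elements
    can be expanded over a common list. *)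
Lemma ecomp_supp u : exists s : seq int, forall t : seq int, uniq t ->
  {subset s <= t} -> u = \sum_(z <- t) ecomp z u.
Proof.
elim/et_hind: u => [|u v [s hs] [s' hs']|i j a b pa pb].
- by exists [::] => t _ _; rewrite big1 // => z _; rewrite raddf0.
- exists (s ++ s') => t ut st.
  have su : {subset s <= t} by move=> z zs; apply: st; rewrite mem_cat zs.
  have sv : {subset s' <= t} by move=> z zs; apply: st; rewrite mem_cat zs orbT.
  rewrite {1}(hs t ut su) {1}(hs' t ut sv).
  by rewrite -big_split; apply: eq_bigr => z _; rewrite raddfD.
- exists [:: (i + j)%N%:Z] => t ut st.
  have tij : (i + j)%N%:Z \in t by apply: st; rewrite inE.
  rewrite (bigD1_seq _ tij ut) /= (ecompE _ pa pb) eqxx big1 ?addr0 // => z nz.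
  by rewrite (ecompE _ pa pb) (negPf nz).
Qed.

Lemma ecompM z e u v : ecomp e v = v -> ecomp z (u * v) = ecomp (z - e) u * v.
Proof.
move=> <-; elim/et_hind: u => [|u u' hu hu'|i j a b pa pb].
- by rewrite mul0r !raddf0 mul0r.
- by rewrite mulrDl !raddfD /= mulrDl hu hu'.
elim/et_hind: v => [|v v' hv hv'|i' j' a' b' pa' pb'].
- by rewrite raddf0 !mulr0 raddf0.
- by rewrite raddfD /= !mulrDr raddfD /= hv hv'.
rewrite (ecompE e pa' pb'); case: eqP => [->|_]; last by rewrite !mulr0 raddf0.
rewrite etM (ecompE z (gproj_M pP pa pa') (gproj_M pP pb' pb)) (ecompE _ pa pb).
have -> : (z - (i' + j')%N%:Z == (i + j)%N%:Z) = (z == (i + i' + (j' + j))%N%:Z).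
  by rewrite subr_eq -PoszD [(i + j + _)%N]addnACA [(j + j')%N]addnC.
by case: ifP; rewrite ?mul0r ?etM.
Qed.

Lemma ecomp1 : ecomp 0 1 = 1.
Proof. by rewrite -et11 (ecompE 0 (gproj_1 pP) (gproj_1 pP)). Qed.

Lemma ecomp_et1 i (a : A) : p i a = a :> A -> ecomp i (et a 1) = et a 1.
Proof. by move=> pa; rewrite (ecompE i pa (gproj_1 pP)) addn0 eqxx. Qed.

Lemma ecomp_1et i (a : A) : p i a = a :> A -> ecomp i (et 1 a) = et 1 a.
Proof. by move=> pa; rewrite (ecompE i (gproj_1 pP) pa) add0n eqxx. Qed.

Lemma ecomp_diff i (a : A) : p i a = a :> A -> ecomp i (ediff E a) = ediff E a.
Proof. by move=> pa; rewrite raddfB /= ecomp_et1 ?ecomp_1et. Qed.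

Lemma gproj_eact d e u (x : A) : p e x = x :> A ->
  p d (eact u x) = eact (ecomp (d%:Z - e%:Z) u) x :> A.
Proof.
move=> px; elim/et_hind: u => [|u v hu hv|i j a b pa pb].
- by rewrite raddf0 !eact0l klin0.
- by rewrite !raddfD /= !eactDl klinD hu hv.
rewrite eactE (gprojE d (gproj_M pP (gproj_M pP pa px) pb)) (ecompE _ pa pb).
have -> : (d%:Z - e%:Z == (i + j)%N%:Z) = (d == i + e + j)%N.
  by rewrite subr_eq -PoszD eqz_nat addnAC.
by case: ifP; rewrite ?eact0l ?eactE.
Qed.

Lemma ecomp_swap z u : ecomp z (eswap u) = eswap (ecomp z u).
Proof.
elim/et_hind: u => [|u v hu hv|i j a b pa pb]; first by rewrite !raddf0.
  by rewrite !raddfD /= hu hv.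
rewrite eswapE (ecompE z pa pb) (ecompE z pb pa) addnC.
by case: ifP; rewrite ?eswapE ?raddf0.
Qed.

Section Rows.
Variables (r : nat) (sh : 'rV[int]_r).

(** The [j]-th basis vector of the free module lies in degree [sh 0 j]. *)
Definition rcomp (z : int) (v : 'rV[E]_r) : 'rV[E]_r :=
  \row_j ecomp (z - sh 0 j) (v 0 j).

Fact rcomp_zmod z : zmod_morphism (rcomp z).
Proof. by move=> u v; apply/rowP => j; rewrite !mxE raddfB. Qed.
HB.instance Definition _ z := GRing.isZmodMorphism.Build _ _ (rcomp z) (rcomp_zmod z).

Lemma rcomp_comp z z' v : rcomp z (rcomp z' v) = if z == z' then rcomp z v else 0.
Proof.
apply/rowP => j; rewrite !mxE ecomp_comp (inj_eq (addIr _)).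
by case: ifP; rewrite ?mxE.
Qed.

Lemma rcomp_idem z v : rcomp z (rcomp z v) = rcomp z v.
Proof. by rewrite rcomp_comp eqxx. Qed.

Lemma rcomp_supp v : exists s : seq int, forall t : seq int, uniq t ->
  {subset s <= t} -> v = \sum_(z <- t) rcomp z v.
Proof.
have [S SP] := choice (fun j => ecomp_supp (v 0 j)).
(* Entry [j] is decomposed in the degrees [z - sh 0 j], so its support is moved by [sh 0 j]. *)
exists (flatten [seq [seq z + sh 0 j | z <- S j] | j <- enum 'I_r]) => t ut st.
apply/rowP => j; rewrite summxE (SP j [seq z - sh 0 j | z <- t]).
- by rewrite big_map; apply: eq_bigr => z _; rewrite mxE.
- by rewrite map_inj_uniq //; apply: addIr.
move=> z zS; apply/mapP; exists (z + sh 0 j); last by rewrite addrK.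
by apply/st/flatten_mapP; exists j; rewrite ?mem_enum //; apply: map_f.
Qed.

End Rows.

(** These are the degrees of the entries for which [v |-> v *m M] preserves degrees. *)
Definition mhomog r s (sh : 'rV[int]_r) (sh' : 'rV[int]_s) (M : 'M[E]_(r, s)) :=
  forall i j, ecomp (sh 0 i - sh' 0 j) (M i j) = M i j.

Lemma rcomp_mul r s (sh : 'rV[int]_r) (sh' : 'rV[int]_s) (M : 'M[E]_(r, s)) z v :
  mhomog sh sh' M -> rcomp sh' z (v *m M) = rcomp sh z v *m M.
Proof.
move=> Mh; apply/rowP => j; rewrite !mxE raddf_sum; apply: eq_bigr => i _ /=.
by rewrite mxE (ecompM _ _ (Mh i j)) opprB addrA subrK.
Qed.

End Graded.

Arguments ecomp {K A} E p z u : simpl never.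

Lemma ehom_comp (K : fieldType) (A B : kalgType K) (E : envModel A) (F : envModel B)
    (p : nat -> {linear kmod A -> kmod A}) (q : nat -> {linear kmod B -> kmod B})
    (h : khom A B) : (forall i a, h (p i a) = q i (h a)) ->
  forall z u, ehom E F h (ecomp E p z u) = ecomp F q z (ehom E F h u).
Proof.
move=> hp [d|d] u; last by rewrite /ecomp raddf0.
rewrite /ecomp /ecomp_nat raddf_sum; apply: eq_bigr => i _ /=.
apply: (et_eq (f := fun u => ehom E F h (emap E E (p i) (p (d - i)%N) u))
  (g := fun u => emap F F (q i) (q (d - i)%N) (ehom E F h u))) => [x y|x y|a b].
- by rewrite !raddfB.
- by rewrite !raddfB.
- by rewrite emapE !ehomE emapE !hp.
Qed.

Lemma kmod_linear (K : fieldType) (B : kalgType K) (V : lmodType K) (g : kmod B -> V) :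
  zmod_morphism g -> (forall c (b : B), g (kscal c * b) = c *: g b) -> linear g.
Proof.
move=> gB gZ c a b; have g0 : g 0 = 0 by rewrite -[0]subr0 gB subrr.
have gN a' : g (- a') = - g a' by rewrite -sub0r gB g0 sub0r.
by rewrite -[b in LHS]opprK gB gN opprK kmodZE gZ.
Qed.

Section KmodMul.
Context {K : fieldType} {B : kalgType K}.
Definition kmull (a : B) : kmod B -> kmod B := fun b => a * b.
Definition kmulr (b : B) : kmod B -> kmod B := fun a => (a : B) * b.
Fact kmull_linear a : linear (kmull a).
Proof.
apply: kmod_linear => [b b'|c b]; first exact: mulrBr.
by rewrite /kmull kmodZE !mulrA kscalC.
Qed.
Fact kmulr_linear b : linear (kmulr b).
Proof.
apply: kmod_linear => [a a'|c a]; first exact: mulrBl.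
by rewrite /kmulr kmodZE mulrA.
Qed.
HB.instance Definition _ a :=
  GRing.isLinear.Build K (kmod B) (kmod B) *:%R (kmull a) (kmull_linear a).
HB.instance Definition _ b :=
  GRing.isLinear.Build K (kmod B) (kmod B) *:%R (kmulr b) (kmulr_linear b).
End KmodMul.

(** * The tensor algebra *)

Section Words.
Context {K : fieldType} {n : nat}.
Local Notation T := (tensor_alg K n).
Local Notation x := (@tX K n).

Lemma wordX_cons i (u : word n) : wordX (i :: u) = x i * wordX u.
Proof. by rewrite /tX /wordX monomM. Qed.

Lemma wordXM (u v : word n) : wordX u * wordX v = wordX (u ++ v) :> T.
Proof. exact: monomM. Qed.

Lemma wordX0 : wordX [::] = 1 :> T.
Proof. by []. Qed.

Lemma tensor_generates : generates x.
Proof.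
move=> P PK Px PD p; rewrite [p]monom_sum.
apply: big_ind => // [|u _]; first by rewrite -(rmorph0 kscal); apply: PK.
elim: u (p@_u) => [|i u IH] c; first by rewrite -[monom _]/(1 : T) mulr1; apply: PK.
by rewrite -[monom _]/(wordX _) wordX_cons mulrA kscalC -mulrA; apply: Px.
Qed.

Section Linext.
Variables (V : lmodType K) (g : word n -> V).
Definition wext (q : kmod T) : V := linext g q.
Fact wext_linear : linear wext.
Proof.
by apply: kmod_linear => [|c b]; [apply: linext_zmod | apply: linext_algZ].
Qed.
HB.instance Definition _ := GRing.isLinear.Build K (kmod T) V *:%R wext wext_linear.

Lemma wextE u : wext (wordX u) = g u.
Proof. exact: linext_monom. Qed.
End Linext.

Lemma wext_eq (V : lmodType K) (f g : {linear kmod T -> V}) :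
  (forall u, f (wordX u) = g (wordX u)) -> forall p : T, f p = g p.
Proof.
move=> fg p; rewrite [p]monom_sum !linear_sum; apply: eq_bigr => u _.
rewrite -[_ * _]/(_ *: (monom u : kmod T)) !linearZ_LR; congr (_ *: _); exact: fg.
Qed.

Lemma tens_deg_eq d (V : lmodType K) (f g : {linear kmod T -> V}) :
  (forall u, size u = d -> f (wordX u) = g (wordX u)) ->
  forall p : T, tens_deg d p -> f p = g p.
Proof.
move=> fg p pd; rewrite [p]monom_sum !linear_sum.
rewrite big_seq [RHS]big_seq; apply: eq_bigr => u.
rewrite -mcoeff_neq0 => /pd ud.
rewrite -[_ * _]/(_ *: (monom u : kmod T)) !linearZ_LR; congr (_ *: _); exact: fg.
Qed.

Definition wproj (d : nat) : kmod T -> kmod T :=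
  wext (fun u => if size u == d then wordX u : kmod T else 0).
HB.instance Definition _ d := GRing.Linear.on (wproj d).

Lemma wprojE d u : wproj d (wordX u) = (if size u == d then wordX u else 0) :> T.
Proof. by rewrite /wproj wextE. Qed.

Definition wcoef (v : word n) : kmod T -> K^o := wext (fun u => (u == v)%:R : K^o).
HB.instance Definition _ v := GRing.Linear.on (wcoef v).

Lemma wcoefE v (p : T) : wcoef v p = p@_v.
Proof.
rewrite {2}[p]monom_expand /wcoef /wext /linext raddf_sum; apply: eq_bigr => u _.
by rewrite [RHS]mcoeffZ; congr (_ * _); rewrite /monom mcoeffU.
Qed.


Lemma wproj_coef d (p : T) u :
  (wproj d p : T)@_u = if size u == d then p@_u else 0.
Proof.
rewrite -!wcoefE.
have -> : (if size u == d then wcoef u p else 0) = (size u == d)%:R *: wcoef u p.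
  by case: ifP; rewrite ?scale1r ?scale0r.
apply: (wext_eq (f := wcoef u \o wproj d) (g := (size u == d)%:R \*: wcoef u)) => v /=.
rewrite wprojE /wcoef wextE (fun_if (wext _)) wextE raddf0.
have [<-|_] := eqVneq v u; first by case: ifP; rewrite ?scale1r ?scale0r.
by rewrite if_same scaler0.
Qed.

Lemma wproj_deg d (p : T) : tens_deg d p <-> wproj d p = p :> T.
Proof.
split=> [|wp u].
  by apply: (tens_deg_eq (f := wproj d) (g := idfun)) => u ud /=; rewrite wprojE ud eqxx.
by rewrite -wp wproj_coef; case: (size u =P d) => // _; rewrite eqxx.
Qed.

Lemma wproj_gproj : gproj (fun d => wproj d : {linear kmod T -> kmod T}).
Proof.
split=> [i j a|a||i j a b].
- have -> : (if i == j then wproj j a else 0) = (i == j)%:R *: wproj j a.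
    by case: ifP; rewrite ?scale1r ?scale0r.
  move: a; apply: (@wext_eq (kmod T) (wproj i \o wproj j) ((i == j)%:R \*: wproj j)) => v /=.
  rewrite wprojE (fun_if (wproj i)) wprojE raddf0.
  have [<-|nij] := eqVneq i j; first by rewrite scale1r; case: ifP => // ->.
  by rewrite scale0r; case: (size v =P j) => // ->; rewrite eq_sym (negPf nij).
(* The bound has to survive enlargement, so that a sum of two elements can use the maximum of their
   bounds. *)
- pose P (b : T) := exists N, forall N', (N <= N')%N ->
      b = \sum_(i < N') (wproj i b : T).
  suff [N /(_ N (leqnn N))] : P a by exists N.
  rewrite [a]monom_sum; apply: (big_ind P) => [|b c [N hN] [N' hN']|u _].
  + by exists 0%N => N' _; rewrite big1 // => i _; rewrite linear0.
  + exists (maxn N N') => M; rewrite geq_max => /andP[/hN hM /hN' hM'].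
    under eq_bigr => i _ do rewrite klinD.
    by rewrite big_split; exact: (congr2 _ hM hM').
  + rewrite -[monom u]/(wordX u); exists (size u).+1 => N' uN'.
    under eq_bigr => i _ do rewrite klinZ /= wprojE.
    rewrite -mulr_sumr; congr (_ * _).
    rewrite (bigD1 (Ordinal uN')) //= eqxx big1 ?addr0 // => i.
    by rewrite -val_eqE /= eq_sym => /negPf ->.
- exact: (wprojE 0 [::]).
- move=> <- <-; move: a.
  apply: (@wext_eq (kmod T) (wproj (i + j) \o (kmulr (wproj j b) \o wproj i))
    (kmulr (wproj j b) \o wproj i)) => u /=; rewrite wprojE.
  case: (size u =P i) => [ui|_]; last by rewrite linear0 linear0.
  move: b; apply: (@wext_eq (kmod T) (wproj (i + j) \o (kmull (wordX u) \o wproj j))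
    (kmull (wordX u) \o wproj j)) => v /=; rewrite wprojE.
  case: (size v =P j) => [vj|_]; last by rewrite linear0 linear0.
  by rewrite /kmull wordXM wprojE size_cat ui vj eqxx.
Qed.

End Words.

(** * The universal derivation of a free algebra *)

Section UniversalDerivation.
Context {K : fieldType} {T : kalgType K} (E : envModel T) {n : nat}.
Variables (x : 'I_n -> T) (D : 'I_n -> {linear kmod T -> kmod E}).
Hypotheses (xgen : generates x) (D1 : forall j, D j 1 = 0)
  (DX : forall j i (b : T), D j (x i * b) =
    (if i == j then et E 1 b else 0) + et E (x i) 1 * D j b :> E).

Lemma uder_scal j c : D j (kscal c) = 0 :> E.
Proof. by rewrite -[kscal c]mulr1 klinZ D1 mulr0. Qed.

Lemma uderM j (a b : T) :
  D j (a * b) = et E a 1 * D j b + et E 1 b * D j a :> E.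
Proof.
elim/xgen: a => [c|i p hp|p q hp hq].
- by rewrite klinZ uder_scal mulr0 addr0 et_kscal.
- rewrite -mulrA !DX hp !mulrDr !mulrA !etM !mulr1 !mul1r.
  rewrite addrCA; congr (_ + (_ + _)).
  by case: ifP; rewrite ?mulr0 // etM mul1r.
- rewrite mulrDl !klinD hp hq etDl !mulrDr mulrDl.
  by rewrite addrACA.
Qed.

(** On a word, [D j] adds up [u (x) v] over the factorisations [u x_j v]. The left side then
    consists of the differences [u x_j (x) v - u (x) x_j v], which telescope. *)
Lemma uder_euler (a : T) : \sum_j D j a * ediff E (x j) = ediff E a.
Proof.
elim/xgen: a => [c|i p hp|p q hp hq].
- by rewrite ediff_kscal big1 // => j _; rewrite uder_scal mul0r.
- under eq_bigr => j _ do rewrite DX mulrDl -mulrA.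
  rewrite big_split -mulr_sumr /= hp ediffM addrC; congr (_ + _).
  rewrite (bigD1 i) //= eqxx big1 ?addr0 // => j ji.
  by rewrite eq_sym (negPf ji) mul0r.
- under eq_bigr => j _ do rewrite klinD mulrDl.
  by rewrite big_split /= hp hq ediffD.
Qed.

End UniversalDerivation.

(** * Cyclic derivatives and the symmetry of the Hessian *)

Section Pderiv.
Context {K : fieldType} {n : nat}.
Local Notation T := (tensor_alg K n).
Local Notation x := (@tX K n).

Definition wderiv (i : 'I_n) : kmod T -> kmod T :=
  wext (fun u : word n =>
    if u is j :: v then (if j == i then wordX v : kmod T else 0) else 0).
HB.instance Definition _ i := GRing.Linear.on (wderiv i).

Lemma wderivE i u : wderiv i (wordX u) =
  (if u is j :: v then (if j == i then wordX v else 0) else 0) :> T.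
Proof. by rewrite /wderiv wextE. Qed.

Lemma pderivE i (p : T) : pderiv i p = wderiv i p.
Proof.
rewrite /pderiv /wderiv /wext /linext; apply: eq_bigr => u _.
by rewrite kmodZE monom_algE.
Qed.

Lemma wderivX i j (b : T) : wderiv i (x j * b) = (if j == i then b else 0) :> T.
Proof.
have -> : (if j == i then b else 0) = (j == i)%:R *: (b : kmod T).
  by case: ifP; rewrite ?scale1r ?scale0r.
apply: (wext_eq (f := wderiv i \o kmull (x j)) (g := (j == i)%:R \*: idfun)) => u /=.
by rewrite /kmull -wordX_cons wderivE; case: ifP; rewrite ?scale1r ?scale0r.
Qed.

Lemma wderiv_euler (a : T) : a = wproj 0 a + \sum_i x i * wderiv i a :> T.
Proof.
rewrite [a in RHS]monom_sum klin_sum.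
under [X in _ = _ + X]eq_bigr => i _ do rewrite klin_sum mulr_sumr.
rewrite exchange_big -big_split {1}[a]monom_sum; apply: eq_bigr => u _ /=.
rewrite klinZ /= [wproj 0 _]wprojE.
under eq_bigr => i _ do rewrite klinZ /= mulrA -kscalC -mulrA.
rewrite -mulr_sumr -mulrDr; congr (_ * _).
case: u => [|j u]; first by rewrite big1 ?addr0 // => i _; rewrite [wderiv i _]wderivE mulr0.
rewrite add0r (bigD1 j) //= [wderiv j _]wderivE eqxx big1 ?addr0 -?wordX_cons // => i ij.
by rewrite [wderiv i _]wderivE eq_sym (negPf ij) mulr0.
Qed.

Lemma wproj0_scal (a : T) : exists c : K, wproj 0 a = kscal c.
Proof.
rewrite [a]monom_sum klin_sum.
apply: (big_ind (fun b : T => exists c : K, b = kscal c)) => [|b c [d ->] [e ->]|u _].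
- by exists 0; rewrite rmorph0.
- by exists (d + e); rewrite rmorphD.
rewrite klinZ /= [wproj 0 _]wprojE; case: u => [|j u] /=.
  by exists (a@_[::]); rewrite wordX0 mulr1.
by exists 0; rewrite mulr0 rmorph0.
Qed.

Lemma wproj_deriv j i (a : T) : wproj j (wderiv i a) = wderiv i (wproj j.+1 a) :> T.
Proof.
apply: (wext_eq (f := wproj j \o wderiv i) (g := wderiv i \o wproj j.+1)) => u /=.
rewrite wderivE wprojE; case: u => [|k u] /=; first by rewrite !linear0.
rewrite eqSS (fun_if (wproj j)) wprojE linear0.
rewrite (fun_if (wderiv i)) wderivE linear0.
by case: ifP; case: ifP.
Qed.

Lemma wproj1_tX i : wproj 1 (x i) = x i :> T.
Proof. exact: wprojE. Qed.

Variable E : envModel T.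

(** The contribution of position [s] to the derivative of [u]: the word is cut at that letter if it
    is [x_j]. *)
Definition wpart (s : nat) (j : 'I_n) (u : word n) : kmod E :=
  if drop s u is a :: v then
    (if a == j then et E (wordX (take s u)) (wordX v) else 0) else 0.

Definition wuder (j : 'I_n) : kmod T -> kmod E :=
  wext (fun u => \sum_(s < size u) wpart s j u).
HB.instance Definition _ j := GRing.Linear.on (wuder j).

Lemma wuderE j u : wuder j (wordX u) = \sum_(s < size u) wpart s j u.
Proof. by rewrite /wuder wextE. Qed.

Lemma wuderX j i (b : T) : wuder j (x i * b) =
  (if i == j then et E 1 b else 0) + et E (x i) 1 * wuder j b :> E.
Proof.
have etlin : linear (et E 1 : kmod T -> kmod E).
  by apply: kmod_linear => [b' c|c b']; [rewrite etBr | rewrite etZr].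
pose et1 : {linear kmod T -> kmod E} :=
  HB.pack (et E 1 : kmod T -> kmod E) (GRing.isLinear.Build K (kmod T) (kmod E) *:%R _ etlin).
have -> : (if i == j then et E 1 b else 0) = (i == j)%:R *: et1 b.
  by case: ifP; rewrite ?scale1r ?scale0r.
apply: (wext_eq (f := wuder j \o kmull (x i))
  (g := ((i == j)%:R \*: et1) \+ (kmull (et E (x i) 1) \o wuder j))) => u /=.
rewrite /kmull -wordX_cons !wuderE big_ord_recl /=; congr (_ + _).
  by rewrite /wpart /=; case: ifP; rewrite ?scale1r ?scale0r.
rewrite mulr_sumr; apply: eq_bigr => s _; rewrite /wpart /=.
case: drop => [|a v]; first by rewrite mulr0.
by case: ifP; rewrite ?mulr0 // etM wordX_cons mulr1.
Qed.


Lemma wuder1 j : wuder j 1 = 0.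
Proof. by rewrite -wordX0 wuderE big_ord0. Qed.

(** The inverse of [rotation]; moving the first letter to the end fits derivatives that remove a
    first letter. *)
Definition wrot : kmod T -> kmod T := wext (fun u => wordX (rot 1 u) : kmod T).
HB.instance Definition _ := GRing.Linear.on wrot.

Lemma wrotE u : wrot (wordX u) = wordX (rot 1 u) :> T.
Proof. by rewrite /wrot wextE. Qed.

Lemma wrot_rotation (w : T) : rotation w = w -> wrot w = w.
Proof.
pose g := wext (fun u : word n => wordX (rotr 1 u) : kmod T).
have -> : rotation w = g w.
  rewrite /rotation /g /wext /linext; apply: eq_bigr => u _.
  by rewrite kmodZE monom_algE.
move=> gw; rewrite -{1}gw.
apply: (wext_eq (f := wrot \o g) (g := idfun)) => u /=.
by rewrite /g wextE wrotE rotrK.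
Qed.

Lemma tens_deg_ind d (P : T -> Prop) : P 0 ->
  (forall p q, P p -> P q -> P (p + q)) ->
  (forall c u, size u = d -> P (kscal c * wordX u)) ->
  forall p, tens_deg d p -> P p.
Proof.
move=> P0 PD Pu p pd; rewrite [p]monom_sum big_seq.
by apply: big_ind => // u; rewrite -mcoeff_neq0 => /pd; apply: Pu.
Qed.

(** Removing the first letter and putting it back at the end is a rotation. For a superpotential
    this is the right-hand counterpart of [wderiv_euler]. *)
Lemma wderiv_rot d (w : T) : tens_deg d.+1 w -> \sum_i wderiv i w * x i = wrot w.
Proof.
elim/tens_deg_ind => [|p q hp hq|c [//|j u] _].
- by rewrite linear0 big1 // => i _; rewrite linear0 mul0r.
- under eq_bigr => i _ do rewrite klinD mulrDl.
  by rewrite big_split [RHS]klinD; exact: (congr2 _ hp hq).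
under eq_bigr => i _ do rewrite klinZ -mulrA.
rewrite -mulr_sumr klinZ /= wrotE rot1_cons -cats1; congr (_ * _).
rewrite (bigD1 j) //= wderivE eqxx big1 ?addr0 ?wordXM // => i ij.
by rewrite wderivE eq_sym (negPf ij) mul0r.
Qed.

(** One summand of a second derivative: words are cut at a first letter [x_i] and at a letter [x_j]
    that follows after [s] further letters. *)
Definition wmid (s : nat) (i j : 'I_n) : kmod T -> kmod E :=
  wext (fun u : word n =>
    if u is a :: v then (if a == i then wpart s j v else 0) else 0).
HB.instance Definition _ s i j := GRing.Linear.on (wmid s i j).

Lemma wmidE s i j u : wmid s i j (wordX u) =
  (if u is a :: v then (if a == i then wpart s j v else 0) else 0) :> E.
Proof. by rewrite /wmid wextE. Qed.

Lemma wmidD s i j (p q : T) :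
  wmid s i j (p + q) = wmid s i j p + wmid s i j q :> E.
Proof. exact: klinD. Qed.

Lemma eswapD (u v : E) : eswap (u + v) = eswap u + eswap v.
Proof. exact: raddfD. Qed.

Lemma wuder_wderiv d i j (w : T) : tens_deg d.+1 w ->
  wuder j (wderiv i w) = \sum_(s < d) wmid s i j w :> E.
Proof.
elim/tens_deg_ind => [|p q hp hq|c [//|a u] [ud]].
- by rewrite !linear0 big1 // => s _; rewrite linear0.
- under eq_bigr => s _ do rewrite klinD.
  by rewrite big_split !klinD; exact: (congr2 _ hp hq).
under eq_bigr => s _ do rewrite klinZ /= wmidE.
rewrite klinZ -mulr_sumr klinZ /=; congr (_ * _).
rewrite wderivE; case: ifP => _; last by rewrite linear0 big1.
by rewrite wuderE ud.
Qed.

Lemma iter_wrotE t u : (t <= size u)%N -> iter t wrot (wordX u) = wordX (rot t u) :> T.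
Proof.
elim: t => [|t IH] tu /=; first by rewrite rot0.
by rewrite [iter _ _ _]IH ?(ltnW tu) // wrotE (rotS tu).
Qed.

Lemma iter_wrotZ t c (p : T) : iter t wrot (kscal c * p) = kscal c * iter t wrot p :> T.
Proof.
elim: t => [|t IH]; first by [].
rewrite !iterS IH; exact: klinZ.
Qed.

Lemma iter_wrotD t (p q : T) : iter t wrot (p + q) = iter t wrot p + iter t wrot q :> T.
Proof.
elim: t => [|t IH]; first by [].
rewrite !iterS IH; exact: klinD.
Qed.

(** Rotating [x_i u x_j v] by [s + 1] letters, where [u] has length [s], gives [x_j v x_i u].
    Cutting it at the same two letters yields [v (x) u], and [v] has length [d - 1 - s]. *)
Lemma eswap_wmid d s i j (w : T) : (s < d)%N -> tens_deg d.+1 w ->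
  eswap (wmid s i j w) = wmid (d.-1 - s)%N j i (iter s.+1 wrot w) :> E.
Proof.
move=> sd; elim/tens_deg_ind => [|p q hp hq|c [//|a u] [ud]].
- have -> : iter s.+1 wrot 0 = 0 by elim: (s.+1) => //= t ->; rewrite linear0.
  by rewrite !linear0 raddf0.
- by rewrite iter_wrotD !wmidD eswapD hp hq.
rewrite iter_wrotZ iter_wrotE /= ?ud ?ltnS 1?ltnW //.
rewrite !klinZ /= eswapM -et_kscal eswapE -[kscal c]mulr1 etZr etZl et11 mulr1 -kscalC.
congr (_ * _); rewrite !wmidE.
rewrite -(cat_take_drop s u); set u1 := take s u.
have su1 : size u1 = s by rewrite size_take ud sd.
case e: (drop s u) => [|b u2].
  by move/eqP: (size_drop s u); rewrite e ud /= eq_sym subn_eq0 leqNgt sd.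
have su2 : size u2 = (d.-1 - s)%N.
  by move: (size_drop s u); rewrite e ud /= -subn1 -subnDA addnC subnDA subn1 => <-.
have -> : rot s.+1 (a :: u1 ++ b :: u2) = b :: u2 ++ a :: u1.
  by rewrite -cat_cons -[s.+1]/(s.+1) -{1}su1 -[(size u1).+1]/(size (a :: u1)) rot_size_cat.
rewrite /wpart !drop_size_cat ?take_size_cat //.
by case: (a == i); case: (b == j); rewrite ?raddf0 ?eswapE.
Qed.

(** A superpotential absorbs the rotation in [eswap_wmid], so the swap exchanges the summands at [s]
    and at [d - 1 - s]. *)
Lemma wuder_sym d i j (w : T) : tens_deg d.+1 w -> rotation w = w ->
  eswap (wuder j (wderiv i w)) = wuder i (wderiv j w) :> E.
Proof.
move=> wd /wrot_rotation wr.
rewrite (wuder_wderiv i j wd) (wuder_wderiv j i wd) raddf_sum.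
rewrite [RHS](reindex_inj rev_ord_inj) /=; apply: eq_bigr => s _.
rewrite (eswap_wmid _ _ (ltn_ord s) wd).
have -> : iter s.+1 wrot w = w.
  by elim: s.+1 => [|t IH]; [|rewrite iterS IH wr].
by case: d s {wd} => [[]//|d] s /=; rewrite subSS.
Qed.

Lemma wuder_deg d j (a : T) : tens_deg d.+1 a ->
  ecomp E (fun d => wproj d : {linear kmod T -> kmod T}) d (wuder j a) = wuder j a.
Proof.
elim/tens_deg_ind => [|p q hp hq|c u ud].
- by rewrite linear0 raddf0.
- by rewrite klinD raddfD; exact: (congr2 _ hp hq).
rewrite klinZ /= wuderE ud mulr_sumr raddf_sum; apply: eq_bigr => s _ /=.
rewrite /wpart; case e: (drop s u) => [|b v]; first by rewrite mulr0 raddf0.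
case: ifP => _; last by rewrite mulr0 raddf0.
have sz : d = (size (take s u) + size v)%N.
  move: (congr1 size (cat_take_drop s u)); rewrite e size_cat /= ud addnS.
  by case.
rewrite -etZl.
have h w' c' : wproj (size w') (kscal c' * wordX w') = kscal c' * wordX w' :> T.
  by rewrite klinZ /= wprojE eqxx.
have h1 := h v 1; rewrite rmorph1 mul1r in h1.
by rewrite (ecompE E wproj_gproj d (h _ c) h1) {1}sz eqxx.
Qed.

End Pderiv.

(** * Exactness from the vanishing of Ext *)

(** [A] as a left [E]-module, the target through which projectivity lifts an augmentation. *)
Definition bimod (K : fieldType) (A : kalgType K) (E : envModel A) : Type := A.

Section Bimod.
Context {K : fieldType} {A : kalgType K} (E : envModel A).
HB.instance Definition _ := GRing.Zmodule.on (bimod E).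
Definition bimod_scale (u : E) (a : bimod E) : bimod E := eact u (a : A).
Fact bimod_scaleA a b v : bimod_scale a (bimod_scale b v) = bimod_scale (a * b) v.
Proof. by rewrite /bimod_scale eactM. Qed.
Fact bimod_scale1 : left_id 1 bimod_scale.
Proof. exact: eact1. Qed.
Fact bimod_scaleDr : right_distributive bimod_scale +%R.
Proof. exact: eactDr. Qed.
Fact bimod_scaleDl v : {morph bimod_scale^~ v : a b / a + b}.
Proof. by move=> a b; apply: eactDl. Qed.
HB.instance Definition _ := GRing.Zmodule_isLmodule.Build E (bimod E)
  bimod_scaleA bimod_scale1 bimod_scaleDr bimod_scaleDl.
End Bimod.

Section ExtComparison.
Context {K : fieldType} {A : kalgType K} (E : envModel A).
Variables (n : nat) (x : 'I_n -> A) (H : 'M[E]_n).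
Hypotheses (xgen : generates x)
  (Xexact : forall v : 'rV_n, v *m diff_col E x = 0 -> exists y, v = y *m H).
Variables (P0 P1 P2 : lmodType E) (d0 : {linear P1 -> P0}) (d1 : {linear P2 -> P1}).
Variable eps : {additive P0 -> A}.
Hypotheses (P0proj : projective P0)
  (epsL : forall a b p, eps (et E a b *: p) = a * eps p * b)
  (eps_surj : forall a, exists p, eps p = a)
  (exact0 : forall p, eps p = 0 <-> exists q, p = d0 q)
  (d0d1 : forall q, d0 (d1 q) = 0).
Local Notation X := (diff_col E x).

Lemma eps_eact u p : eps (u *: p) = eact u (eps p).
Proof.
elim/et_ind: u => [|u v hu hv|a b].
- by rewrite scale0r raddf0 eact0l.
- by rewrite scalerDl raddfD /= hu hv eactDl.
- by rewrite epsL eactE.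
Qed.

(** The degree 0 part of a comparison of resolutions: [eps] is lifted through the multiplication map
    from [E] to [A]. *)
Lemma exists_lift : exists b0 : {linear P0 -> E^o},
  forall p, eact (b0 p : E) 1 = eps p.
Proof.
have epslin : linear (eps : P0 -> bimod E).
  by move=> u p q; rewrite raddfD /= eps_eact.
have actlin : linear ((fun u => eact u 1) : E^o -> bimod E).
  by move=> u v w /=; rewrite eactDl -[u *: v]/(u * (v : E)) eactM.
pose epsB : {linear P0 -> bimod E} :=
  HB.pack (eps : P0 -> bimod E) (GRing.isLinear.Build E P0 (bimod E) *:%R _ epslin).
pose actB : {linear E^o -> bimod E} :=
  HB.pack ((fun u => eact u 1) : E^o -> bimod E)
    (GRing.isLinear.Build E E^o (bimod E) *:%R _ actlin).
have [|b0 hb0] := P0proj epsB (g := actB).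
  by move=> y; exists (et E y 1); rewrite /= eactE !mulr1.
by exists b0 => p; apply: hb0.
Qed.

Lemma ker_mul_diff u c : eact u 1 = 0 -> (forall i, ediff E (x i) * c = 0) -> u * c = 0.
Proof.
move=> /(eact1_ker xgen)[v /matrixP/(_ 0 0)]; rewrite !mxE mulr1n => -> xc.
by rewrite mulr_suml big1 // => i _; rewrite mxE -mulrA xc mulr0.
Qed.

(** If every [ediff (x i)] kills [c], so does the kernel of multiplication. Hence [p |-> b0 p * c]
    is a 0-cocycle and vanishes. At a [p0] over 1, [b0 p0] is 1 modulo that kernel, so
    [c = b0 p0 * c = 0]. *)
Lemma ext0_ker :
    (forall f : P0 -> E, linear_for *%R f -> (forall q, f (d0 q) = 0) ->
      forall p, f p = 0) ->
  forall c : E, (forall i, ediff E (x i) * c = 0) -> c = 0.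
Proof.
move=> ext0 c xc; have [b0 hb0] := exists_lift; have [p0 ep0] := eps_surj 1.
have b0P p : eps p = 0 -> (b0 p : E) * c = 0.
  by move=> ep; apply: ker_mul_diff => //; rewrite hb0.
have f0 : (b0 p0 : E) * c = 0.
  apply: (ext0 (fun p => (b0 p : E) * c)) => [u p q|q].
    by rewrite linearP mulrDl -[u *: b0 p]/(u * (b0 p : E)) -mulrA.
  by apply: b0P; apply/exact0; exists q.
have : (1 - (b0 p0 : E)) * c = 0.
  by apply: ker_mul_diff => //; rewrite eactBl hb0 eact1 ep0 subrr.
by rewrite mulrBl mul1r f0 subr0.
Qed.

(** On the kernel of multiplication, [v X |-> v c] is a well-defined linear map [ubar]: two choices
    of [v] differ by a multiple of [H], and [H c = 0]. Composing it with [b0] and [d0] gives a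
    1-cocycle. That it is a coboundary makes [ubar] right multiplication by some [b], and
    [u = ediff (x i)] reads off the entries of [c]. *)
Lemma ext1_exact :
    (forall f : P1 -> E, linear_for *%R f -> (forall q, f (d1 q) = 0) ->
      exists2 g : P0 -> E, linear_for *%R g & forall p, f p = g (d0 p)) ->
  forall c : 'cV[E]_n, H *m c = 0 -> exists b : 'M_1, c = X *m b.
Proof.
move=> ext1 c Hc; have [b0 hb0] := exists_lift; have [p0 ep0] := eps_surj 1.
have /choice[V VP] (u : E) : exists v : 'rV_n, eact u 1 = 0 -> u%:M = v *m X.
  have [/(eact1_ker xgen)[v ev]|nu] := pselect (eact u 1 = 0); first by exists v.
  by exists 0.
pose ubar u : E := (V u *m c) 0 0.
have ubarE u v : u%:M = v *m X -> ubar u = (v *m c) 0 0.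
  move=> uv; have u0 : eact u 1 = 0 by apply/(eact1_ker xgen); exists v.
  have [y ey] : exists y, V u - v = y *m H.
    by apply: Xexact; rewrite mulmxBl -(VP u u0) -uv subrr.
  apply/eqP; rewrite -subr_eq0 /ubar.
  have -> : (V u *m c) 0 0 - (v *m c) 0 0 = ((V u - v) *m c) 0 0.
    by rewrite mulmxBl !mxE.
  by rewrite ey -mulmxA Hc mulmx0 mxE.
have ubarL u a b : eact a 1 = 0 -> eact b 1 = 0 -> ubar (u * a + b) = u * ubar a + ubar b.
  move=> a0 b0'; rewrite (ubarE _ (u *: V a + V b)); first by rewrite /ubar mulmxDl -scalemxAl !mxE.
  rewrite mulmxDl -scalemxAl -(VP a a0) -(VP b b0').
  by apply/matrixP=> i j; rewrite !ord1 !mxE !mulr1n.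
have ubar0 : ubar 0 = 0.
  by rewrite (ubarE _ 0) ?mul0mx ?mxE // raddf0.
have b0d q : eact (b0 (d0 q) : E) 1 = 0 by rewrite hb0; apply/exact0; exists q.
have [|q|g gL gP] := ext1 (fun q => ubar (b0 (d0 q))).
- by move=> u q q' /=; rewrite !linearP -[u *: b0 _]/(u * (b0 _ : E)) ubarL.
- by rewrite d0d1 linear0 ubar0.
have gZ u p : g (u *: p) = u * g p.
  have g0 : g 0 = 0 by move: (gL (-1) 0 0); rewrite scaler0 addr0 mulN1r addNr.
  by have := gL u p 0; rewrite !addr0 g0 addr0.
pose k := (b0 p0 : E) - 1.
have k0 : eact k 1 = 0 by rewrite eactBl hb0 eact1 ep0 subrr.
(* For [u] in the kernel, [b0 (u *: p0) = u * k + u], so [u * g p0] exceeds [ubar u] by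
   [u * ubar k]; the second term removes this defect. *)
pose b := g p0 - ubar k.
have ubarb u : eact u 1 = 0 -> ubar u = u * b.
  move=> u0; have [q eq] : exists q, u *: p0 = d0 q.
    by apply/exact0; rewrite eps_eact ep0.
  have : ubar (u * k + u) = u * g p0.
    rewrite mulrBr mulr1 subrK -gZ eq -gP -eq; congr ubar.
    by rewrite linearZ.
  by rewrite ubarL // /b mulrBr => <-; rewrite addrAC subrr add0r.
exists b%:M; apply/colP => i; rewrite !mxE big_ord1 !mxE mulr1n -ubarb.
  rewrite (ubarE _ (delta_mx 0 i)); first by rewrite -rowE !mxE.
  by rewrite -rowE; apply/matrixP => s t; rewrite !ord1 !mxE mulr1n.
by rewrite eact_diff mulr1 mul1r subrr.
Qed.

End ExtComparison.

(** * The Hessian complex *)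

(** Interface of the tensor algebra: [p] are the degree projections, [d i] removes a first letter
    [x i], and [D] is the universal derivation. *)
Record free_data (K : fieldType) (T : kalgType K) (E : envModel T) (n : nat)
    (x : 'I_n -> T) (p : nat -> {linear kmod T -> kmod T})
    (d : 'I_n -> {linear kmod T -> kmod T}) (D : 'I_n -> {linear kmod T -> kmod E})
    : Prop := FreeData {
  fd_proj : gproj p;
  fd_gen : generates x;
  fd_x : forall i, p 1%N (x i) = x i :> T;
  fd_p0 : forall a : T, exists c : K, p 0%N a = kscal c :> T;
  fd_dX : forall i j (b : T), d i (x j * b) = (if j == i then b else 0) :> T;
  fd_euler : forall a : T, a = p 0%N a + \sum_i x i * d i a :> T;
  fd_pd : forall j i (a : T), p j (d i a) = d i (p j.+1 a) :> T;
  fd_D1 : forall j, D j 1 = 0 :> E;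
  fd_DX : forall j i (b : T), D j (x i * b) =
    (if i == j then et E 1 b else 0) + et E (x i) 1 * D j b :> E
}.

(* [f i] is the [i]-th cyclic derivative of a homogeneous superpotential of
   degree [m.+1]. *)
Record potential (K : fieldType) (T : kalgType K) (E : envModel T) (n m : nat)
    (x : 'I_n -> T) (p : nat -> {linear kmod T -> kmod T})
    (D : 'I_n -> {linear kmod T -> kmod E}) (f : 'I_n -> T) : Prop := Potential {
  pt_deg : forall i, p m (f i) = f i :> T;
  pt_euler : \sum_i x i * f i = \sum_i f i * x i;
  pt_sym : forall i j, eswap (D j (f i)) = D i (f j) :> E;
  pt_Ddeg : forall i j, ecomp E p m.-1%:Z (D j (f i)) = D j (f i)
}.

Section MatrixSwap.
Context {K : fieldType} {A : kalgType K} {E : envModel A}.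

(** The analogue of the conjugate transpose. As [eswap] reverses products, so does [mswap], although
    [E] is not commutative; it turns columns, that is cochains, into rows. *)
Definition mswap r s (M : 'M[E]_(r, s)) : 'M[E]_(s, r) := (map_mx eswap M)^T.

Lemma mswapE r s (M : 'M[E]_(r, s)) i j : mswap M i j = eswap (M j i).
Proof. by rewrite !mxE. Qed.

Lemma mswapM r s t (M : 'M[E]_(r, s)) (N : 'M[E]_(s, t)) :
  mswap (M *m N) = mswap N *m mswap M.
Proof.
apply/matrixP => i j; rewrite mswapE !mxE raddf_sum; apply: eq_bigr => l _ /=.
by rewrite eswapM !mswapE.
Qed.

Lemma mswapK r s (M : 'M[E]_(r, s)) : mswap (mswap M) = M.
Proof. by apply/matrixP => i j; rewrite !mswapE eswapK. Qed.

Fact mswap_zmod r s : zmod_morphism (@mswap r s).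
Proof. by move=> M N; apply/matrixP => i j; rewrite !mxE raddfB. Qed.
HB.instance Definition _ r s :=
  GRing.isZmodMorphism.Build _ _ (@mswap r s) (@mswap_zmod r s).

Lemma mswap_diff_col n (x : 'I_n -> A) : mswap (diff_col E x) = - (diff_col E x)^T.
Proof. by apply/matrixP => i j; rewrite mswapE !mxE eswap_diff. Qed.

End MatrixSwap.

Arguments mswap {K A E r s} M.

(** * Exactness of the Hessian complex at the column of generators *)

Section Quotient.
Context {K : fieldType} {T A : kalgType K} {E : envModel T} (EA : envModel A).
Variables (n m : nat) (x : 'I_n -> T) (p : nat -> {linear kmod T -> kmod T}).
Variables (d : 'I_n -> {linear kmod T -> kmod T}) (D : 'I_n -> {linear kmod T -> kmod E}).
Hypothesis F : free_data x p d D.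
Variable f : 'I_n -> T.
Hypothesis W : potential m x p D f.
Variable rho : khom T A.
Hypotheses (rho_surj : forall a, exists t, rho t = a)
  (rho_ker : forall a, rho a = 0 -> exists t : 'I_n -> E, a = \sum_i eact (t i) (f i))
  (rho_f : forall i, rho (f i) = 0).

Local Notation h := (ehom E EA rho).
Local Notation y := (rho \o x).

Definition hess : 'M[E]_n := \matrix_(i, j) D j (f i).
Definition qhess : 'M[EA]_n := map_mx h hess.

Lemma qhessE i j : qhess i j = h (D j (f i)).
Proof. by rewrite !mxE. Qed.

Lemma mswap_qhess : mswap qhess = qhess.
Proof.
by apply/matrixP => i j; rewrite mswapE !qhessE -ehom_swap (pt_sym W).
Qed.

Lemma rho_gen : generates y.
Proof.
move=> P PK Px PD a; have [t <-] := rho_surj a.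
apply: (fd_gen F (P := fun t => P (rho t))) => [c|i q Pq|q r Pq Pr].
- by rewrite khomZ; apply: PK.
- by rewrite rmorphM; apply: Px.
- by rewrite rmorphD; apply: PD.
Qed.

(** In the Leibniz rule, the terms that differentiate the coefficients keep [g] inside a tensor
    factor and die in the quotient. *)
Lemma uder_eact j t g : rho g = 0 -> h (D j (eact t g)) = h t * h (D j g).
Proof.
move=> g0; elim/et_ind: t => [|u v hu hv|a b].
- by rewrite eact0l linear0 !raddf0 mul0r.
- by rewrite eactDl klinD !raddfD /= mulrDl hu hv.
have DM := uderM (fd_gen F) (fd_D1 F) (fd_DX F).
rewrite eactE !DM mulrDr !raddfD /= !rmorphM /= !ehomE !rmorphM !rmorph1 g0.
by rewrite mulr0 et0l et0r mul0r mul0r mulr0 addr0 add0r mulrA etM mul1r mul1r.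
Qed.

Definition in_hess (v : 'rV[EA]_n) := exists u : 'rV_n, v = u *m qhess.

Lemma in_hessD v v' : in_hess v -> in_hess v' -> in_hess (v + v').
Proof. by move=> [u ->] [u' ->]; exists (u + u'); rewrite mulmxDl. Qed.

Lemma in_hessZ a v : in_hess v -> in_hess (a *: v).
Proof. by move=> [u ->]; exists (a *: u); rewrite scalemxAl. Qed.

Lemma in_hess_uder g : rho g = 0 -> in_hess (\row_j h (D j g)).
Proof.
move=> /rho_ker[t ->]; exists (\row_i h (t i)); apply/rowP => j.
rewrite !mxE klin_sum raddf_sum; apply: eq_bigr => i _ /=.
by rewrite uder_eact ?rho_f // qhessE mxE.
Qed.

Lemma exists_section : exists s : {linear kmod A -> kmod T}, forall a, rho (s a) = a.
Proof. exact: (linear_section (f := khom_lin rho)). Qed.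

(* The universal derivation T -> A (x) V (x) A kills the ideal modulo the image
   of the Hessian, which yields a one-sided inverse of multiplication by the
   column of the [ediff (y i)]. *)
Lemma diff_col_exact (v : 'rV[EA]_n) : v *m diff_col EA y = 0 ->
  exists u : 'rV_n, v = u *m qhess.
Proof.
have [s sP] := exists_section.
pose gj j (a b : A) := (et EA 1 b * h (D j (s a)) : kmod EA).
have gb j : bilin (gj j).
  split=> [a a' b|a b b'|c a b|c a b]; rewrite /gj.
  - by rewrite !klinD raddfD mulrDr.
  - by rewrite etDr mulrDl.
  - rewrite !klinZ rmorphM /= -[h (kscal c)](_ : kscal c = _).
      by rewrite mulrA -kscalC -mulrA.
    by rewrite -!et_kscal ehomE khomZ rmorph1.
  - by rewrite etZr -mulrA.
pose S (u : EA) : 'rV[EA]_n := \row_j elift (V := kmod EA) (gj j) u.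
have SB : zmod_morphism S.
  by move=> u u'; apply/rowP => j; rewrite !mxE (elift_zmod (gb j)).
have S0 : S 0 = 0 by rewrite -[0]subr0 SB subrr.
have SD u u' : S (u + u') = S u + S u'.
  by apply/eqP; rewrite -subr_eq -SB addrK.
have SE a b : S (et EA a b) = et EA 1 b *: \row_j h (D j (s a)).
  by apply/rowP => j; rewrite !mxE (eliftE _ (gb j)).
(* For [u = a (x) b] the difference is [1 (x) b] times the derivative of [s a * x i - s (a * y i)],
   which lies in the ideal because [s] is a section. *)
have key i u : in_hess (u *: delta_mx 0 i - S (u * ediff EA (y i))).
  elim/et_ind: u => [|u u' hu hu'|a b].
  - by rewrite mul0r scale0r S0 subrr; exists 0; rewrite mul0mx.
  - by rewrite mulrDl SD scalerDl opprD addrACA; apply: in_hessD.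
  rewrite mulrBr !etM SB mulr1 mul1r !SE.
  pose g := s a * x i - s (a * y i).
  have g0 : rho g = 0 by rewrite rmorphB rmorphM !sP subrr.
  rewrite (_ : _ - _ = et EA 1 b *: \row_j h (D j g)).
    by apply: in_hessZ; apply: in_hess_uder.
  have DM := uderM (fd_gen F) (fd_D1 F) (fd_DX F).
  apply/rowP => j; rewrite /g !mxE [D j (_ - _)]klinB DM /=.
  have -> : D j (x i) = (i == j)%:R :> E.
    rewrite -[x i]mulr1 (fd_DX F) (fd_D1 F) mulr0 addr0 et11.
    by case: eqP.
  have hB u u' : h (u - u') = h u - h u' by exact: raddfB.
  have hD u u' : h (u + u') = h u + h u' by exact: raddfD.
  have hM u u' : h (u * u') = h u * h u' by exact: rmorphM.
  rewrite hB hD !hM rmorph_nat !ehomE !rmorph1 sP.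
  by rewrite mulrBr mulrDr !mulrA !etM !mul1r opprB eq_sym addrA.
move=> vX.
have -> : v = \sum_i (v 0 i *: delta_mx 0 i - S (v 0 i * ediff EA (y i))).
  rewrite sumrB -row_sum_delta -[LHS]subr0; congr (_ - _).
  have <- : S (\sum_i v 0 i * ediff EA (y i)) = \sum_i S (v 0 i * ediff EA (y i)).
    exact: (big_morph S SD S0).
  have -> : \sum_i v 0 i * ediff EA (y i) = (v *m diff_col EA y) 0 0.
    by rewrite mxE; apply: eq_bigr => i _; rewrite !mxE.
  by rewrite vX mxE S0.
apply: (big_ind in_hess) => [|v1 v2|i _]; last exact: key.
  by exists 0; rewrite mul0mx.
exact: in_hessD.
Qed.

End Quotient.

(** * Regularity of the central element *)

Section Letters.
Context {K : fieldType} {T : kalgType K} {E : envModel T}.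
Variables (n : nat) (x : 'I_n -> T) (p : nat -> {linear kmod T -> kmod T}).
Variables (d : 'I_n -> {linear kmod T -> kmod T}) (D : 'I_n -> {linear kmod T -> kmod E}).
Hypothesis F : free_data x p d D.

Lemma sumX_inj (a : 'I_n -> T) : \sum_i x i * a i = 0 -> forall i, a i = 0.
Proof.
move=> xa i; have : d i (\sum_j x j * a j) = 0 :> T by rewrite xa klin0.
rewrite klin_sum (bigD1 i) //= (fd_dX F) eqxx big1 ?addr0 // => j ji.
by rewrite (fd_dX F) (negPf ji).
Qed.

Lemma fd_deriv_scal i c : d i (kscal c) = 0 :> T.
Proof.
have := fd_euler F (kscal c); have -> : p 0%N (kscal c) = kscal c :> T.
  by rewrite -[kscal c]mulr1 klinZ (gproj_1 (fd_proj F)).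
move=> e; move: i; apply: sumX_inj; apply: (addrI (kscal c)).
by rewrite addr0; apply/esym.
Qed.

Definition strip (i : 'I_n) (u : E) : E := emap E E (d i) (idfun : {linear kmod T -> kmod T}) u.
HB.instance Definition _ i := GRing.isZmodMorphism.Build E E (strip i)
  (raddfB (emap E E (d i) (idfun : {linear kmod T -> kmod T}))).

Lemma stripE i a b : strip i (et E a b) = et E (d i a) b.
Proof. exact: emapE. Qed.

(** Sends [a (x) b] to the constant term of [a] times [b]: the part of [u] from which no first
    letter can be stripped. *)
Definition lconst (u : E) : T :=
  elift (V := kmod T) (fun a b => (p 0%N a : T) * b : kmod T) u.

Fact lconst_bilin : bilin (V := kmod T) (fun a b => (p 0%N a : T) * b : kmod T).
Proof.
split=> [a a' b|a b b'|c a b|c a b] /=.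
- by rewrite klinD mulrDl.
- by rewrite mulrDr.
- by rewrite klinZ -mulrA.
- by rewrite kmodZE mulrA -kscalC -mulrA.
Qed.
HB.instance Definition _ := GRing.isZmodMorphism.Build E T lconst
  (@elift_zmod _ _ E (kmod T) _ lconst_bilin).

Lemma lconstE a b : lconst (et E a b) = (p 0%N a : T) * b.
Proof. exact: (eliftE E lconst_bilin). Qed.

Lemma eact_strip u g :
  eact u g = g * lconst u + \sum_i x i * eact (strip i u) g.
Proof.
elim/et_ind: u => [|u v hu hv|a b].
- rewrite eact0l raddf0 mulr0 big1 ?addr0 // => i _.
  by rewrite raddf0 eact0l mulr0.
- rewrite eactDl raddfD /= mulrDr hu hv addrACA; congr (_ + _).
  by rewrite -big_split; apply: eq_bigr => i _; rewrite raddfD /= eactDl mulrDr.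
rewrite eactE lconstE {1}(fd_euler F a) !mulrDl; congr (_ + _).
  by have [c ->] := fd_p0 F a; rewrite mulrA -kscalC.
by rewrite !mulr_suml; apply: eq_bigr => i _; rewrite stripE eactE !mulrA.
Qed.

Lemma deriv_mulr i (g b : T) : p 0%N g = 0 :> T -> d i (g * b) = d i g * b :> T.
Proof.
move=> g0; have ge : g = \sum_j x j * d j g by rewrite {1}(fd_euler F g) g0 add0r.
rewrite {1}ge mulr_suml klin_sum (bigD1 i) //= -mulrA (fd_dX F) eqxx big1 ?addr0 // => j ji.
by rewrite -mulrA (fd_dX F) (negPf ji).
Qed.

Lemma deriv_eact i u g : p 0%N g = 0 :> T ->
  d i (eact u g) = d i g * lconst u + eact (strip i u) g :> T.
Proof.
move=> g0; rewrite eact_strip klinD deriv_mulr //; congr (_ + _).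
rewrite klin_sum (bigD1 i) //= (fd_dX F) eqxx big1 ?addr0 // => j ji.
by rewrite (fd_dX F) (negPf ji).
Qed.

Lemma gproj_deriv j i (a : T) : p j a = a :> T ->
  p j.-1 (d i a) = d i a :> T /\ (j = 0%N -> d i a = 0 :> T).
Proof.
case: j => [|j] pa.
  have da : d i a = 0 :> T by have [c e] := fd_p0 F a; rewrite -pa e fd_deriv_scal.
  by rewrite da klin0.
by rewrite /= (fd_pd F) pa.
Qed.

Lemma ecomp_strip z i u : ecomp E p (z - 1) (strip i u) = strip i (ecomp E p z u).
Proof.
elim/(@et_hind _ _ E _ (fd_proj F)): u => [|u v hu hv|s t a b pa pb]; first by rewrite !raddf0.
  by rewrite !raddfD /= hu hv.
rewrite stripE (ecompE _ (fd_proj F) _ pa pb) (fun_if (strip i)) raddf0 stripE.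
have [pd d0] := gproj_deriv i pa.
case: s pa pd d0 => [|s] pa pd d0; first by rewrite d0 // et0l raddf0 if_same.
rewrite (ecompE _ (fd_proj F) _ pd pb) subr_eq -PoszD.
by rewrite /= [(s + t + 1)%N]addn1 -addSn.
Qed.

Lemma gproj_lconst j u : p j (lconst u) = lconst (ecomp E p j u) :> T.
Proof.
elim/(@et_hind _ _ E _ (fd_proj F)): u => [|u v hu hv|s t a b pa pb].
- by rewrite !raddf0.
- by rewrite !raddfD /= hu hv.
rewrite lconstE (ecompE _ (fd_proj F) _ pa pb) (fun_if lconst) raddf0 lconstE.
case: s pa => [|s] pa.
  have pab : p t ((p 0%N a : T) * b) = (p 0%N a : T) * b :> T.
    by rewrite pa; apply: (gproj_M (fd_proj F) pa pb).
  by rewrite (gprojE (fd_proj F) j pab) add0n eqz_nat.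
by rewrite (gprojE (fd_proj F) 0 pa) mul0r klin0 if_same.
Qed.

End Letters.

Section Regularity.
Context {K : fieldType} {T A B : kalgType K} {E : envModel T} {EA : envModel A}.
Variables (n m : nat) (x : 'I_n -> T) (p : nat -> {linear kmod T -> kmod T}).
Variables (d : 'I_n -> {linear kmod T -> kmod T}) (D : 'I_n -> {linear kmod T -> kmod E}).
Hypothesis F : free_data x p d D.
Variable f : 'I_n -> T.
Hypotheses (W : potential m.+1 x p D f).
Variables (rho : khom T A) (q : nat -> {linear kmod A -> kmod A}).
Hypotheses (rho_surj : forall a, exists t, rho t = a)
  (rho_ker : forall a, rho a = 0 -> exists t : 'I_n -> E, a = \sum_i eact (t i) (f i))
  (rho_f : forall i, rho (f i) = 0)
  (rho_q : forall i a, rho (p i a) = q i (rho a)).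
Hypothesis hess_exact : forall v : 'rV[EA]_n, v *m qhess EA D f rho = 0 ->
  exists b : 'M_1, v = b *m (diff_col EA (rho \o x))^T.
Variables (pi : khom T B) (k : 'I_n).
Hypotheses (pi_f : forall i, i != k -> pi (f i) = 0)
  (Omega_central : forall b : B, pi (f k) * b = b * pi (f k)).

Local Notation h := (ehom E EA rho).
Let pP := fd_proj F.

Lemma ehom_surj u : exists v, h v = u.
Proof.
elim/et_ind: u => [|u u' [v <-] [v' <-]|a b].
- by exists 0; rewrite raddf0.
- by exists (v + v'); rewrite raddfD.
- have [s <-] := rho_surj a; have [t <-] := rho_surj b.
  by exists (et E s t); rewrite ehomE.
Qed.

(** As [rho] commutes with the degree 0 projections, [rho] after [lconst] factors through the
    enveloping algebra of [A]. *)
Lemma lconst_ker u : h u = 0 -> rho (lconst p u) = 0.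
Proof.
pose g (a b : A) : kmod A := (q 0%N a : A) * b.
have gb : bilin g.
  split=> [a a' b|a b b'|c a b|c a b]; rewrite /g.
  - by rewrite klinD mulrDl.
  - by rewrite mulrDr.
  - by rewrite klinZ -mulrA.
  - by rewrite kmodZE mulrA -kscalC -mulrA.
suff -> : rho (lconst p u) = elift g (h u).
  by move=> ->; rewrite -[0](subrr 0) (elift_zmod gb) subrr.
apply: (et_eq (f := fun u => rho (lconst p u)) (g := fun u => elift g (h u))).
- by move=> v v'; rewrite !raddfB.
- by move=> v v'; rewrite raddfB /= (elift_zmod gb).
- by move=> a b; rewrite lconstE rmorphM rho_q ehomE (eliftE _ gb).
Qed.

Lemma potential_proj0 i : p 0%N (f i) = 0 :> T.
Proof. by rewrite (gprojE pP 0 (pt_deg W i)). Qed.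

(** Only [f k] survives in [B], and being central it moves out of the two-sided action. *)
Lemma pi_eact i (u : E) : pi (eact u (f i)) = if i == k then pi (f k) * pi (eact u 1) else 0.
Proof.
elim/et_ind: u => [|u v hu hv|a b].
- by rewrite !eact0l raddf0 mulr0 if_same.
- by rewrite !eactDl !raddfD /= hu hv; case: ifP; rewrite ?mulrDr ?addr0.
rewrite !eactE mulr1 !rmorphM; case: eqP => [->|/eqP ik].
  by rewrite -Omega_central -mulrA.
by rewrite pi_f // mulr0 mul0r.
Qed.

(* Induction on the degree: by exactness at the Hessian, [t] is a multiple of
   the Euler relation plus some [t'] in the kernel of T (x) T -> A (x) A, and
   stripping the first letter of [t'] lowers the degree. *)
Lemma syzygy_homog (N : nat) (z : int) (t : 'I_n -> E) : z < N%:Z ->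
  (forall i, ecomp E p z (t i) = t i) ->
  \sum_i eact (t i) (f i) = 0 -> pi (eact (t k) 1) = 0.
Proof.
elim: N z t => [|N IH] z t zN tz St.
  by rewrite -tz ecomp_neg // eact0l raddf0.
have [z0|] := ltP z 0; first by rewrite -tz ecomp_neg // eact0l raddf0.
case: z zN tz => // z zN tz _.
(* Applying [D j] to the syzygy and reducing to [A^e] shows that the row of the [h (t i)] is killed
   by the Hessian, hence is a multiple of the row of the [ediff]. *)
have [b0 hb0] : exists b : E, forall i, h (t i - b * ediff E (x i)) = 0.
  have [|b eb] := hess_exact (v := \row_i h (t i)).
    apply/rowP => j; rewrite !mxE.
    transitivity (h (D j (\sum_i eact (t i) (f i)))); last first.
      by rewrite St klin0 raddf0.
    rewrite klin_sum raddf_sum; apply: eq_bigr => i _ /=.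
    by rewrite (uder_eact EA F) ?rho_f // !mxE.
  have [c hc] := ehom_surj (b 0 0); exists c => i.
  rewrite raddfB /= rmorphM /= ehom_diff hc; apply/eqP; rewrite subr_eq0; apply/eqP.
  by move/rowP/(_ i): eb; rewrite !mxE big_ord1 !mxE.
(* Keeping only the component of degree [z - 1] makes [t'] homogeneous of degree [z]. *)
pose b := ecomp E p (z%:Z - 1) b0.
pose t' i := t i - b * ediff E (x i).
have xdeg i : ecomp E p 1 (ediff E (x i)) = ediff E (x i).
  exact: (ecomp_diff E pP (fd_x F i)).
have t'z i : ecomp E p z%:Z (t' i) = t' i.
  by rewrite raddfB /= tz (ecompM pP _ _ (xdeg i)) /b (ecomp_idem pP).
have ht' i : h (t' i) = 0.
  rewrite /t' -{1}(tz i) /b -(ecompM pP _ _ (xdeg i)) -raddfB.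
  by rewrite (ehom_comp EA rho_q) hb0 raddf0.
have St' : \sum_i eact (t' i) (f i) = 0.
  under eq_bigr => i _ do rewrite eactBl eactM eact_diff.
  by rewrite sumrB St sub0r -raddf_sum sumrB (pt_euler W) subrr raddf0 oppr0.
suff : pi (eact (t' k) 1) = 0.
  by rewrite eactBl eactM eact_diff mulr1 mul1r subrr raddf0 subr0.
pose g j := lconst p (t' j).
have /choice[s sP] j : exists s : 'I_n -> E,
    (forall i, ecomp E p (z%:Z - m.+1%:Z) (s i) = s i) /\
    g j = \sum_i eact (s i) (f i).
  have [s0 e0] := rho_ker (lconst_ker (ht' j)).
  exists (fun i => ecomp E p (z%:Z - m.+1%:Z) (s0 i)); split.
    by move=> i; rewrite (ecomp_idem pP).
  have <- : p z (g j) = g j :> T by rewrite /g (gproj_lconst F) t'z.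
  rewrite /g e0 klin_sum; apply: eq_bigr => i _.
  by rewrite (gproj_eact pP _ _ (pt_deg W i)).
(* Removing a first letter [x_i] from [sum_j t'_j f_j = 0] leaves the stripped terms and the
   products [d_i(f_j) g_j]. Expanding each [g_j] in the ideal turns this into a syzygy, of degree
   [z - 1] since [d_i(f_l)] has degree [m] and [s] has degree [z - (m + 1)]. *)
pose t'' i j := strip d i (t' j) + \sum_l et E (d i (f l)) 1 * s l j.
have t''k i : pi (eact (t'' i k) 1) = 0.
  apply: (IH (z%:Z - 1)) => [|j|].
  - by rewrite ltrBlDr -PoszD addn1.
  - rewrite raddfD /= (ecomp_strip F) t'z raddf_sum; congr (_ + _).
    apply: eq_bigr => l _ /=; rewrite (ecompM pP _ _ (proj1 (sP l) j)).
    have [pd _] := gproj_deriv F i (pt_deg W l).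
    have -> : z%:Z - 1 - (z%:Z - m.+1%:Z) = m%:Z.
      by rewrite -addn1 PoszD opprB addrC addrA subrK addrK.
    by rewrite (ecomp_et1 E pP pd).
  have dS : \sum_j d i (eact (t' j) (f j)) = 0 :> T by rewrite -klin_sum St' klin0.
  rewrite -[RHS]dS.
  under [RHS]eq_bigr => j _ do rewrite (deriv_eact F _ _ (potential_proj0 j)) addrC.
  under [LHS]eq_bigr => j _ do rewrite eactDl eact_suml.
  rewrite !big_split /=; congr (_ + _); rewrite exchange_big; apply: eq_bigr => l _.
  rewrite -/(g l) (proj2 (sP l)) mulr_sumr; apply: eq_bigr => j _.
  by rewrite eactM eactE mulr1.
have stripk i : pi (eact (strip d i (t' k)) 1) =
    - \sum_l pi (d i (f l)) * pi (eact (s l k) 1).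
  apply/eqP; rewrite -addr_eq0; apply/eqP; rewrite -[RHS](t''k i) /t'' eactDl [RHS]raddfD /=.
  rewrite eact_suml raddf_sum; congr (_ + _); apply: eq_bigr => l _ /=.
  by rewrite eactM eactE mulr1 rmorphM.
(* The class of [t'_k] is [pi (g k)] plus the stripped part. By [sum_i x_i d_i(f_l) = f_l], the
   stripped part is minus the sum of the [pi (f l) * pi (eact (s l k) 1)]. Only [l = k] survives in
   each, and the two cancel. *)
rewrite (eact_strip F) mul1r raddfD raddf_sum /= -/(g k).
under eq_bigr => i _ do rewrite rmorphM stripk mulrN mulr_sumr.
rewrite sumrN exchange_big /= (proj2 (sP k)) raddf_sum -sumrB big1 // => l _ /=.
rewrite pi_eact; under eq_bigr => i _ do rewrite mulrA -rmorphM.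
have fl : pi (f l) = \sum_i pi (x i * d i (f l)).
  by rewrite {1}(fd_euler F (f l)) potential_proj0 add0r raddf_sum.
rewrite -mulr_suml -fl; case: eqP => [->|/eqP lk]; first by rewrite subrr.
by rewrite pi_f // mul0r subrr.
Qed.

Lemma syzygy (t : 'I_n -> E) :
  \sum_i eact (t i) (f i) = 0 -> pi (eact (t k) 1) = 0.
Proof.
move=> St; have [s es] := ecomp_supp pP (t k).
rewrite (es (undup s) (undup_uniq s)); last by move=> z; rewrite mem_undup.
rewrite eact_suml raddf_sum big1 // => -[z|z] _ /=; last first.
  by rewrite ecomp_neg // eact0l raddf0.
apply: (syzygy_homog (N := z.+1) (z := z%:Z) (t := fun i => ecomp E p z (t i))).
- by rewrite ltz_nat.
- by move=> i; rewrite (ecomp_idem pP).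
have pS : \sum_i p (z + m.+1)%N (eact (t i) (f i)) = 0 :> T.
  by rewrite -klin_sum St klin0.
rewrite -[RHS]pS.
apply: eq_bigr => i _; rewrite (gproj_eact pP _ _ (pt_deg W i)).
by rewrite PoszD addrK.
Qed.

Hypothesis pi_ker : forall a, pi a = 0 ->
  ideal_gen (fun r => exists2 i, i != k &
    r = f i \/ r = x i * f k - f k * x i) a.

(** The relations of [B] involve [f k] only through commutators, whose coefficient [ediff (x i)]
    acts on 1 as 0; this vanishing is stable under sums and two-sided multiples. *)
Lemma ideal_syzygy a : pi a = 0 -> exists t : 'I_n -> E,
  a = \sum_i eact (t i) (f i) /\ pi (eact (t k) 1) = 0.
Proof.
pose J c := exists t : 'I_n -> E,
  c = \sum_i eact (t i) (f i) /\ pi (eact (t k) 1) = 0.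
move=> /pi_ker/(_ J); apply; first split.
- exists (fun=> 0); rewrite eact0l raddf0 big1 // => i _; exact: eact0l.
- move=> b c [t [-> tk]] [t' [-> t'k]]; exists (fun i => t i - t' i); split.
    by rewrite -sumrB; apply: eq_bigr => i _; rewrite eactBl.
  by rewrite eactBl raddfB /= tk t'k subrr.
- move=> b a' c [t [-> tk]]; exists (fun i => et E b c * t i); split.
    rewrite mulr_sumr mulr_suml; apply: eq_bigr => i _.
    by rewrite eactM eactE.
  by rewrite eactM eactE !rmorphM tk mulr0 mul0r.
move=> r [i ik [->|->]].
  exists (fun j => (j == i)%:R); split; last first.
    by rewrite eq_sym (negPf ik) eact0l raddf0.
  rewrite (bigD1 i) //= eqxx eact1 big1 ?addr0 // => j /negPf ->.
  exact: eact0l.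
exists (fun j => if j == k then ediff E (x i) else 0); split; last first.
  by rewrite eqxx eact_diff mulr1 mul1r subrr raddf0.
rewrite (bigD1 k) //= eqxx eact_diff big1 ?addr0 // => j /negPf ->.
exact: eact0l.
Qed.

Hypothesis pi_surj : forall b, exists t, pi t = b.

(** If [f_k c] lies in the ideal of [B], it has two expansions in the [f_i]: one with coefficient
    [1 (x) c] at [k] only, the other with a coefficient at [k] that vanishes in [B]. Their
    difference is a syzygy. *)
Lemma Omega_regular b : pi (f k) * b = 0 -> b = 0.
Proof.
have [c <-] := pi_surj b; rewrite -rmorphM => /ideal_syzygy[t [te tk]].
suff : pi (eact (t k - et E 1 c) 1) = 0.
  by rewrite eactBl raddfB /= tk eactE !mul1r sub0r => /eqP; rewrite oppr_eq0 => /eqP.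
have := @syzygy (fun i => t i - if i == k then et E 1 c else 0).
rewrite eqxx; apply; under eq_bigr => i _ do rewrite eactBl.
rewrite sumrB -te (bigD1 k) //= eqxx eactE mul1r big1 ?addr0 ?subrr // => i /negPf ->.
exact: eact0l.
Qed.

End Regularity.

(** * The twisted cone *)

Lemma mul_mx_central (R : pzRingType) (z : R) (zc : forall u, z * u = u * z) r s
  (N : 'M[R]_(r, s)) : N *m z%:M = z *: N.
Proof.
apply/matrixP => i j; rewrite !mxE (bigD1 j) //= mxE eqxx mulr1n big1 ?addr0 => [|l lj].
  by rewrite zc.
by rewrite mxE (negPf lj) mulr0n mulr0.
Qed.

Section CentralElement.
Context {K : fieldType} {A B : kalgType K} (EA : envModel A) (EB : envModel B).
Variables (tau : khom B A) (z : B) (M : nat) (p : nat -> {linear kmod B -> kmod B}).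
Hypotheses (tau_surj : forall a, exists b, tau b = a)
  (tau_ker : forall b, tau b = 0 -> exists c, b = z * c)
  (tau_z : tau z = 0) (zC : forall b, z * b = b * z) (zreg : forall b, z * b = 0 -> b = 0).
Hypotheses (pP : gproj p) (z_deg : p M z = z :> B) (M0 : (0 < M)%N).

Local Notation h := (ehom EB EA tau).
Local Notation z1 := (et EB z 1).
Local Notation z2 := (et EB 1 z).
Local Notation zeta := (ediff EB z).

Let z2C : forall u, z2 * u = u * z2 := et1r_central zC.
Let zetaC : forall u, zeta * u = u * zeta := ediff_central zC.

(** Tensored with the identity, this linear left inverse of multiplication by [z] cancels [z1] or
    [z2] in the enveloping algebra. *)
Lemma exists_retraction : exists r : {linear kmod B -> kmod B}, forall b : B, r (z * b) = b :> B.
Proof.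
have zlin : linear ((fun b => z * b) : kmod B -> kmod B).
  move=> c x y; rewrite mulrDr kmodZE [z * _]mulrA.
  by rewrite [z * kscal c]zC -mulrA.
pose zl : {linear kmod B -> kmod B} :=
  HB.pack (_ : kmod B -> kmod B) (GRing.isLinear.Build K (kmod B) (kmod B) *:%R _ zlin).
have [|r rP] := linear_retraction (f := zl).
  move=> b b' /= e; apply/eqP; rewrite -subr_eq0; apply/eqP/zreg.
  by rewrite mulrBr e subrr.
by exists r => b; apply: rP.
Qed.

(** With a linear section [s] of [tau], written as a map of [B], split [a (x) b - s a (x) s b] as
    [(a - s a) (x) b + s a (x) (b - s b)]; both differences are multiples of [z]. *)
Lemma ehom_ker u : h u = 0 -> exists a b, u = z1 * a + z2 * b.
Proof.
have [s sP] : exists s : {linear kmod A -> kmod B}, forall a, tau (s a) = a.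
  exact: (linear_section (f := khom_lin tau)).
pose J u := exists a b, u = z1 * a + z2 * b.
have J0 : J 0 by exists 0, 0; rewrite !mulr0 addr0.
have JD v v' : J v -> J v' -> J (v + v').
  move=> [a [b ->]] [a' [b' ->]]; exists (a + a'), (b + b').
  by rewrite !mulrDr addrACA.
suff Ju : J (u - emap EA EB s s (h u)) by move=> hu; move: Ju; rewrite hu raddf0 subr0.
elim/et_ind: u => [|v v' hv hv'|a b]; first by rewrite !raddf0 addr0.
  by rewrite !raddfD /= addrACA; apply: JD.
rewrite ehomE emapE.
have [c ec] : exists c, a - s (tau a) = z * c.
  by apply: tau_ker; rewrite raddfB /= sP subrr.
have [c' ec'] : exists c, b - s (tau b) = z * c.
  by apply: tau_ker; rewrite raddfB /= sP subrr.
exists (et EB c b), (et EB (s (tau a)) c'); rewrite !etM mulr1 mul1r -zC -ec -ec'.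
by rewrite etBl etBr addrA subrK.
Qed.

Lemma ehom_ker_mx r s (v : 'M[EB]_(r, s)) : map_mx h v = 0 ->
  exists a b, v = z1 *: a + z2 *: b.
Proof.
move=> hv; have /choice[a ha] (ij : 'I_r * 'I_s) : exists a, exists b,
    v ij.1 ij.2 = z1 * a + z2 * b.
  by apply: ehom_ker; move/matrixP/(_ ij.1 ij.2): hv; rewrite !mxE.
have /choice[b hb] := ha.
exists (\matrix_(i, j) a (i, j)), (\matrix_(i, j) b (i, j)).
by apply/matrixP => i j; rewrite !mxE (hb (i, j)).
Qed.

Lemma ehom_surj_mx r s (v : 'M[EA]_(r, s)) : exists u, map_mx h u = v.
Proof.
have hs u : exists w, h w = u.
  elim/et_ind: u => [|u u' [w <-] [w' <-]|a b].
  - by exists 0; rewrite raddf0.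
  - by exists (w + w'); rewrite raddfD.
  - have [c <-] := tau_surj a; have [c' <-] := tau_surj b.
    by exists (et EB c c'); rewrite ehomE.
have [g gP] := choice hs; exists (map_mx g v).
by apply/matrixP => i j; rewrite !mxE gP.
Qed.

Lemma scale_z2_inj r s (v : 'M[EB]_(r, s)) : z2 *: v = 0 -> v = 0.
Proof.
have [R RP] := exists_retraction.
have Rz u : emap EB EB (idfun : {linear kmod B -> kmod B}) R (z2 * u) = u.
  elim/et_ind: u => [|u u' hu hu'|a b]; first by rewrite mulr0 raddf0.
    by rewrite mulrDr raddfD /= hu hu'.
  by rewrite etM emapE mul1r -zC RP.
move/matrixP => v0; apply/matrixP => i j; rewrite -[LHS]Rz.
by have := v0 i j; rewrite !mxE => ->; rewrite raddf0.
Qed.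

(** Together with [scale_z2_inj] this makes [z2], [z1] a regular sequence: the retraction acts on
    the first factor and commutes with [z2]. *)
Lemma scale_z1_z2 r s (v w : 'M[EB]_(r, s)) : z1 *: v = z2 *: w -> exists u, v = z2 *: u.
Proof.
have [R RP] := exists_retraction.
pose R1 := emap EB EB R (idfun : {linear kmod B -> kmod B}).
have R10 : R1 0 = 0 by exact: raddf0.
have R1D u u' : R1 (u + u') = R1 u + R1 u' by exact: raddfD.
have R1z1 u : R1 (z1 * u) = u.
  elim/et_ind: u => [|u u' hu hu'|a b]; first by rewrite mulr0 R10.
    by rewrite mulrDr R1D hu hu'.
  by rewrite etM /R1 emapE mulr1 RP.
have R1z2 u : R1 (z2 * u) = z2 * R1 u.
  elim/et_ind: u => [|u u' hu hu'|a b]; first by rewrite mulr0 R10 mulr0.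
    by rewrite mulrDr !R1D hu hu' mulrDr.
  by rewrite etM /R1 !emapE etM !mul1r.
move/matrixP => vw; exists (map_mx R1 w); apply/matrixP => i j.
by have := vw i j; rewrite !mxE -R1z2 => <-; rewrite R1z1.
Qed.

Lemma rcomp_scale r (sh : 'rV[int]_r) l (v : 'rV[EB]_r) :
  rcomp p sh l (z2 *: v) = z2 *: rcomp p sh (l - M%:Z) v.
Proof.
apply/rowP => j; rewrite !mxE z2C (ecompM pP _ _ (ecomp_1et EB pP z_deg)) -z2C.
by rewrite addrAC.
Qed.

Section Cone.
(* A sequence of matrices which squares to zero up to [zeta] times the homotopy
   [hC]; [coneM] is the differential of the twisted cone of [zeta]. *)
Variables (aC : nat -> nat) (sC : forall i, 'rV[int]_(aC i)).
Variables (dC : forall i, 'M[EB]_(aC i.+1, aC i)) (hC : forall i, 'M[EB]_(aC i.+2, aC i)).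
Hypotheses (dC_dC : forall i, dC i.+1 *m dC i = zeta *: hC i)
  (dC_hC : forall i, dC i.+2 *m hC i = hC i.+1 *m dC i)
  (dC_exact : forall i (v : 'rV[EA]_(aC i.+2)), v *m map_mx h (dC i.+1) = 0 ->
     exists u : 'rV_(aC i.+3), v = u *m map_mx h (dC i.+2))
  (sC_ge0 : forall i j, 0 <= sC i 0 j)
  (dC_homog : forall i, mhomog p (sC i.+1) (sC i) (dC i))
  (hC_homog : forall i, mhomog p (sC i.+2) (sC i + const_mx M%:Z) (hC i)).

Definition coneR i := (aC i.+1 + aC i)%N.
(** The second summand is the source of [zeta], so it is shifted by the degree [M] of [z]. *)
Definition coneS i : 'rV[int]_(coneR i) := row_mx (sC i.+1) (sC i + const_mx M%:Z).
Definition coneM i : 'M[EB]_(coneR i.+1, coneR i) :=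
  block_mx (dC i.+1) (- hC i) zeta%:M (- dC i).

(** On the diagonal, [- hC] times [zeta] cancels the product of the two [dC]; the upper right corner
    vanishes because [dC] and [hC] commute. *)
Lemma coneMM i : coneM i.+1 *m coneM i = 0.
Proof.
rewrite /coneM mulmx_block !(mul_mx_central zetaC) !mul_scalar_mx.
rewrite !mulmxN !mulNmx !opprK !scalerN !dC_dC dC_hC.
by rewrite !subrr !addNr block_mx_const.
Qed.

Lemma coneM_homog i : mhomog p (coneS i.+1) (coneS i) (coneM i).
Proof.
move=> a b; rewrite /coneS /coneM.
case: (split_ordP a) => {}a ->; case: (split_ordP b) => {}b ->;
  rewrite ?block_mxEul ?block_mxEur ?block_mxEdl ?block_mxEdr ?row_mxEl ?row_mxEr.
- exact: dC_homog.
- by rewrite [(- hC i) a b]mxE raddfN /= hC_homog.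
- rewrite !mxE addrAC; case: eqP => [->|_]; last by rewrite !mulr0n raddf0.
  by rewrite subrr add0r mulr1n (ecomp_diff EB pP z_deg).
- rewrite [(- dC i) a b]mxE raddfN /= !mxE opprD addrACA subrr addr0.
  by rewrite dC_homog.
Qed.

Lemma coneS_ge0 i j : 0 <= coneS i 0 j.
Proof.
rewrite /coneS; case: (split_ordP j) => j' ->; rewrite ?row_mxEl ?row_mxEr //.
by rewrite !mxE addr_ge0.
Qed.

(** Every cycle is divisible by [z2] modulo boundaries. Over [A] the map [zeta] vanishes, so the
    first component becomes a cycle of an exact complex and lifts to a boundary up to multiples of
    [z1] and [z2]. *)
Lemma cone_step i (v : 'rV_(coneR i.+1)) : v *m coneM i = 0 ->
  exists (u : 'rV_(coneR i.+2)) (v' : 'rV_(coneR i.+1)),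
    v = u *m coneM i.+1 + z2 *: v' /\ v' *m coneM i = 0.
Proof.
move=> vM; pose c : 'rV_(aC i.+2) := lsubmx v; pose c' : 'rV_(aC i.+1) := rsubmx v.
have vE : v = row_mx c c' by rewrite hsubmxK.
have first_block (a : 'rV_(aC i.+2)) (a' : 'rV_(aC i.+1)) :
    row_mx a a' *m coneM i = 0 -> a *m dC i.+1 + zeta *: a' = 0.
  rewrite mul_row_block mul_mx_central; last exact: zetaC.
  by rewrite -row_mx0 => /eq_row_mx[].
have hz : h zeta = 0 by rewrite ehom_diff tau_z /ediff et0l et0r subrr.
have [u0 eu0] : exists u, map_mx h c = u *m map_mx h (dC i.+2).
  apply: dC_exact; rewrite -map_mxM.
  move: vM; rewrite vE => /first_block/eqP; rewrite addr_eq0 => /eqP ->.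
  by apply/matrixP => s t; rewrite !mxE raddfN /= rmorphM /= hz mul0r oppr0.
have [b eb] := ehom_surj_mx u0.
have [a [a' ea]] : exists a a', c - b *m dC i.+2 = z1 *: a + z2 *: a'.
  by apply: ehom_ker_mx; rewrite map_mxB map_mxM eb eu0 subrr.
(* The second entry [a] subtracts [zeta a = z1 a - z2 a], which trades the multiple of [z1] for one
   of [z2]. *)
pose u : 'rV_(coneR i.+2) := row_mx b a.
pose c1 := c' + b *m hC i.+1 + a *m dC i.+1.
have v1E : v - u *m coneM i.+1 = row_mx (z2 *: (a + a')) c1.
  rewrite vE mul_row_block opp_row_mx add_row_mx; congr row_mx.
    rewrite mul_mx_central; last exact: zetaC.
    by rewrite opprD addrA ea /ediff scalerBl opprB [z1 *: a + _]addrC addrACA subrr addr0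
      scalerDr addrC.
  by rewrite !mulmxN opprD !opprK addrA.
have v1M : (v - u *m coneM i.+1) *m coneM i = 0.
  by rewrite mulmxBl vM -mulmxA coneMM mulmx0 subrr.
have [c2 ec2] : exists c2, c1 = z2 *: c2.
  (* The cycle condition reads [zeta c1 = - z2 (a + a') dC], that is, [z1 c1] is a multiple of
     [z2]. *)
  apply: (@scale_z1_z2 _ _ _ (c1 - (a + a') *m dC i.+1)).
  move: v1M; rewrite v1E => /first_block/eqP.
  rewrite -scalemxAl /ediff scalerBl addrCA addr_eq0 => /eqP ->.
  by rewrite opprB scalerBr.
exists u, (row_mx (a + a') c2); split.
  by rewrite scale_row_mx -ec2 -v1E addrC subrK.
by apply: scale_z2_inj; rewrite scalemxAl scale_row_mx -ec2 -v1E.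
Qed.

(** Each division by [z2] lowers the degree by [M > 0], while homogeneous rows of negative degree
    vanish because the shifts are nonnegative. *)
Lemma cone_exact i (v : 'rV_(coneR i.+1)) : v *m coneM i = 0 ->
  exists u, v = u *m coneM i.+1.
Proof.
have homog (N : nat) (l : int) (w : 'rV_(coneR i.+1)) : l < N%:Z ->
    rcomp p (coneS i.+1) l w = w -> w *m coneM i = 0 ->
    exists u, w = u *m coneM i.+1.
  elim: N l w => [|N IH] l w lN wl wM.
    exists 0; rewrite mul0mx -wl; apply/rowP => j; rewrite mxE ecomp_neg; first by rewrite mxE.
    by rewrite subr_lt0; apply: (lt_le_trans lN); exact: coneS_ge0.
  have [u [w' [ew w'M]]] := cone_step wM.
  have [|||u' eu'] := IH (l - M%:Z) (rcomp p (coneS i.+1) (l - M%:Z) w').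
  - rewrite ltrBlDr (lt_le_trans lN) // -PoszD lez_nat.
    by rewrite -addn1 leq_add2l.
  - exact: rcomp_idem.
  - by rewrite -(rcomp_mul pP _ _ (@coneM_homog i)) w'M raddf0.
  exists (rcomp p (coneS i.+2) l u + z2 *: u').
  rewrite mulmxDl -scalemxAl -eu' -rcomp_scale.
  by rewrite -(rcomp_mul pP _ _ (@coneM_homog i.+1)) -raddfD /= -ew wl.
move=> vM; have [s /(_ (undup s) (undup_uniq s)) ->] := rcomp_supp pP (coneS i.+1) v.
  apply: (big_ind (fun w => exists u, w = u *m coneM i.+1)) => [|a b [u ->] [u' ->]|l _].
  - by exists 0; rewrite mul0mx.
  - by exists (u + u'); rewrite mulmxDl.
  apply: (homog `|l|.+1 l); first by case: l => l //; rewrite ltz_nat.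
    exact: rcomp_idem.
  by rewrite -(rcomp_mul pP _ _ (@coneM_homog i)) vM raddf0.
by move=> l; rewrite mem_undup.
Qed.

End Cone.
End CentralElement.

Lemma rV0 (R : pzRingType) (u : 'rV[R]_0) : u = 0.
Proof. by apply/rowP => -[]. Qed.

Lemma cV0 (R : pzRingType) (u : 'cV[R]_0) : u = 0.
Proof. by apply/colP => -[]. Qed.

(** * The deformed cone of the Hessian complex and its self-duality *)

Section ConeComplex.
Context {K : fieldType} {A B : kalgType K} (EA : envModel A) (EB : envModel B).
Variables (tau : khom B A) (z : B) (M : nat) (p : nat -> {linear kmod B -> kmod B}).
Hypotheses (tau_surj : forall a, exists b, tau b = a)
  (tau_ker : forall b, tau b = 0 -> exists c, b = z * c)
  (tau_z : tau z = 0) (zC : forall b, z * b = b * z) (zreg : forall b, z * b = 0 -> b = 0).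
Hypotheses (pP : gproj p) (z_deg : p M z = z :> B) (M0 : (0 < M)%N).
Variables (n : nat) (x : 'I_n -> B) (H : 'M[EB]_n) (k : 'I_n).
Local Notation X := (diff_col EB x).
Local Notation h := (ehom EB EA tau).
Local Notation zeta := (ediff EB z).
Hypotheses (xgen : generates x) (x_deg : forall i, p 1%N (x i) = x i :> B)
  (H_deg : forall i j, ecomp EB p M.-1%:Z (H i j) = H i j)
  (HX : H *m X = zeta *: delta_mx k 0) (Hsym : mswap H = H)
  (X_exact : forall v : 'rV[EA]_n, v *m map_mx h X = 0 ->
     exists u : 'rV_n, v = u *m map_mx h H)
  (H_exact : forall v : 'rV[EA]_n, v *m map_mx h H = 0 ->
     exists u : 'M_1, v = u *m map_mx h X^T)
  (Xt_inj : forall v : 'M[EA]_1, v *m map_mx h X^T = 0 -> v = 0).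

(* Index [i.+1] holds the term of degree [i]; a zero term sits at index 0. *)
Definition aC (i : nat) : nat :=
  match i with 1 => 1 | 2 => n | 3 => n | 4 => 1 | _ => 0 end%N.

(** Partial sums of the degrees 1, [M - 1], 1 of the three maps. *)
Definition sdeg (i : nat) : int :=
  match i with 2 => 1 | 3 => M%:Z | 4 => M%:Z + 1 | _ => 0 end.

Definition sC (i : nat) : 'rV[int]_(aC i) := const_mx (sdeg i).

Definition dC (i : nat) : 'M[EB]_(aC i.+1, aC i) :=
  match i with 1 => X | 2 => H | 3 => X^T | _ => 0 end.

Definition hC (i : nat) : 'M[EB]_(aC i.+2, aC i) :=
  match i with 1 => delta_mx k 0 | 2 => delta_mx 0 k | _ => 0 end.

Let zetaC : forall u, zeta * u = u * zeta := ediff_central zC.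

Lemma mswap_zeta r s (N : 'M[EB]_(r, s)) : mswap (zeta *: N) = - (zeta *: mswap N).
Proof.
apply/matrixP => i j; rewrite mswapE !mxE eswapM eswap_diff mulrN.
by rewrite zetaC.
Qed.

Lemma mswapD r s (N N' : 'M[EB]_(r, s)) : mswap (N + N') = mswap N + mswap N'.
Proof. exact: raddfD. Qed.

Lemma mswapN r s (N : 'M[EB]_(r, s)) : mswap (- N) = - mswap N.
Proof. exact: raddfN. Qed.

Lemma mswapX : mswap X = - X^T.
Proof. exact: mswap_diff_col. Qed.

Lemma mswapXt : mswap X^T = - X.
Proof. by apply/matrixP => i j; rewrite mswapE !mxE eswap_diff. Qed.

Lemma mswap_delta r s (i : 'I_r) (j : 'I_s) : mswap (delta_mx i j : 'M[EB]_(r, s)) = delta_mx j i.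
Proof.
apply/matrixP => a b; rewrite mswapE !mxE andbC.
by case: (_ && _); [exact: eswap1 | exact: raddf0].
Qed.

Lemma XtH : X^T *m H = zeta *: delta_mx 0 k.
Proof.
have := congr1 mswap HX; rewrite mswapM Hsym mswapX mswap_zeta mswap_delta mulNmx.
exact: oppr_inj.
Qed.

Lemma dC_dC i : dC i.+1 *m dC i = zeta *: hC i.
Proof.
case: i => [|[|[|[|i]]]] /=; rewrite ?mul0mx ?mulmx0 ?scaler0 //.
exact: XtH.
Qed.

Lemma dC_hC i : dC i.+2 *m hC i = hC i.+1 *m dC i.
Proof.
case: i => [|[|[|[|i]]]] /=; rewrite ?mul0mx ?mulmx0 //.
(* Here [i = 1], and both products consist of the single entry [ediff (x k)]. *)
by rewrite -rowE; apply/matrixP => a b; rewrite !ord1 -colE !mxE.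
Qed.

Lemma dC_exact i (v : 'rV[EA]_(aC i.+2)) : v *m map_mx h (dC i.+1) = 0 ->
  exists u : 'rV_(aC i.+3), v = u *m map_mx h (dC i.+2).
Proof.
case: i v => [|[|[|i]]] v.
- exact: X_exact.
- exact: H_exact.
- by move=> /= /Xt_inj ->; exists 0; rewrite mul0mx.
by move=> _; exists 0; rewrite mul0mx; apply: rV0.
Qed.

Lemma sC_ge0 i j : 0 <= sC i 0 j.
Proof. by rewrite mxE; case: i j => [|[|[|[|[|i]]]]]. Qed.

Lemma dC_homog i : mhomog p (sC i.+1) (sC i) (dC i).
Proof.
move=> a b; rewrite !mxE.
case: i a b => [|[|[|[|i]]]] a b; try by rewrite mxE raddf0.
- by rewrite /= subr0 mxE (ecomp_diff EB pP (x_deg a)).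
- by rewrite /= -predn_int.
by rewrite /= addrC addKr !mxE (ecomp_diff EB pP (x_deg b)).
Qed.

Lemma ecomp_nat0 (b : nat) : (b <= 1)%N -> ecomp EB p 0 b%:R = b%:R.
Proof. by case: b => [|[]] // _; [rewrite raddf0 | apply: ecomp1]. Qed.

Lemma hC_homog i : mhomog p (sC i.+2) (sC i + const_mx M%:Z) (hC i).
Proof.
move=> a b; rewrite !mxE.
case: i a b => [|[|[|i]]] a b; try by rewrite mxE raddf0.
- by rewrite /= add0r subrr !mxE ecomp_nat0 ?leq_b1.
by rewrite /= [1 + _]addrC subrr !mxE ecomp_nat0 ?leq_b1.
Qed.

Local Notation R := (coneR aC).
Local Notation Mx := (coneM z dC hC).

Lemma cone_res_exact i (v : 'rV[EB]_(R i.+1)) : v *m Mx i = 0 ->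
  exists u, v = u *m Mx i.+1.
Proof.
exact: (cone_exact tau_surj tau_ker tau_z zC zreg pP z_deg M0
  dC_dC dC_hC dC_exact sC_ge0 dC_homog hC_homog).
Qed.

Lemma row_coneM i r (a : 'M[EB]_(r, aC i.+2)) (b : 'M_(r, aC i.+1)) :
  row_mx a b *m Mx i =
  row_mx (a *m dC i.+1 + zeta *: b) (- (a *m hC i) - b *m dC i).
Proof. by rewrite mul_row_block (mul_mx_central zetaC) !mulmxN. Qed.

Lemma coneM_col i s (a : 'M[EB]_(aC i.+1, s)) (b : 'M_(aC i, s)) :
  Mx i *m col_mx a b =
  col_mx (dC i.+1 *m a - hC i *m b) (zeta *: a - dC i *m b).
Proof. by rewrite mul_block_col mul_scalar_mx !mulNmx. Qed.

Lemma coneM_col0 i (c : 'cV[EB]_(R i)) : Mx i *m c = 0 ->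
  dC i.+1 *m usubmx c = hC i *m dsubmx c /\ zeta *: usubmx c = dC i *m dsubmx c.
Proof.
rewrite -{1}[c]vsubmxK coneM_col -col_mx0 => /eq_col_mx[/eqP + /eqP].
by rewrite !subr_eq0 => /eqP -> /eqP ->.
Qed.

(** Up to signs and an exchange of the two blocks, [mswap] carries columns killed by [Mx i] to rows
    killed by [Mx (3 - i)]. This lemma and the next three thus reduce to [cone_res_exact]. *)
Lemma dual_exact0 (c : 'cV[EB]_(R 0)) : Mx 0 *m c = 0 -> c = 0.
Proof.
move=> /coneM_col0[]; move: (usubmx c) (dsubmx c) (vsubmxK c) => c1 c2 <-.
rewrite (cV0 c2) !mulmx0 => e1 e2.
have [|u eu] := cone_res_exact (i := 3) (v := row_mx 0 (mswap c1)).
  rewrite row_coneM !mul0mx oppr0 !add0r.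
  have -> : zeta *: mswap c1 = 0 by rewrite -[LHS]opprK -mswap_zeta e2 raddf0 oppr0.
  have -> : mswap c1 *m dC 3 = 0.
    by rewrite -[LHS]opprK -mulmxN -[- dC 3]mswapX -mswapM e1 raddf0 oppr0.
  by rewrite oppr0 row_mx0.
move: eu; rewrite -[u]hsubmxK (rV0 (lsubmx u)) (rV0 (rsubmx u)) row_mx0 mul0mx.
rewrite -[RHS]row_mx0 => /eq_row_mx[_] e.
by rewrite -[c1]mswapK e raddf0 col_mx0.
Qed.

Lemma dual_exact1 (c : 'cV[EB]_(R 1)) : Mx 1 *m c = 0 -> exists c', c = Mx 0 *m c'.
Proof.
move=> /coneM_col0[]; move: (usubmx c) (dsubmx c) (vsubmxK c) => c1 c2 <-.
move=> /(congr1 mswap) + /(congr1 mswap).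
rewrite mswap_zeta !mswapM [mswap (dC 2)]Hsym [mswap (hC 1)]mswap_delta.
rewrite [mswap (dC 1)]mswapX mulmxN => e1 /oppr_inj e2.
have [|u] := cone_res_exact (i := 2) (v := row_mx (mswap c2) (- mswap c1)).
  rewrite row_coneM scalerN mulNmx opprK [_ *m dC 2]e1 -[dC 3]/(X^T) -e2.
  by rewrite subrr addNr row_mx0.
rewrite -[u]hsubmxK (rV0 (lsubmx u)) row_coneM !mul0mx oppr0 !add0r.
move: (rsubmx u) => u2 /eq_row_mx[/(congr1 mswap) e3 /oppr_inj/(congr1 mswap) e4].
exists (col_mx (- mswap u2) 0); rewrite coneM_col !mulmx0 !subr0.
move: e3 e4; rewrite mswap_zeta mswapM !mswapK [mswap (dC 3)]mswapXt => -> ->.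
by rewrite mulNmx mulmxN scalerN.
Qed.

Lemma dual_exact2 (c : 'cV[EB]_(R 2)) : Mx 2 *m c = 0 -> exists c', c = Mx 1 *m c'.
Proof.
move=> /coneM_col0[]; move: (usubmx c) (dsubmx c) (vsubmxK c) => c1 c2 <-.
move=> /(congr1 mswap) + /(congr1 mswap).
rewrite mswap_zeta !mswapM [mswap (dC 2)]Hsym [mswap (hC 2)]mswap_delta.
rewrite [mswap (dC 3)]mswapXt mulmxN => e1 e2.
have [|u] := cone_res_exact (i := 1) (v := row_mx (mswap c2) (mswap c1)).
  rewrite row_coneM [_ *m dC 2](esym e2) [_ *m hC 1](esym e1).
  by rewrite opprK subrr addNr row_mx0.
rewrite -[u]hsubmxK row_coneM.
move: (lsubmx u) (rsubmx u) => u1 u2.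
move=> /eq_row_mx[/(congr1 mswap) e3 /(congr1 mswap) e4].
exists (col_mx (- mswap u2) (mswap u1)); rewrite coneM_col.
move: e3 e4; rewrite !mswapD !mswapN mswap_zeta !mswapM !mswapK.
rewrite [mswap (dC 3)]mswapXt [mswap (hC 2)]mswap_delta [mswap (dC 2)]Hsym => -> ->.
rewrite mulNmx scalerN mulmxN; congr col_mx; by rewrite addrC.
Qed.

Lemma dual_exact3 (c : 'cV[EB]_(R 3)) : Mx 3 *m c = 0 -> exists c', c = Mx 2 *m c'.
Proof.
move=> /coneM_col0[_]; move: (usubmx c) (dsubmx c) (vsubmxK c) => c1 c2 <-.
move=> /(congr1 mswap).
rewrite mswap_zeta mswapM [mswap (dC 3)]mswapXt mulmxN => /oppr_inj e2.
have [|u] := cone_res_exact (i := 0) (v := row_mx (mswap c2) (- mswap c1)).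
  rewrite row_coneM scalerN e2 subrr.
  by move: (Y in row_mx _ Y) => y; rewrite (rV0 y) row_mx0.
rewrite -[u]hsubmxK row_coneM.
move: (lsubmx u) (rsubmx u) => u1 u2.
move=> /eq_row_mx[/(congr1 mswap) e3 /(congr1 mswap) e4].
exists (col_mx (- mswap u2) (- mswap u1)); rewrite coneM_col.
move: e3 e4; rewrite !mswapD !mswapN mswap_zeta !mswapM !mswapK.
rewrite [mswap (dC 1)]mswapX [mswap (hC 1)]mswap_delta [mswap (dC 2)]Hsym.
move=> -> /(congr1 -%R); rewrite opprK => ->.
rewrite !mulmxN mulNmx !opprK !scalerN opprD !opprK.
by congr col_mx; rewrite addrC.
Qed.

(** Sends [a (x) b] to [b a]. The image of the last dual map is a right ideal; the swap makes it a
    left ideal, the kernel of multiplication. *)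
Definition top_pairing (c : 'cV[EB]_(R 4)) : B := eact (eswap (dsubmx c 0 0)) 1.

Lemma top_pairing0 (c : 'cV[EB]_(R 4)) :
  top_pairing c = 0 <-> exists c', c = Mx 3 *m c'.
Proof.
rewrite /top_pairing -{2}[c]vsubmxK (cV0 (usubmx c)); move: (dsubmx c) => y.
split=> [/(eact1_ker xgen)[w ew]|[c']].
  exists (col_mx 0 (mswap w)); rewrite coneM_col scaler0 add0r; congr col_mx.
    by rewrite (cV0 (_ - _)).
  rewrite -mulNmx -mswapX -mswapM -ew.
  by apply/matrixP => i j; rewrite !ord1 mswapE mxE mulr1n eswapK.
rewrite -[c']vsubmxK coneM_col => /eq_col_mx[_ ->].
move: (usubmx c') (dsubmx c') => c1 c2.
rewrite -mswapE mswapD mswapN mswap_zeta mswapM [mswap (dC 3)]mswapXt mulmxN opprK.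
have -> (N N' : 'M[EB]_1) : (- N + N') 0 0 = N' 0 0 - N 0 0 by rewrite !mxE addrC.
rewrite eactBl.
have -> : eact ((mswap c2 *m X) 0 0) 1 = 0.
  apply/(eact1_ker xgen); exists (mswap c2).
  by apply/matrixP => i j; rewrite !ord1 [LHS]mxE mulr1n.
by rewrite mxE zetaC eactM eact_diff mulr1 mul1r subrr raddf0 subr0.
Qed.

(** The cone adds [zeta] to the generators [ediff (x i)] of the image; it is itself killed by
    multiplication. *)
Lemma aug_exact (v : 'rV[EB]_(R 0)) :
  eact (v 0 (lshift 0 0)) 1 = 0 <-> exists q, v = q *m Mx 0.
Proof.
split=> [/(eact1_ker xgen)[w ew]|[q ->]].
  exists (row_mx w 0); rewrite row_coneM -[v]hsubmxK scaler0 addr0; congr row_mx.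
    rewrite -[dC 1]/X -ew; apply/matrixP => i j; rewrite !ord1 !mxE mulr1n.
    by congr (v 0 _); apply: val_inj.
  by rewrite (rV0 (rsubmx v)) (rV0 (_ - _)).
rewrite -[q]hsubmxK row_coneM row_mxEl mxE eactDl.
have -> : eact ((lsubmx q *m dC 1) 0 0) 1 = 0.
  apply/(eact1_ker xgen); exists (lsubmx q).
  by apply/matrixP => i j; rewrite !ord1 [LHS]mxE mulr1n.
by rewrite mxE zetaC eactM eact_diff mulr1 mul1r subrr raddf0 addr0.
Qed.

End ConeComplex.

(** * Gradings of quotients *)

Lemma khom_factor (K : fieldType) (T B A : kalgType K) (pi : khom T B) (rho : khom T A) :
    (forall b, exists t, pi t = b) -> (forall t, pi t = 0 -> rho t = 0) ->
  exists tau : khom B A, forall t, tau (pi t) = rho t.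
Proof.
move=> /choice[s sP] ker.
have e t b : pi t = b -> rho (s b) = rho t.
  move=> tb; apply/eqP; rewrite -subr_eq0 -rmorphB; apply/eqP/ker.
  by rewrite rmorphB sP tb subrr.
have gB : zmod_morphism (rho \o s).
  by move=> b c /=; rewrite -rmorphB; apply: e; rewrite rmorphB !sP.
have gM : monoid_morphism (rho \o s).
  split=> [|b c] /=; first by rewrite (e 1) ?rmorph1.
  by rewrite -rmorphM; apply: e; rewrite rmorphM !sP.
pose g : {rmorphism B -> A} := HB.pack (rho \o s)
  (GRing.isZmodMorphism.Build B A _ gB) (GRing.isMonoidMorphism.Build B A _ gM).
have gZ c : g (kscal c) = kscal c by rewrite /= (e (kscal c)) ?khomZ.
by exists (KHom gZ) => t; apply: e.
Qed.

Section QuotientGrading.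
Context {K : fieldType} {T B : kalgType K} (E : envModel T).
Variables (p : nat -> {linear kmod T -> kmod T}) (pi : khom T B).
Hypotheses (pP : gproj p) (pi_surj : forall b, exists t, pi t = b).

Lemma eact_ideal (S : T -> Prop) (u : E) t :
  ideal_gen S t -> ideal_gen S (eact u t).
Proof.
move=> St; have Sg := ideal_genP S.
have SD a b : ideal_gen S a -> ideal_gen S b -> ideal_gen S (a + b).
  move=> Sa Sb; rewrite -[b]opprK -[- b]sub0r; apply: (idealB Sg) => //.
  by apply: (idealB Sg) => //; apply: (ideal0 Sg).
elim/et_ind: u => [|u v hu hv|a b]; first by rewrite eact0l; apply: (ideal0 Sg).
  by rewrite eactDl; apply: SD.
by rewrite eactE; apply: (idealM Sg).
Qed.

Lemma ideal_homog (S : T -> Prop) : (forall s, S s -> exists d, p d s = s :> T) ->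
  forall t, ideal_gen S t -> forall i, ideal_gen S (p i t).
Proof.
move=> Sh t; have Sg := ideal_genP S.
have SD a b : ideal_gen S a -> ideal_gen S b -> ideal_gen S (a + b).
  move=> Sa Sb; rewrite -[b]opprK -[- b]sub0r; apply: (idealB Sg) => //.
  by apply: (idealB Sg) => //; apply: (ideal0 Sg).
move=> /(_ (fun t => forall i, ideal_gen S (p i t))); apply.
  split=> [i|a b Ja Jb i|a c b Jc i].
  - by rewrite klin0; apply: (ideal0 Sg).
  - by rewrite klinB; apply: (idealB Sg).
  - have [N cN] := gproj_fin pP c.
    rewrite -(eactE E) cN raddf_sum klin_sum.
    apply: big_ind => [||j _]; [exact: (ideal0 Sg)|exact: SD|].
    rewrite /= (gproj_eact pP _ _ (gproj_idem pP j c)).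
    exact: eact_ideal.
move=> s Ss i; have [d ds] := Sh s Ss; rewrite (gprojE pP i ds).
by case: ifP => _; [apply: ideal_gen_sub | apply: (ideal0 Sg)].
Qed.

Lemma ideal_pos (S : T -> Prop) : (forall s, S s -> p 0%N s = 0 :> T) ->
  forall t, ideal_gen S t -> p 0%N t = 0 :> T.
Proof.
move=> S0 t /(_ (fun t => p 0%N t = 0 :> T)); apply=> //.
split=> [|a b pa pb|a c b pc]; first by rewrite klin0.
  by rewrite klinB pa pb subrr.
have [N cN] := gproj_fin pP c.
rewrite -(eactE E) cN raddf_sum klin_sum big1 // => -[[|j] jN] _ /=.
  by rewrite pc raddf0 klin0.
rewrite (gproj_eact pP _ _ (gproj_idem pP j.+1 c)) ecomp_neg ?eact0l //.
Qed.

Hypothesis pi_p : forall t, pi t = 0 -> forall i, pi (p i t) = 0.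

Lemma quotient_gproj : exists q : nat -> {linear kmod B -> kmod B},
  (forall i t, pi (p i t) = q i (pi t)) /\ gproj q.
Proof.
have /choice[s sP] := pi_surj.
have e i t b : pi t = b -> pi (p i (s b)) = pi (p i t).
  move=> tb; apply/eqP; rewrite -subr_eq0 -rmorphB -klinB; apply/eqP/pi_p.
  by rewrite rmorphB sP tb subrr.
have qlin i : linear ((fun b => pi (p i (s b))) : kmod B -> kmod B).
  apply: kmod_linear => [a b|c b]; first by rewrite -rmorphB -klinB; apply: e; rewrite rmorphB !sP.
  rewrite kmodZE -(khomZ pi) -rmorphM -klinZ; apply: e.
  by rewrite rmorphM khomZ sP.
pose q i : {linear kmod B -> kmod B} := HB.pack (_ : kmod B -> kmod B)
  (GRing.isLinear.Build K (kmod B) (kmod B) *:%R _ (qlin i)).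
have qE i t : q i (pi t) = pi (p i t) by apply: e.
exists q; split=> [i t|]; first by rewrite qE.
split=> [i j b|b||i j a b].
- have [t <-] := pi_surj b; rewrite !qE (gproj_proj pP).
  by case: ifP; rewrite ?raddf0 ?qE.
- have [t <-] := pi_surj b; have [N tN] := gproj_fin pP t.
  exists N; rewrite {1}tN raddf_sum; apply: eq_bigr => i _.
  by rewrite qE.
- by rewrite -(rmorph1 pi) qE (gproj_1 pP).
- have [t <-] := pi_surj a; have [t' <-] := pi_surj b.
  rewrite !qE => <- <-; rewrite -rmorphM qE.
  by congr (pi _); apply: (gproj_M pP); apply: gproj_idem.
Qed.

Lemma quotient_degP (q : nat -> {linear kmod B -> kmod B}) :
    (forall i t, pi (p i t) = q i (pi t)) ->
  forall d b, (exists2 t, p d t = t :> T & b = pi t) <-> q d b = b :> B.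
Proof.
move=> pq d b; split=> [[t pt ->]|qb]; first by rewrite -pq pt.
have [t tb] := pi_surj b; exists (p d t); first exact: gproj_idem.
by rewrite pq tb qb.
Qed.

End QuotientGrading.

Lemma gproj_grading (K : fieldType) (B : kalgType K) (q : nat -> {linear kmod B -> kmod B})
    (gr : nat -> B -> Prop) : gproj q -> (forall d b, gr d b <-> q d b = b :> B) ->
  is_grading gr.
Proof.
move=> qP grq; split=> [i|i a b|a|s c us gc s0 i is_].
- by apply/grq; rewrite klin0.
- by move=> /grq qa /grq qb; apply/grq; rewrite klinB qa qb.
- have [N aN] := gproj_fin qP a; exists (iota 0 N), (fun i => q i a); split.
    by move=> i; apply/grq; apply: gproj_idem.
  by rewrite {1}aN -[N in iota 0 N]subn0 -/(index_iota 0 N) big_mkord.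
have: q i (\sum_(j <- s) c j) = 0 :> B by rewrite s0 klin0.
rewrite klin_sum (bigD1_seq i) //= big1 ?addr0; first by move/grq: (gc i) => ->.
by move=> j ji; move/grq: (gc j) => /(gprojE qP i) ->; rewrite eq_sym (negPf ji).
Qed.

Lemma rcomp_grading (K : fieldType) (B : kalgType K) (EB : envModel B)
    (q : nat -> {linear kmod B -> kmod B}) (qP : gproj q) r (sh : 'rV[int]_r) :
  is_grading (fun (l : int) (v : 'rV[EB]_r) => rcomp q sh l v = v).
Proof.
split=> [l|l a b la lb|v|s c us gc s0 i is_].
- exact: raddf0.
- by rewrite raddfB /= la lb.
- have [s sP] := rcomp_supp qP sh v; exists (undup s), (fun l => rcomp q sh l v).
  split=> [l|]; first exact: rcomp_idem.
  by apply: sP (undup_uniq s) _ => l; rewrite mem_undup.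
have: rcomp q sh i (\sum_(j <- s) c j) = 0 by rewrite s0 raddf0.
rewrite raddf_sum (bigD1_seq i) //= big1 ?addr0 ?gc // => j ji.
by rewrite -gc rcomp_comp // eq_sym (negPf ji).
Qed.

Lemma bijectivePn (T U : Type) (g : T -> U) : injective g -> (forall y, exists x, g x = y) ->
  bijective g.
Proof.
move=> ginj /choice[s sP]; exists s => [x|//].
by apply: ginj; rewrite sP.
Qed.

(** * The resolution of the extension *)

Section FreeModules.
Variable R : pzRingType.

Lemma rV_projective r : projective 'rV[R]_r.
Proof.
move=> M N g f gsurj.
have [y yP] := choice (fun j : 'I_r => gsurj (f (delta_mx 0 j))).
have hlin : linear (fun v : 'rV[R]_r => \sum_j v 0 j *: y j).
  move=> a u v; rewrite scaler_sumr -big_split; apply: eq_bigr => j _ /=.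
  by rewrite !mxE scalerDl scalerA.
exists (HB.pack_for {linear 'rV[R]_r -> M} (fun v : 'rV[R]_r => \sum_j v 0 j *: y j)
  (GRing.isLinear.Build R _ M *:%R _ hlin)) => v /=.
rewrite linear_sum [in RHS](row_sum_delta v) linear_sum; apply: eq_bigr => j _.
by rewrite !linearZ yP.
Qed.

Lemma rV_finitely_generated r : finitely_generated 'rV[R]_r.
Proof.
by exists r, (delta_mx 0) => v; exists (fun j => v 0 j); apply: row_sum_delta.
Qed.

Lemma linear_form_col r (f : 'rV[R]_r -> R) : linear_for *%R f ->
  forall v, f v = (v *m \col_j f (delta_mx 0 j)) 0 0.
Proof.
move=> fL; have f0 : f 0 = 0.
  by have := fL (-1) 0 0; rewrite scaler0 addr0 mulN1r addNr.
have fZ a v : f (a *: v) = a * f v by have := fL a v 0; rewrite !addr0 f0 addr0.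
have fD u v : f (u + v) = f u + f v by have := fL 1 u v; rewrite scale1r mul1r.
move=> v; rewrite {1}[v]row_sum_delta (big_morph f fD f0) mxE.
by apply: eq_bigr => j _; rewrite fZ mxE.
Qed.

Lemma col_linear_form r (c : 'cV[R]_r) : linear_for *%R (fun v : 'rV[R]_r => (v *m c) 0 0).
Proof. by move=> a u v; rewrite mulmxDl -scalemxAl !mxE. Qed.

Lemma row_forms_eq r (c c' : 'cV[R]_r) :
  (forall v : 'rV_r, (v *m c) 0 0 = (v *m c') 0 0) -> c = c'.
Proof.
by move=> cc; apply/colP => i; have := cc (delta_mx 0 i); rewrite -!rowE !mxE.
Qed.

End FreeModules.

Section Degrees.
Context {K : fieldType} {B : kalgType K} (EB : envModel B).
Variables (q : nat -> {linear kmod B -> kmod B}) (gr : nat -> B -> Prop).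
Hypotheses (qP : gproj q) (grq : forall d b, gr d b <-> q d b = b :> B).

(** This is [env_deg] over an arbitrary model; for [env_model B] the two are convertible. *)
Definition et_deg (l : int) (u : EB) : Prop :=
  exists (r : nat) (i j : 'I_r -> nat) (a b : 'I_r -> B),
    (forall t, [/\ gr (i t) (a t), gr (j t) (b t) & (i t + j t)%N%:Z = l])
    /\ u = \sum_t et EB (a t) (b t).

Lemma et_degP l u : et_deg l u <-> ecomp EB q l u = u.
Proof.
split=> [[r [i [j [a [b [abP ->]]]]]]|<-].
  rewrite raddf_sum; apply: eq_bigr => t _ /=.
  have [/grq pa /grq pb ij] := abP t.
  by rewrite (ecompE EB qP l pa pb) ij eqxx.
have d0 : et_deg l 0.
  exists 0%N, (fun=> 0%N), (fun=> 0%N), (fun=> 0), (fun=> 0).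
  by split; [case | rewrite big_ord0].
elim/(@et_hind _ _ EB _ qP): u => [|u v|i j a b pa pb]; first by rewrite raddf0.
  rewrite raddfD /=.
  move=> [r [i [j [a [b [abP ->]]]]]] [r' [i' [j' [a' [b' [abP' ->]]]]]].
  pose mix (X : Type) (g : 'I_r -> X) (g' : 'I_r' -> X) (t : 'I_(r + r')) :=
    match split t with inl s => g s | inr s => g' s end.
  exists (r + r')%N, (mix _ i i'), (mix _ j j'), (mix _ a a'), (mix _ b b').
  split=> [t|]; first by rewrite /mix; case: (split t).
  rewrite big_split_ord; congr (_ + _); apply: eq_bigr => t _; rewrite /mix.
    by rewrite -[lshift _ _]/(unsplit (inl t)) unsplitK.
  by rewrite -[rshift _ _]/(unsplit (inr t)) unsplitK.
rewrite (ecompE EB qP l pa pb); case: eqP => [->|//].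
exists 1%N, (fun=> i), (fun=> j), (fun=> a), (fun=> b); rewrite big_ord1.
by split=> // t; split=> //; apply/grq.
Qed.

Lemma grZ_eact1 l u : ecomp EB q l u = u -> grZ gr l (eact u 1).
Proof.
case: l => [d|d] /=; last by move<-; rewrite ecomp_neg // eact0l.
move=> du; apply/grq; rewrite (gproj_eact qP _ _ (gproj_1 qP)) subr0.
by rewrite du.
Qed.

End Degrees.

Section ConeResolution.
Context {K : fieldType} {A B : kalgType K} (EA : envModel A) (EB : envModel B).
Variables (tau : khom B A) (z : B) (M : nat) (p : nat -> {linear kmod B -> kmod B}).
Hypotheses (tau_surj : forall a, exists b, tau b = a)
  (tau_ker : forall b, tau b = 0 -> exists c, b = z * c)
  (tau_z : tau z = 0) (zC : forall b, z * b = b * z) (zreg : forall b, z * b = 0 -> b = 0).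
Hypotheses (pP : gproj p) (z_deg : p M z = z :> B) (M0 : (0 < M)%N).
Variables (n : nat) (x : 'I_n -> B) (H : 'M[EB]_n) (k : 'I_n).
Local Notation X := (diff_col EB x).
Local Notation h := (ehom EB EA tau).
Local Notation zeta := (ediff EB z).
Hypotheses (xgen : generates x) (x_deg : forall i, p 1%N (x i) = x i :> B)
  (H_deg : forall i j, ecomp EB p M.-1%:Z (H i j) = H i j)
  (HX : H *m X = zeta *: delta_mx k 0) (Hsym : mswap H = H)
  (X_exact : forall v : 'rV[EA]_n, v *m map_mx h X = 0 ->
     exists u : 'rV_n, v = u *m map_mx h H)
  (H_exact : forall v : 'rV[EA]_n, v *m map_mx h H = 0 ->
     exists u : 'M_1, v = u *m map_mx h X^T)
  (Xt_inj : forall v : 'M[EA]_1, v *m map_mx h X^T = 0 -> v = 0).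
Variable gr : nat -> B -> Prop.
Hypothesis grp : forall d b, gr d b <-> p d b = b :> B.

Local Notation R := (coneR (aC n)).
Local Notation Sh := (coneS M (sC M n)).
Local Notation Mx := (coneM z (dC x H) (hC EB k)).

Lemma res_mx_exact i (v : 'rV[EB]_(R i.+1)) : v *m Mx i = 0 <-> exists u, v = u *m Mx i.+1.
Proof.
split; last first.
  by move=> [u ->]; rewrite -mulmxA (coneMM zC (dC_dC zC HX Hsym) (dC_hC x H k)) mulmx0.
exact: (cone_res_exact tau_surj tau_ker tau_z zC zreg pP z_deg M0 x_deg H_deg
  HX Hsym X_exact H_exact Xt_inj).
Qed.

Lemma res_mx_homog i : mhomog p (Sh i.+1) (Sh i) (Mx i).
Proof.
exact: (coneM_homog pP z_deg (dC_homog pP M0 x_deg H_deg) (hC_homog EB M pP k)).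
Qed.

Definition aug (v : 'rV[EB]_(R 0)) : B := eact (v 0 (lshift 0 0)) 1.

Fact aug_zmod : zmod_morphism aug.
Proof. by move=> u v; rewrite /aug !mxE eactBl. Qed.
HB.instance Definition _ := GRing.isZmodMorphism.Build 'rV[EB]_(R 0) B aug aug_zmod.

Lemma res_deg_scale i j l (u : EB) (v : 'rV[EB]_(R i)) :
  et_deg gr j u -> rcomp p (Sh i) l v = v -> rcomp p (Sh i) (j + l) (u *: v) = u *: v.
Proof.
move=> /(et_degP pP grp) uj /rowP vl; apply/rowP => s; have := vl s; rewrite mxE => vs.
rewrite [LHS]mxE [(u *: v) 0 s]mxE (ecompM pP _ _ vs) opprB.
by rewrite addrA subrK addrK uj.
Qed.

Lemma res_mx_deg i l (v : 'rV[EB]_(R i.+1)) :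
  rcomp p (Sh i.+1) l v = v -> rcomp p (Sh i) l (v *m Mx i) = v *m Mx i.
Proof. by move=> vl; rewrite (rcomp_mul pP _ _ (@res_mx_homog i)) vl. Qed.

Lemma aug_deg l v : rcomp p (Sh 0) l v = v -> grZ gr l (aug v).
Proof.
move=> /rowP/(_ (lshift 0 0)); rewrite mxE /coneS row_mxEl [const_mx _ _ _]mxE subr0 => vl.
exact: (grZ_eact1 pP grp).
Qed.

Lemma aug_lin a b v : aug (et EB a b *: v) = a * aug v * b.
Proof. by rewrite /aug mxE eactM eactE. Qed.

Lemma aug_surj a : exists v, aug v = a.
Proof. by exists (const_mx (et EB a 1)); rewrite /aug mxE eactE !mulr1. Qed.

Lemma aug_kernel v : aug v = 0 <-> exists q, v = q *m Mx 0.
Proof. exact: (aug_exact zC H k xgen). Qed.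

Lemma res_vanish : exists N, forall i, (N < i)%N -> forall v : 'rV[EB]_(R i), v = 0.
Proof. by exists 4%N => -[|[|[|[|[|i]]]]] // _ v; exact: rV0. Qed.

(** The dependent match mirrors [coboundary], so that the statement converts to [ext_vanishes] once
    the resolution is built. *)
Lemma cone_ext_vanishes i (f : 'rV[EB]_(R i) -> EB) : i != 4%N ->
    linear_for *%R f -> (forall v, f (v *m Mx i) = 0) ->
  match i return ('rV[EB]_(R i) -> EB) -> Prop with
  | 0 => fun f => forall v, f v = 0
  | j.+1 => fun f => exists2 g : 'rV[EB]_(R j) -> EB,
      linear_for *%R g & forall v, f v = g (v *m Mx j)
  end f.
Proof.
move=> i4 fL fM; pose c := \col_j f (delta_mx 0 j); have fc := linear_form_col fL.
have Mc : Mx i *m c = 0.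
  by apply: row_forms_eq => v; rewrite mulmxA -fc fM mulmx0 mxE.
have cob j (c' : 'cV[EB]_(R j)) (g : 'rV[EB]_(R j.+1) -> EB) (gc : 'cV[EB]_(R j.+1)) :
    (forall v, g v = (v *m gc) 0 0) -> gc = Mx j *m c' ->
    exists2 g' : 'rV[EB]_(R j) -> EB, linear_for *%R g' & forall v, g v = g' (v *m Mx j).
  move=> gv egc; exists (fun v => (v *m c') 0 0); first exact: col_linear_form.
  by move=> v; rewrite gv egc mulmxA.
case: i i4 f fL fM @c fc Mc => [|[|[|[|[|i]]]]] // _ f fL fM c fc Mc.
- have c0 := dual_exact0 tau_surj tau_ker tau_z zC zreg pP z_deg M0 x_deg H_deg
    HX Hsym X_exact H_exact Xt_inj Mc.
  by move=> v; rewrite fc -/c c0 mulmx0 mxE.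
- have [c' ec] := dual_exact1 tau_surj tau_ker tau_z zC zreg pP z_deg M0 x_deg H_deg
    HX Hsym X_exact H_exact Xt_inj Mc.
  exact: cob fc ec.
- have [c' ec] := dual_exact2 tau_surj tau_ker tau_z zC zreg pP z_deg M0 x_deg H_deg
    HX Hsym X_exact H_exact Xt_inj Mc.
  exact: cob fc ec.
- have [c' ec] := dual_exact3 tau_surj tau_ker tau_z zC zreg pP z_deg M0 x_deg H_deg
    HX Hsym X_exact H_exact Xt_inj Mc.
  exact: cob fc ec.
(* Past index 4 the modules are zero, so the column [c] is 0. *)
apply: (cob _ 0 _ c fc); rewrite mulmx0; exact: cV0.
Qed.

Definition top_vec : 'rV[EB]_(R 4) := delta_mx 0 (rshift 0 0).
Definition top_phi (f : 'rV[EB]_(R 4) -> EB) : B := eact (eswap (f top_vec)) 1.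

Lemma top_phiD f g : top_phi (f \+ g) = top_phi f + top_phi g.
Proof. by rewrite /top_phi /= raddfD /= eactDl. Qed.

Lemma top_phi0 f : linear_for *%R f ->
  top_phi f = 0 <-> exists2 g : 'rV[EB]_(R 3) -> EB,
    linear_for *%R g & forall v, f v = g (v *m Mx 3).
Proof.
move=> fL; have fc := linear_form_col fL.
have -> : top_phi f = top_pairing (\col_j f (delta_mx 0 j)).
  by rewrite /top_pairing /dsubmx !mxE.
split=> [/(top_pairing0 zC H k xgen)[c' ec]|[g gL gM]].
  exists (fun v => (v *m c') 0 0); first exact: col_linear_form.
  by move=> v; rewrite fc ec mulmxA.
apply/(top_pairing0 zC H k xgen); exists (\col_j g (delta_mx 0 j)).
by apply: row_forms_eq => v; rewrite -fc gM (linear_form_col gL) mulmxA.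
Qed.

Lemma top_phi_surj a : exists2 f, linear_for *%R f /\ (forall v, f (v *m Mx 4) = 0) &
  top_phi f = a.
Proof.
exists (fun v => (v *m (const_mx (et EB 1 a) : 'cV_(R 4))) 0 0); last first.
  by rewrite /top_phi /top_vec -rowE !mxE eswapE eactE !mulr1.
split; first exact: col_linear_form.
by move=> v; rewrite (rV0 (v : 'rV_0)) !mul0mx mxE.
Qed.

(** The swap turns right multiplication by [a (x) b] into left multiplication by [b (x) a]; no twist
    appears, so the Nakayama automorphism is the identity. *)
Lemma top_phiM f a b : top_phi (fun v => f v * et EB a b) = b * top_phi f * a.
Proof. by rewrite /top_phi eswapM eswapE eactM eactE. Qed.

(** The top generator has degree [M + 1] in the Hessian complex and another [M] from the cone. *)
Lemma top_phi_deg j f : (forall l v, rcomp p (Sh 4) l v = v -> et_deg gr (j + l) (f v)) ->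
  grZ gr (M%:Z + 1 + M%:Z + j) (top_phi f).
Proof.
move=> fdeg; apply: (grZ_eact1 pP grp); rewrite (ecomp_swap pP); congr eswap.
apply/(et_degP pP grp); rewrite addrC; apply: fdeg.
apply/rowP => s; rewrite mxE /top_vec /coneS.
case: (split_ordP s) => {}s ->; first by case: s.
rewrite row_mxEr !mxE ord1 !eqxx /= subrr; exact: ecomp1.
Qed.

End ConeResolution.

Section ConeCalabiYau.
Context {K : fieldType} {A B : kalgType K} (EA : envModel A).
Local Notation EB := (env_model B).
Variables (tau : khom B A) (z : B) (M : nat) (p : nat -> {linear kmod B -> kmod B}).
Hypotheses (tau_surj : forall a, exists b, tau b = a)
  (tau_ker : forall b, tau b = 0 -> exists c, b = z * c)
  (tau_z : tau z = 0) (zC : forall b, z * b = b * z) (zreg : forall b, z * b = 0 -> b = 0).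
Hypotheses (pP : gproj p) (z_deg : p M z = z :> B) (M0 : (0 < M)%N).
Variables (n : nat) (x : 'I_n -> B) (H : 'M[EB]_n) (k : 'I_n).
Local Notation X := (diff_col EB x).
Local Notation h := (ehom EB EA tau).
Local Notation zeta := (ediff EB z).
Hypotheses (xgen : generates x) (x_deg : forall i, p 1%N (x i) = x i :> B)
  (H_deg : forall i j, ecomp EB p M.-1%:Z (H i j) = H i j)
  (HX : H *m X = zeta *: delta_mx k 0) (Hsym : mswap H = H)
  (X_exact : forall v : 'rV[EA]_n, v *m map_mx h X = 0 ->
     exists u : 'rV_n, v = u *m map_mx h H)
  (H_exact : forall v : 'rV[EA]_n, v *m map_mx h H = 0 ->
     exists u : 'M_1, v = u *m map_mx h X^T)
  (Xt_inj : forall v : 'M[EA]_1, v *m map_mx h X^T = 0 -> v = 0).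
Variable gr : nat -> B -> Prop.
Hypothesis grp : forall d b, gr d b <-> p d b = b :> B.

Local Notation R := (coneR (aC n)).
Local Notation Sh := (coneS M (sC M n)).
Local Notation Mx := (coneM z (dC x H) (hC EB k)).

(** Transparent, because [cone_resolution_ext] computes with its modules and maps. *)
Definition cone_resolution : fg_proj_resolution gr.
Proof.
refine (@Build_fg_proj_resolution K B gr
  (fun i => 'rV[EB]_(R i) : lmodType (env_alg B))
  (fun i l (v : 'rV[EB]_(R i)) => rcomp p (Sh i) l v = v)
  (fun i => (mulmxr (Mx i) : {linear 'rV[EB]_(R i.+1) -> 'rV[EB]_(R i)}))
  (@aug K B EB n : {additive 'rV[EB]_(R 0) -> B}) _ _ _ _ _ _ _ _ _ _ _).
- exact (fun i => @rcomp_grading K B EB p pP (R i) (Sh i)).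
- exact (@res_deg_scale K B EB M p pP n gr grp).
- exact (fun i => @rV_finitely_generated EB (R i)).
- exact (fun i => @rV_projective EB (R i)).
- exact (@res_vanish K B EB n).
- exact (@res_mx_deg K B EB z M p pP z_deg M0 n x H k x_deg H_deg).
- exact (@aug_deg K B EB M p pP n gr grp).
- exact (@aug_lin K B EB n).
- exact (@aug_surj K B EB n).
- exact (@aug_kernel K B EB z zC n x H k xgen).
- exact (res_mx_exact tau_surj tau_ker tau_z zC zreg pP z_deg M0 x_deg H_deg
    HX Hsym X_exact H_exact Xt_inj).
Defined.

Lemma cone_resolution_ext :
  (forall i, i != 4%N -> ext_vanishes cone_resolution i) /\
  ext_is_twisted cone_resolution 4 idfun (M%:Z + 1 + M%:Z).
Proof.
split.
  move=> i i4 f [fL fM].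
  exact (@cone_ext_vanishes K A B EA EB tau z M p tau_surj tau_ker tau_z zC zreg pP z_deg
    M0 n x H k x_deg H_deg HX Hsym X_exact H_exact Xt_inj i f i4 fL fM).
exists (@top_phi K B EB n); split.
- move=> f g _ _; exact (@top_phiD K B EB n f g).
- move=> f [fL _]; exact (@top_phi0 K B EB z zC n x H k xgen f fL).
- exact (@top_phi_surj K B EB z n x H k).
- move=> f a b _; exact (@top_phiM K B EB n f a b).
- move=> j f _; exact (@top_phi_deg K B EB M p pP n gr grp j f).
Qed.

End ConeCalabiYau.

Arguments cone_resolution_ext {K A B EA tau z M p}.

(** * The central extension *)

Section FinalData.
Context {K : fieldType} {n : nat}.
Local Notation T := (tensor_alg K n).

Lemma tensor_free_data (E : envModel T) :
  free_data (E := E) (@tX K n) (fun d => wproj d : {linear kmod T -> kmod T})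
    (fun i => wderiv i : {linear kmod T -> kmod T})
    (fun j => wuder E j : {linear kmod T -> kmod E}).
Proof.
split.
- exact: wproj_gproj.
- exact: tensor_generates.
- exact: wproj1_tX.
- exact: wproj0_scal.
- exact: wderivX.
- exact: wderiv_euler.
- exact: wproj_deriv.
- exact: wuder1.
- exact: wuderX.
Qed.

Lemma tensor_potential (E : envModel T) (m : nat) (w : T) : superpotential m.+2 w ->
  potential (E := E) m.+1 (@tX K n) (fun d => wproj d : {linear kmod T -> kmod T})
    (fun j => wuder E j : {linear kmod T -> kmod E}) (fun i => pderiv i w).
Proof.
move=> [wdeg wrot].
have wp : wproj m.+2 w = w :> T by apply/wproj_deg.
have fdeg i : tens_deg m.+1 (pderiv i w).
  by apply/wproj_deg; rewrite pderivE wproj_deriv wp.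
split=> [i||i j|i j].
- by apply/wproj_deg.
- have w0 : wproj 0 w = 0 :> T := gprojE wproj_gproj 0 wp.
  have left_euler := wderiv_euler w; rewrite w0 add0r in left_euler.
  have right_euler := etrans (wderiv_rot wdeg) (wrot_rotation wrot).
  have e : (fun i => pderiv i w) = (fun i => wderiv i w : T).
    by apply/funext => i; exact: pderivE.
  pose euler (g : 'I_n -> T) := \sum_i tX i * g i = \sum_i g i * tX i.
  exact: (eq_ind_r euler (etrans (esym left_euler) (esym right_euler)) e).
- by rewrite !pderivE; apply: wuder_sym wdeg wrot.
- exact: wuder_deg.
Qed.

End FinalData.

Section QuotKhom.
Context {K : fieldType} {A : kalgType K} (S : A -> Prop).

Fact quot_pi_kscal c : quot_pi S (kscal c) = kscal c.
Proof. by []. Qed.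

Definition quot_khom : khom A (quot_alg S) :=
  @KHom K A (quot_alg S) (quot_pi S) quot_pi_kscal.

Lemma quot_khom_surj a : exists t, quot_khom t = a.
Proof. by exists (quot_repr a); exact: quot_reprK. Qed.

Lemma quot_khom_ker t : quot_khom t = 0 <-> ideal_gen S t.
Proof.
rewrite -[X in _ = X](rmorph0 quot_khom); split=> [/quot_eqP|St]; first by rewrite subr0.
by apply/quot_eqP; rewrite subr0.
Qed.

End QuotKhom.

Lemma ehom_ehom (K : fieldType) (T B A : kalgType K) (E : envModel T) (EB : envModel B)
    (EA : envModel A) (pi : khom T B) (tau : khom B A) (rho : khom T A) :
  (forall t, tau (pi t) = rho t) ->
  forall u, ehom EB EA tau (ehom E EB pi u) = ehom E EA rho u.
Proof.
move=> tp; apply: (et_eq (f := fun u => ehom EB EA tau (ehom E EB pi u))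
  (g := fun u => ehom E EA rho u)) => [u v|u v|a b].
- by rewrite !raddfB.
- exact: raddfB.
- by rewrite !ehomE !tp.
Qed.

Section CentralExtension.
Context {K : fieldType} {T A B : kalgType K} (E : envModel T) (EA : envModel A).
Variables (n m : nat) (x : 'I_n -> T) (p : nat -> {linear kmod T -> kmod T}).
Variables (d : 'I_n -> {linear kmod T -> kmod T}) (D : 'I_n -> {linear kmod T -> kmod E}).
Hypothesis F : free_data x p d D.
Variable f : 'I_n -> T.
Hypothesis W : potential m.+1 x p D f.
Variables (rho : khom T A) (pi : khom T B) (k : 'I_n).
Hypotheses (rho_surj : forall a, exists t, rho t = a)
  (rho_kernel : forall t, rho t = 0 <-> ideal_gen (fun r => exists i, r = f i) t)
  (pi_surj : forall b, exists t, pi t = b)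
  (pi_kernel : forall t, pi t = 0 <-> ideal_gen (fun r => exists2 i, i != k &
    r = f i \/ r = x i * f k - f k * x i) t).

Let pP := fd_proj F.
Local Notation y := (rho \o x).
Local Notation Omega := (pi (f k)).

Lemma rho_f i : rho (f i) = 0.
Proof. by apply/rho_kernel; apply: ideal_gen_sub; exists i. Qed.

Lemma pi_f i : i != k -> pi (f i) = 0.
Proof. by move=> ik; apply/pi_kernel; apply: ideal_gen_sub; exists i => //; left. Qed.

Lemma rho_ker a : rho a = 0 -> exists t : 'I_n -> E, a = \sum_i eact (t i) (f i).
Proof.
move=> /rho_kernel/(_ (fun a => exists t : 'I_n -> E, a = \sum_i eact (t i) (f i))).
apply; first split.
- by exists (fun=> 0); rewrite big1 // => i _; exact: eact0l.
- move=> b c [t ->] [t' ->]; exists (fun i => t i - t' i).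
  by rewrite -sumrB; apply: eq_bigr => i _; rewrite eactBl.
- move=> b a' c [t ->]; exists (fun i => et E b c * t i).
  rewrite mulr_sumr mulr_suml; apply: eq_bigr => i _.
  by rewrite eactM eactE.
move=> r [i ->]; exists (fun j => (j == i)%:R).
rewrite (bigD1 i) //= eqxx eact1 big1 ?addr0 // => j /negPf ->.
exact: eact0l.
Qed.

Lemma rho_grading : exists q : nat -> {linear kmod A -> kmod A},
  (forall i t, rho (p i t) = q i (rho t)) /\ gproj q.
Proof.
apply: (quotient_gproj pP rho_surj) => t /rho_kernel rt i; apply/rho_kernel.
apply: (ideal_homog E pP) => // _ [j ->]; exists m.+1; exact: pt_deg W j.
Qed.

Lemma ext_rel_homog r : (exists2 i, i != k & r = f i \/ r = x i * f k - f k * x i) ->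
  exists2 j, (0 < j)%N & p j r = r :> T.
Proof.
move=> [i ik [->|->]]; first by exists m.+1; rewrite ?(pt_deg W).
exists (1 + m.+1)%N => //; rewrite klinB (gproj_M pP (fd_x F i) (pt_deg W k)).
by rewrite addnC (gproj_M pP (pt_deg W k) (fd_x F i)).
Qed.

Lemma pi_grading : exists q : nat -> {linear kmod B -> kmod B},
  (forall i t, pi (p i t) = q i (pi t)) /\ gproj q.
Proof.
apply: (quotient_gproj pP pi_surj) => t /pi_kernel pt i; apply/pi_kernel.
by apply: (ideal_homog E pP) => // r /ext_rel_homog[j _ pr]; exists j.
Qed.

Lemma pi_ker0 t : pi t = 0 -> p 0%N t = 0 :> T.
Proof.
move/pi_kernel; apply: (ideal_pos E pP) => r /ext_rel_homog[[//|j] _ pr].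
exact: (gprojE pP 0 pr).
Qed.

(** Commutation with [x_k] is not among the relations: it follows from [sum x_i f_i = sum f_i x_i],
    of which only the terms at [k] survive in [B]. *)
Lemma Omega_central b : Omega * b = b * Omega.
Proof.
move: b; apply: (rho_gen F pi_surj) => [c|i b bc|b c bc cc] /=.
- by rewrite kscalC.
- have xc : pi (x i) * Omega = Omega * pi (x i).
    have [->|ik] := eqVneq i k.
      have := congr1 pi (pt_euler W); rewrite !raddf_sum (bigD1 k) //=.
      rewrite [in RHS](bigD1 k) //= !rmorphM /= [X in _ + X]big1; last first.
        by move=> j jk; rewrite rmorphM pi_f // mulr0.
      rewrite [X in _ = _ + X]big1 ?addr0 // => j jk.
      by rewrite rmorphM pi_f // mul0r.
    apply/eqP; rewrite -subr_eq0 -!rmorphM -rmorphB; apply/eqP/pi_kernel.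
    by apply: ideal_gen_sub; exists i => //; right.
  by rewrite mulrA -xc -mulrA bc mulrA.
- by rewrite mulrDr bc cc mulrDl.
Qed.

Hypotheses (hext0 : forall c : EA, (forall i, ediff EA (y i) * c = 0) -> c = 0)
  (hext1 : forall c : 'cV[EA]_n, qhess EA D f rho *m c = 0 ->
     exists b : 'M_1, c = diff_col EA y *m b).

(** Ext gives exactness on columns; symmetry of the Hessian under [mswap] moves it to rows. *)
Lemma qhess_exact (v : 'rV[EA]_n) : v *m qhess EA D f rho = 0 ->
  exists b : 'M_1, v = b *m (diff_col EA y)^T.
Proof.
move=> /(congr1 mswap); rewrite mswapM (mswap_qhess EA W) raddf0 => /hext1[b eb].
exists (- mswap b); rewrite -[v]mswapK eb mswapM mswap_diff_col.
by rewrite mulmxN mulNmx.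
Qed.

Lemma diff_row_inj (v : 'M[EA]_1) : v *m (diff_col EA y)^T = 0 -> v = 0.
Proof.
move=> v0; apply/matrixP => i j; rewrite !ord1 [RHS]mxE -[LHS]eswapK.
rewrite [eswap (v 0 0)]hext0 ?raddf0 // => l.
rewrite -[LHS]eswapK eswapM eswapK eswap_diff mulrN.
by move/rowP/(_ l): v0; rewrite !mxE big_ord1 !mxE => ->; rewrite oppr0 raddf0.
Qed.

Lemma Omega_lreg b : Omega * b = 0 -> b = 0.
Proof.
have [q [rho_q _]] := rho_grading.
apply: (Omega_regular F W rho_surj rho_ker rho_f rho_q qhess_exact pi_f Omega_central _ pi_surj).
by move=> a /pi_kernel.
Qed.

(** An element of the ideal of [A] is [sum_i s_i f_i] with two-sided coefficients; in [B] only
    [i = k] remains, and centrality collects the coefficient on one side. *)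
Lemma exists_tau : exists tau : khom B A, (forall t, tau (pi t) = rho t) /\
  (forall b, tau b = 0 <-> exists c, b = Omega * c).
Proof.
have [|tau tauP] := khom_factor (rho := rho) pi_surj.
  move=> t /pi_kernel pt; apply/rho_kernel.
  have Sg := ideal_genP (fun r => exists i, r = f i).
  apply: pt => // r [i _ [->|->]]; first by apply: ideal_gen_sub; exists i.
  have fk : ideal_gen (fun r => exists i, r = f i) (f k) by apply: ideal_gen_sub; exists k.
  apply: (idealB Sg).
    by have := idealM Sg (x i) 1 fk; rewrite mulr1.
  by have := idealM Sg 1 (x i) fk; rewrite mul1r.
exists tau; split=> // b; split=> [|[c ->]]; last first.
  by rewrite rmorphM tauP rho_f mul0r.
have [t <-] := pi_surj b; rewrite tauP => /rho_ker[s ->].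
exists (pi (eact (s k) 1)); rewrite raddf_sum (bigD1 k) //=.
rewrite (pi_eact pi_f Omega_central) eqxx big1 ?addr0 // => i ik.
by rewrite (pi_eact pi_f Omega_central) (negPf ik).
Qed.

Section Hessian.
Variable EB : envModel B.
Local Notation H := (qhess EB D f pi).

Lemma pi_hess_deg (q : nat -> {linear kmod B -> kmod B}) :
  (forall i t, pi (p i t) = q i (pi t)) ->
  forall i j, ecomp EB q m.+1.-1%:Z (H i j) = H i j.
Proof. by move=> pi_q i j; rewrite qhessE -(ehom_comp EB pi_q) (pt_Ddeg W). Qed.

Lemma pi_hess_diff : H *m diff_col EB (pi \o x) = ediff EB Omega *: delta_mx k 0.
Proof.
apply/colP => i; rewrite !mxE eqxx andbT.
transitivity (ehom E EB pi (\sum_j D j (f i) * ediff E (x j))).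
  rewrite raddf_sum; apply: eq_bigr => j _ /=.
  by rewrite qhessE rmorphM /= ehom_diff mxE.
rewrite (uder_euler (fd_gen F) (fd_D1 F) (fd_DX F)) ehom_diff.
have [->|ik] := eqVneq i k; first by rewrite mulr1.
by rewrite pi_f // mulr0 /ediff et0l et0r subrr.
Qed.

Variable tau : khom B A.
Hypothesis tauP : forall t, tau (pi t) = rho t.

Lemma tau_diff_col : map_mx (ehom EB EA tau) (diff_col EB (pi \o x)) = diff_col EA y.
Proof. by rewrite ehom_diff_col; apply/colP => i; rewrite !mxE /= tauP. Qed.

Lemma tau_hess : map_mx (ehom EB EA tau) H = qhess EA D f rho.
Proof. by apply/matrixP => i j; rewrite mxE !qhessE (ehom_ehom EB EA tauP). Qed.

Lemma tau_diff_exact (v : 'rV[EA]_n) :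
  v *m map_mx (ehom EB EA tau) (diff_col EB (pi \o x)) = 0 ->
  exists u : 'rV_n, v = u *m map_mx (ehom EB EA tau) H.
Proof.
rewrite tau_diff_col tau_hess; exact: (diff_col_exact F rho_surj rho_ker rho_f).
Qed.

Lemma tau_hess_exact (v : 'rV[EA]_n) : v *m map_mx (ehom EB EA tau) H = 0 ->
  exists u : 'M_1, v = u *m map_mx (ehom EB EA tau) (diff_col EB (pi \o x))^T.
Proof. by rewrite tau_hess -map_trmx tau_diff_col; apply: qhess_exact. Qed.

Lemma tau_row_inj (v : 'M[EA]_1) :
  v *m map_mx (ehom EB EA tau) (diff_col EB (pi \o x))^T = 0 -> v = 0.
Proof. by rewrite -map_trmx tau_diff_col; apply: diff_row_inj. Qed.

End Hessian.

Variable gr : nat -> B -> Prop.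
Hypothesis grP : forall i b, gr i b <-> exists2 t, p i t = t :> T & b = pi t.

Lemma extension_resolution : exists (P : fg_proj_resolution gr) (l : int),
  (forall i, i != 4%N -> ext_vanishes P i) /\ ext_is_twisted P 4 idfun l.
Proof.
have [q [pi_q qP]] := pi_grading.
have grq i b : gr i b <-> q i b = b :> B.
  by rewrite grP; apply: (quotient_degP pP pi_surj pi_q).
have [tau [tauP tau_ker]] := exists_tau.
have tau_surj a : exists b, tau b = a.
  by have [t <-] := rho_surj a; exists (pi t).
have Om_deg : q m.+1 Omega = Omega :> B by rewrite -pi_q (pt_deg W).
have tau_Om : tau Omega = 0 by rewrite tauP rho_f.
have x_deg i : q 1%N ((pi \o x) i) = (pi \o x) i :> B.
  by rewrite /= -pi_q (fd_x F).
exists (cone_resolution tau_surj (fun b => proj1 (tau_ker b)) tau_Om Omega_central Omega_lreg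
  qP Om_deg (ltn0Sn m) (rho_gen F pi_surj) x_deg (pi_hess_deg (env_model B) pi_q) (pi_hess_diff (env_model B))
  (mswap_qhess (env_model B) W pi) (tau_diff_exact tauP) (tau_hess_exact tauP) (tau_row_inj tauP) grq).
exists (m.+1%:Z + 1 + m.+1%:Z).
exact: cone_resolution_ext.
Qed.

End CentralExtension.

Section ExtOfResolution.
Context {K : fieldType} {A : kalgType K} (gr : nat -> A -> Prop).
Variable P : fg_proj_resolution gr.
Local Notation E := (env_model A).
Variables (n : nat) (x : 'I_n -> A) (H : 'M[E]_n).
Hypotheses (xgen : generates x)
  (Xexact : forall v : 'rV_n, v *m diff_col E x = 0 -> exists y, v = y *m H).

Lemma ext_vanishes0 : ext_vanishes P 0 ->
  forall c : E, (forall i, ediff E (x i) * c = 0) -> c = 0.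
Proof.
move=> ext0.
apply (@ext0_ker K A E n x xgen (res_P P 0) (res_P P 1) (res_d P 0) (res_eps P)
  (@res_proj _ _ _ P 0) (@res_eps_lin _ _ _ P) (@res_eps_surj _ _ _ P) (@res_exact0 _ _ _ P)).
move=> f fL fd; exact (ext0 f (conj fL fd)).
Qed.

Lemma ext_vanishes1 : ext_vanishes P 1 ->
  forall c : 'cV[E]_n, H *m c = 0 -> exists b : 'M_1, c = diff_col E x *m b.
Proof.
move=> ext1.
apply (@ext1_exact K A E n x H xgen Xexact (res_P P 0) (res_P P 1) (res_P P 2)
  (res_d P 0) (res_d P 1) (res_eps P) (@res_proj _ _ _ P 0) (@res_eps_lin _ _ _ P)
  (@res_eps_surj _ _ _ P) (@res_exact0 _ _ _ P)).
  by move=> q; apply/res_exact; exists q.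
move=> f fL fd; exact (ext1 f (conj fL fd)).
Qed.

End ExtOfResolution.

Section QuotientGradedAlgebra.
Context {K : fieldType} {T B : kalgType K}.
Variables (p : nat -> {linear kmod T -> kmod T}) (q : nat -> {linear kmod B -> kmod B}).
Variable pi : khom T B.
Hypotheses (pP : gproj p) (qP : gproj q) (pi_surj : forall b, exists t, pi t = b)
  (pi_q : forall i t, pi (p i t) = q i (pi t))
  (p0 : forall a : T, exists c : K, p 0%N a = kscal c :> T)
  (pi_ker0 : forall t, pi t = 0 -> p 0%N t = 0 :> T) (T1 : (1 : T) != 0).
Variable gr : nat -> B -> Prop.
Hypothesis grq : forall i b, gr i b <-> q i b = b :> B.

Lemma quotient_ga_1 : gr 0%N 1.
Proof. by apply/grq/(gproj_1 qP). Qed.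

Lemma quotient_ga_M i j a b : gr i a -> gr j b -> gr (i + j)%N (a * b).
Proof. by move=> /grq qa /grq qb; apply/grq/(gproj_M qP). Qed.

Lemma quotient_ga_nz : (1 : B) != 0.
Proof.
apply/eqP; rewrite -(rmorph1 pi) => /pi_ker0.
by rewrite (gproj_1 pP) => /eqP; rewrite (negPf T1).
Qed.

Lemma quotient_ga_connected a : gr 0%N a -> exists c : K, a = kscal c.
Proof.
move=> /grq <-; have [t <-] := pi_surj a; rewrite -pi_q.
by have [c ->] := p0 t; exists c; rewrite khomZ.
Qed.

End QuotientGradedAlgebra.

Lemma central_regularP (R : pzRingType) (z : R) :
  (forall b, z * b = b * z) -> (forall b, z * b = 0 -> b = 0) -> central_regular z.
Proof.
move=> zC zreg; split=> // a b e; apply/eqP; rewrite -subr_eq0; apply/eqP/zreg.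
  by rewrite mulrBr e subrr.
by rewrite mulrBr !zC e subrr.
Qed.

Lemma tensor_nontrivial (K : fieldType) n : (1 : tensor_alg K n) != 0.
Proof.
apply/eqP => e; have : wcoef [::] (wordX [::] : tensor_alg K n) = 0.
  by rewrite wordX0 e linear0.
by rewrite /wcoef wextE eqxx => /eqP; rewrite oner_eq0.
Qed.

Lemma id_graded_automorphism (K : fieldType) (A : kalgType K) (gr : nat -> A -> Prop) :
  graded_automorphism gr idfun.
Proof. by split=> //; exists idfun. Qed.

Lemma quotient_by_kernel (K : fieldType) (A B : kalgType K) (tau : khom B A) (z : B) :
    (forall a, exists b, tau b = a) -> (forall b, tau b = 0 <-> exists c, b = z * c) ->
  exists g : khom (quot_alg (eq z)) A,
    (forall b, g (quot_pi (eq z) b) = tau b) /\ bijective g.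
Proof.
move=> tau_surj tau_ker.
have tz : tau z = 0 by apply/tau_ker; exists 1; rewrite mulr1.
have [|g gP] := khom_factor (rho := tau) (@quot_khom_surj K B (eq z)).
  move=> b /quot_khom_ker; apply: ideal_gen_ker; first exact: raddfB.
  by move=> a _ c <-; rewrite !rmorphM tz mulr0 mul0r.
exists g; split=> //; apply: bijectivePn => [a b gab|a]; last first.
  by have [b <-] := tau_surj a; exists (quot_khom (eq z) b); apply: gP.
have [s es] : exists s, quot_khom (eq z) s = a - b := quot_khom_surj _.
apply/eqP; rewrite -subr_eq0 -es; apply/eqP/quot_khom_ker.
have /tau_ker[c ->] : tau s = 0 by rewrite -gP es rmorphB gab subrr.
have zz : ideal_gen (eq z) z by apply: ideal_gen_sub.
by have := idealM (ideal_genP (eq z)) 1 c zz; rewrite mul1r.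
Qed.

(** * The extension of the algebra of a superpotential *)

Section CentralExtensionTheorem.
Context {K : fieldType} {n m : nat} (w : tensor_alg K n) (k : 'I_n).
Hypotheses (hw : superpotential m.+2 w)
  (hCY : calabi_yau (quot_deg (jacobian_rel w)) 3).
Local Notation T := (tensor_alg K n).
Local Notation A := (jacobian_alg w).
Local Notation B := (extension_alg w k).
Local Notation E := (env_model T).
Local Notation EA := (env_model A).
Local Notation rho := (quot_khom (jacobian_rel w)).
Local Notation pi := (quot_khom (extension_rel w k)).
Local Notation f := (fun i => pderiv i w).
Local Notation Wd := (fun j => wuder E j : {linear kmod T -> kmod E}).
Local Notation wp := (fun d => wproj d : {linear kmod T -> kmod T}).

Let F := tensor_free_data E.
Let W := tensor_potential E hw.
Let rho_surj := @quot_khom_surj K T (jacobian_rel w).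
Let pi_surj := @quot_khom_surj K T (extension_rel w k).
Let rho_kernel := @quot_khom_ker K T (jacobian_rel w).
Let pi_kernel := @quot_khom_ker K T (extension_rel w k).

Lemma jacobian_ext0 (c : EA) :
  (forall i, ediff EA ((rho \o @tX K n) i) * c = 0) -> c = 0.
Proof.
have [_ _ [P [l [van _]]]] := hCY.
exact: (ext_vanishes0 (P := P) (rho_gen F rho_surj) (van 0%N isT)).
Qed.

Lemma jacobian_ext1 (c : 'cV[EA]_n) : qhess EA Wd f rho *m c = 0 ->
  exists b : 'M_1, c = diff_col EA (rho \o @tX K n) *m b.
Proof.
have [_ _ [P [l [van _]]]] := hCY.
apply: (ext_vanishes1 (P := P) (rho_gen F rho_surj) _ (van 1%N isT)).
exact: (diff_col_exact F rho_surj (rho_ker E rho_kernel) (rho_f rho_kernel)).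
Qed.

Lemma extension_gradingP : exists q : nat -> {linear kmod B -> kmod B},
  [/\ forall i t, pi (wproj i t) = q i (pi t), gproj q &
    forall i b, quot_deg (extension_rel w k) i b <-> q i b = b :> B].
Proof.
have [q [pi_q qP]] := pi_grading F W pi_surj pi_kernel.
exists q; split=> // i b.
rewrite -(quotient_degP wproj_gproj pi_surj pi_q).
by split=> -[t /wproj_deg pt ->]; exists t.
Qed.

Lemma extension_presented : exists (n' : nat) (g : {rmorphism tensor_alg K n' -> B})
    (rs : seq (tensor_alg K n')),
  [/\ forall c, g (kscal c) = kscal c, forall a, exists t, g t = a,
      forall i : 'I_n', quot_deg (extension_rel w k) 1 (g (tX i))
    & forall t, g t = 0 <-> ideal_gen (fun r => r \in rs) t].
Proof.
pose rs := [seq f i | i <- enum 'I_n & i != k] ++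
  [seq commutator (tX i) (f k) | i <- enum 'I_n & i != k].
have rsP r : (r \in rs) <-> extension_rel w k r.
  rewrite mem_cat; split=> [/orP[] /mapP[i]|[i ik [->|->]]].
  - by rewrite mem_filter => /andP[ik _] ->; exists i => //; left.
  - by rewrite mem_filter => /andP[ik _] ->; exists i => //; right.
  - by apply/orP; left; apply: map_f; rewrite mem_filter ik mem_enum.
  - by apply/orP; right; apply: map_f; rewrite mem_filter ik mem_enum.
exists n, pi, rs; split=> [c|b|i|t].
- exact: khomZ.
- exact: pi_surj.
- by exists (tX i) => //; apply/wproj_deg; apply: wproj1_tX.
- rewrite pi_kernel; split=> It J JP SJ; apply: It => // s Ss.
    by apply: SJ; apply/rsP.
  by apply: SJ; apply/rsP.
Qed.

Lemma extension_graded : graded_algebra (quot_deg (extension_rel w k)).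
Proof.
have [q [pi_q qP grq]] := extension_gradingP.
split.
- exact: (gproj_grading qP grq).
- exact: (quotient_ga_1 qP grq).
- exact: (quotient_ga_M qP grq).
- exact: (quotient_ga_nz wproj_gproj (pi_ker0 F W pi_kernel) (@tensor_nontrivial K n)).
- exact: (quotient_ga_connected pi_surj pi_q wproj0_scal grq).
- exact: extension_presented.
Qed.

Lemma extension_calabi_yau : calabi_yau (quot_deg (extension_rel w k)) 4.
Proof.
split; [exact: extension_graded | exact: id_graded_automorphism |].
apply: (extension_resolution F W rho_surj rho_kernel pi_surj pi_kernel
  jacobian_ext0 jacobian_ext1) => i b.
by split=> -[t /wproj_deg pt ->]; exists t.
Qed.

Local Notation Omega := (quot_pi (extension_rel w k) (pderiv k w) : B).

Lemma extension_central_regular : central_regular Omega.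
Proof.
have OC : forall b : B, Omega * b = b * Omega := Omega_central F W pi_surj pi_kernel.
have OR : forall b : B, Omega * b = 0 -> b = 0.
  exact: (Omega_lreg F W rho_surj rho_kernel pi_surj pi_kernel jacobian_ext1).
exact: central_regularP OC OR.
Qed.

Lemma extension_quotient : exists g : {rmorphism quot_alg (eq Omega) -> A},
  [/\ forall c, g (kscal c) = kscal c, bijective g
    & forall t : T, g (quot_pi (eq Omega) (quot_pi (extension_rel w k) t))
        = quot_pi (jacobian_rel w) t].
Proof.
have [tau [tauP tau_ker]] := exists_tau F W rho_kernel pi_surj pi_kernel.
have tau_surj a : exists b, tau b = a.
  by have [t <-] := rho_surj a; exists (pi t).
have [g [gP gbij]] := quotient_by_kernel tau_surj tau_ker.
exists g; split=> [c||t]; first exact: khomZ; first exact: gbij.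
exact: (etrans (gP (pi t)) (tauP t)).
Qed.

End CentralExtensionTheorem.

Theorem corollary1p2 (K : fieldType) (n m : nat) (w : tensor_alg K n)
  (k : 'I_n) (hm : (2 <= m)%N) (hw : superpotential m.+1 w)
  (hCY : calabi_yau (quot_deg (jacobian_rel w)) 3) :
  let Omega : extension_alg w k := quot_pi (extension_rel w k) (pderiv k w) in
  [/\ calabi_yau (quot_deg (extension_rel w k)) 4,
      central_regular Omega
    & exists f : {rmorphism quot_alg (eq Omega) -> jacobian_alg w},
        [/\ forall c, f (kscal c) = kscal c, bijective f
          & forall p : tensor_alg K n,
              f (quot_pi (eq Omega) (quot_pi (extension_rel w k) p))
              = quot_pi (jacobian_rel w) p]].
Proof.
(* In terms of the new [m], [Omega] has degree [m.+1], visibly positive, as the descent on degrees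
   requires. *)
case: m hm hw => [//|m] _ hw; split.
- exact: extension_calabi_yau hw hCY.
- exact: extension_central_regular hw hCY.
- exact: extension_quotient hw.
Qed.
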